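(* Unless P=NP, the ROPAS problem (with both the dag width and the number of workers unconstrained) cannot be approximated within any factor less than $5/4$; that is, for no constant $\rho<5/4$ is there a polynomial-time algorithm that on every instance of ROPAS outputs a regimen whose expected completion time is at most $\rho$ times the minimum expected completion time.
   Context: Model. Let $\mathcal G$ be a finite dag whose nodes (tasks) are $N=\{1,\dots,t\}$; an arc $(u\to v)$ means $v$ cannot be executed before $u$. A set $X\subseteq N$ satisfies precedence constraints if every parent of every task in $X$ belongs to $X$; for such $X$, $E(X)$ denotes the set of tasks not in $X$ all of whose parents lie in $X$. There are $n$ workers $[n]$ and probabilities $0\le p_{i,j}\le 1$ such that for every task $j$ some worker $i$ has $p_{i,j}>0$. A regimen $\Sigma$ assigns to every precedence-satisfying set $Z$ a function $\Sigma(Z):[n]\to E(Z)\cup\{\perp\}$ ($\perp$ = idle). Execution from a precedence-satisfying $X$: start with $Y=X$; each round every worker $i$ with $\Sigma(Y)(i)=j\ne\perp$ attempts $j$, succeeding with probability $p_{i,j}$ independently of all other attempts; a task is executed iff at least one worker assigned to it succeeds, and executed tasks are added to $Y$. The process ends once $Y$ contains every sink. The completion time is the number of rounds until the process ends when starting from $X=\emptyset$. ROPAS: given $\mathcal G$, $n$ and rational $(p_{i,j})$, find a regimen minimizing the expected completion time. *)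

(* Defs.v *)
From HB Require Import structures.
From mathcomp Require Import all_boot all_order all_algebra.
From mathcomp Require Import all_classical all_reals all_analysis.

Set Implicit Arguments.
Unset Strict Implicit.
Unset Printing Implicit Defensive.
Import Order.TTheory GRing.Theory Num.Theory.

(** * Deterministic multi-tape Turing machines *)

(* [None] is the blank. *)
Definition symbol : Type := option bool.

(* A two-way infinite tape: the cells to the left of the head, nearest first,
   and the cells from the head rightwards; all unlisted cells are blank. *)
Definition tape : Type := (seq symbol * seq symbol)%type.

Inductive move : Type := Left | Stay | Right.

Definition read_tape (t : tape) : symbol := head None t.2.

Definition write_tape (a : symbol) (t : tape) : tape := (t.1, a :: behead t.2).

Definition move_tape (m : move) (t : tape) : tape :=
  match m with
  | Left => (behead t.1, head None t.1 :: t.2)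
  | Stay => t
  | Right => (head None t.2 :: t.1, behead t.2)
  end.

Record tm : Type := TM {
  tm_state : finType;
  tm_extra : nat;  (* the machine has [tm_extra.+1] tapes *)
  tm_start : tm_state;
  tm_halt : pred tm_state;
  tm_trans : tm_state -> {ffun 'I_tm_extra.+1 -> symbol} ->
             tm_state * ('I_tm_extra.+1 -> symbol * move) }.

Definition config (M : tm) : Type :=
  (tm_state M * {ffun 'I_(tm_extra M).+1 -> tape})%type.

Definition tm_step (M : tm) (c : config M) : config M :=
  if tm_halt c.1 then c else
  let a := tm_trans c.1 [ffun i => read_tape (c.2 i)] in
  (a.1, [ffun i => move_tape (a.2 i).2 (write_tape (a.2 i).1 (c.2 i))]).

(* The input is on tape 0, with the head on its first symbol. *)
Definition tm_init (M : tm) (x : seq bool) : config M :=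
  (tm_start M,
   [ffun i => if i == ord0 then ([::], [seq Some b | b <- x]) else ([::], [::])]).

Fixpoint bits_until_blank (s : seq symbol) : seq bool :=
  if s is Some b :: s' then b :: bits_until_blank s' else [::].

(* The output is the word on tape 0 from the head up to the first blank. *)
Definition tm_output (M : tm) (c : config M) : seq bool :=
  bits_until_blank (c.2 ord0).2.

(* Halted configurations are fixed by [tm_step], so this says that [M] halts on
   [x] after at most [s] steps, with output [y]. *)
Definition computes_within (M : tm) (s : nat) (x y : seq bool) : Prop :=
  let c := iter s (@tm_step M) (tm_init M x) in
  tm_halt c.1 /\ tm_output c = y.

(* [f] is computed in time polynomial in the length of the encoded input; nothing
   is required on strings that encode no element of [T]. *)
Definition poly_time (T U : Type) (encT : T -> seq bool) (encU : U -> seq bool)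
    (f : T -> U) : Prop :=
  exists (M : tm) (c d : nat), forall x : T,
    computes_within M (c * size (encT x) ^ d + c) (encT x) (encU (f x)).

(** * P and NP *)

Definition language : Type := set (seq bool).

Definition enc_bool (b : bool) : seq bool := [:: b].

(* A self-delimiting code: each bit is preceded by [true], and [false] ends. *)
Definition enc_word (x : seq bool) : seq bool :=
  flatten [seq [:: true; b] | b <- x] ++ [:: false].

Definition enc_pair (xw : seq bool * seq bool) : seq bool :=
  enc_word xw.1 ++ xw.2.

Definition classP : set language := fun L =>
  exists f : seq bool -> bool,
    poly_time id enc_bool f /\ forall x, L x <-> f x.

Definition classNP : set language := fun L =>
  exists (V : seq bool * seq bool -> bool) (c d : nat),
    poly_time enc_pair enc_bool V /\
    forall x, L x <-> exists w, size w <= c * size x ^ d + c /\ V (x, w).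

(** * ROPAS instances *)

Local Open Scope ring_scope.

Record instance : Type := Instance {
  ntasks : nat;
  nworkers : nat;
  dag_arc : rel 'I_ntasks;  (* [dag_arc u v]: [v] cannot be executed before [u] *)
  prob : 'I_nworkers -> 'I_ntasks -> rat;
  dag_acyclic : forall c : seq 'I_ntasks, c != [::] -> ~~ cycle dag_arc c;
  prob_ge0 : forall i j, 0 <= prob i j;
  prob_le1 : forall i j, prob i j <= 1;
  prob_gt0 : forall j, exists i, 0 < prob i j }.

Definition tasks (I : instance) : finType := 'I_(ntasks I).
Definition workers (I : instance) : finType := 'I_(nworkers I).

Definition prec_closed (I : instance) (X : {set tasks I}) : bool :=
  [forall v in X, forall u, dag_arc u v ==> (u \in X)].

Definition eligible (I : instance) (X : {set tasks I}) : {set tasks I} :=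
  [set v | (v \notin X) && [forall u, dag_arc u v ==> (u \in X)]]%SET.

Definition sink (I : instance) (v : tasks I) : bool := [forall u, ~~ dag_arc v u].

Definition finished (I : instance) (Y : {set tasks I}) : bool :=
  [forall v, sink v ==> (v \in Y)].

(* [None] is the idle assignment. *)
Definition assignment (I : instance) : Type := workers I -> option (tasks I).

(* Only the values at precedence-satisfying sets are meaningful. *)
Definition policy (I : instance) : Type := {set tasks I} -> assignment I.

Definition is_regimen (I : instance) (s : policy I) : Prop :=
  forall Z, prec_closed Z ->
  forall i j, s Z i = Some j -> j \in eligible Z.

(** * Execution of a regimen *)

Section Execution.
Variables (I : instance) (s : policy I).

Definition success_prob (Y : {set tasks I}) (i : workers I) : rat :=
  if s Y i is Some j then prob i j else 0.

(* The probability that, in a round started at [Y], the workers whose attempts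
   succeed are exactly those in [W]. *)
Definition outcome_prob (Y : {set tasks I}) (W : {set workers I}) : rat :=
  \prod_i (if i \in W then success_prob Y i else 1 - success_prob Y i).

Definition after_round (Y : {set tasks I}) (W : {set workers I}) : {set tasks I} :=
  (Y :|: [set j | [exists i in W, s Y i == Some j]])%SET.

Definition round_prob (Y Y' : {set tasks I}) : rat :=
  \sum_(W : {set workers I} | after_round Y W == Y') outcome_prob Y W.

(* The probability that the execution from [X] lasts at least [k] rounds and that
   the executed set after [k] rounds is [Y]. *)
Fixpoint reach_prob (X : {set tasks I}) (k : nat) (Y : {set tasks I}) : rat :=
  if k is k'.+1 then
    \sum_(Z : {set tasks I} | ~~ finished Z) reach_prob X k' Z * round_prob Z Y
  else (Y == X)%:R.

(* The probability that the execution from [X] ends after exactly [k] rounds. *)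
Definition end_prob (X : {set tasks I}) (k : nat) : rat :=
  \sum_(Y : {set tasks I} | finished Y) reach_prob X k Y.

Local Open Scope ereal_scope.

(* The sum of k P(T = k) over finite k, plus +oo * P(T = +oo) (with +oo * 0 = 0),
   where T is the completion time. *)
Definition expected_time (R : realType) : \bar R :=
  \sum_(0 <= k <oo) (k%:R * ratr (end_prob finset.set0 k))%:E
  + +oo * (1 - \sum_(0 <= k <oo) (ratr (end_prob finset.set0 k))%:E).

End Execution.

(* There are finitely many policies, so the infimum is a minimum. *)
Definition min_expected_time (R : realType) (I : instance) : \bar R :=
  ereal_inf [set expected_time s R | s in [set s : policy I | is_regimen s]]%classic.

(** * Encodings and approximation algorithms *)

Definition enc_unary (m : nat) : seq bool := nseq m true ++ [:: false].

(* Binary digits, least significant first. *)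
Definition enc_binary (m : nat) : seq bool :=
  enc_word [seq odd (m %/ 2 ^ e) | e <- iota 0 (trunc_log 2 m).+1].

(* The sign is dropped: only used on nonnegative rationals. *)
Definition enc_rat (q : rat) : seq bool :=
  enc_binary `|numq q|%N ++ enc_binary `|denq q|%N.

(* The numbers of tasks and workers are in unary: an instance lists its tasks and
   its workers, so its size is at least their number. *)
Definition enc_instance (I : instance) : seq bool :=
  enc_unary (ntasks I) ++ enc_unary (nworkers I)
  ++ [seq dag_arc u v | u <- enum (tasks I), v <- enum (tasks I)]
  ++ flatten [seq enc_rat (prob i j) | i <- enum (workers I), j <- enum (tasks I)].

Definition enc_set (I : instance) (Z : {set tasks I}) : seq bool :=
  [seq v \in Z | v <- enum (tasks I)].

(* Idle is 0, and task [j] is [j.+1]. *)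
Definition enc_assignment (I : instance) (a : assignment I) : seq bool :=
  flatten [seq enc_unary (if a i is Some j then (j : 'I_(ntasks I)).+1 else 0%N)
          | i <- enum (workers I)].

Record query : Type := Query {
  query_inst : instance;
  query_set : {set tasks query_inst};
  query_desc : seq bool }.

(* The first two parts are self-delimiting. *)
Definition enc_query (q : query) : seq bool :=
  enc_instance (query_inst q) ++ enc_set (query_set q) ++ query_desc q.

(* A regimen is in general an exponentially large table, so an algorithm outputs
   a description [w] of it.  A representation scheme is a map [ev] giving the
   encoded assignment that [w] prescribes at a set of tasks of an instance; any
   scheme that can be evaluated in polynomial time is allowed (tables included). *)
Definition describes (ev : query -> seq bool) (I : instance) (w : seq bool)
    (s : policy I) : Prop :=
  forall Z, prec_closed Z -> ev (Query Z w) = enc_assignment (s Z).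

Definition poly_time_approximable (R : realType) (rho : R) : Prop :=
  exists (ev : query -> seq bool) (alg : instance -> seq bool),
    [/\ poly_time enc_query id ev,
        poly_time enc_instance id alg
      & forall I : instance, exists s : policy I,
          [/\ is_regimen s, describes ev (alg I) s
            & (expected_time s R <= rho%:E * min_expected_time R I)%E]].

(* Main.v *)
Require Import Defs.
From HB Require Import structures.
From mathcomp Require Import all_boot all_order all_algebra.
From mathcomp Require Import all_classical all_reals all_analysis.
From mathcomp Require Import zify.
Set Implicit Arguments.
Unset Strict Implicit.
Unset Printing Implicit Defensive.
Import Order.TTheory GRing.Theory Num.Theory.

                                                                                   
                                                                                
                                                                                   
                                                                                    
                                                                                   
                                                                                   
                                                                                     
                                                                                      
                                                                                    
                                                                                    
                                                                            

                                                

(** An approximation within a ratio below 5/4 yields a polynomial-time decision procedure for every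
    language in NP, so P would equal NP.

    The gap. For clauses of at most six literals, [gadget] has two literal tasks and one capable
    worker per variable, and six tasks and five capable workers per clause; each clause task waits
    for the literal in its slot. All success probabilities are 0 or 1, so execution is deterministic
    and the expected completion time is the round of completion, or infinite ([expected_time_le],
    [expected_time_lt]). A satisfying assignment gives a regimen of three rounds: the true literals;
    then the false literals together with one task per clause whose slot holds a true literal; then
    the five remaining tasks of each clause ([gadget_complete]). Conversely, if a regimen ends
    within three rounds, its first-round choices satisfy every clause: a clause without a true
    literal would have no task executed after two rounds, and its six tasks would compete for five
    workers in the third ([gadget_sound]). As 5/4 times 3 is below 4, a good approximation on a
    satisfiable instance ends within three rounds, and its first round displays a satisfying
    assignment.

    The formula. The clauses come straight from a language L in NP, in the manner of Cook and Levin: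
    they describe the tableau of the verifier on [enc_word x] followed by an unknown witness
    ([clauses_sound], [clauses_complete]). The tableau is a single sequence of tiles, in which a
    clause looks only at bounded data and at fixed backward distances, so that the instance has a
    regular adjacency matrix ([enc_tab_instance]).

    The decision. On input x, build the instance, run the approximation algorithm, evaluate the
    regimen it describes at the empty set only, read a witness off the parities of the assigned task
    numbers, and run the verifier on x and this witness. A positive answer comes with a witness; if
    x is in L, the gap forces the witness found to be accepted ([extract_tab],
    [classNP_sub_classP]).

    Polynomial time is established on genuine Turing machines: programs of a small language are
    compiled to machines ([prog_tm]) and verified with timed triples ([does], [pdoes]), up to
    [decider_correct]. The inclusion of P in NP is obtained with the same tools
    ([classP_sub_classNP]). *)

(** * A small programming language and its compilation to Turing machines *)

Section Programs.
                                                                                 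
                                                                                     
(** Machines callable as subroutines: [Run j q off] stands for [mach j] in state [q], working on the
    block of tapes that starts at [off]. *)
Variable mach : nat -> tm.

                                                                                   
(** Control depends on the tapes only through single scanned symbols, of which there are three, so
    branching through a function on symbols remains finite. *)
Inductive cmd : Type :=
| Nop
| Act of nat & (symbol -> symbol) & move
| Seq of cmd & cmd
| Switch of nat & (symbol -> cmd)
| While of nat & pred symbol & cmd
| Run (j : nat) of tm_state (mach j) & nat.

HB.instance Definition _ := gen_eqMixin cmd.
HB.instance Definition _ := gen_choiceMixin cmd.

Definition machine_reads (M : tm) (off : nat) (r : nat -> symbol) :
    {ffun 'I_(tm_extra M).+1 -> symbol} := [ffun j => r (off + val j)].

                                                                          
                                    
(** A control state is a stack of pending commands. A step rewrites the top of the stack: loops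
    unfold in place, and a call advances the called machine by one transition. *)
Definition next_cont (u : seq cmd) (r : nat -> symbol) : seq cmd :=
  match u with
  | [::] => [::]
  | c :: K =>
    match c with
    | Nop => K
    | Act _ _ _ => K
    | Seq a b => a :: b :: K
    | Switch i f => f (r i) :: K
    | While i p b => if p (r i) then b :: c :: K else K
    | Run j q off =>
        if tm_halt q then K
        else Run (tm_trans q (machine_reads (mach j) off r)).1 off :: K
    end
  end.

Definition run_action (M : tm) (q : tm_state M) (off : nat) (r : nat -> symbol)
    (i : nat) : symbol * move :=
  if tm_halt q || (i < off) then (r i, Stay) else
  if insub (i - off) is Some j
  then (tm_trans q (machine_reads M off r)).2 j else (r i, Stay).

Definition head_action (u : seq cmd) (r : nat -> symbol) (i : nat) : symbol * move :=
  match u with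
  | Act j h mv :: _ => if i == j then (h (r j), mv) else (r i, Stay)
  | Run j q off :: _ => run_action q off r i
  | _ => (r i, Stay)
  end.

Definition act_tape (a : symbol * move) (t : tape) : tape :=
  move_tape a.2 (write_tape a.1 t).

Definition pconfig : Type := (seq cmd * (nat -> tape))%type.

Definition reads (ts : nat -> tape) (i : nat) : symbol := read_tape (ts i).

Definition pstep (c : pconfig) : pconfig :=
  if c.1 is [::] then c else
  (next_cont c.1 (reads c.2),
   fun i => act_tape (head_action c.1 (reads c.2) i) (c.2 i)).

(** A finite set closed enough to contain every non-empty stack reachable from [[:: c]]; together
    with the empty stack it is the state set of the compiled machine. A call contributes one stack
    per state of the called machine. *)
Fixpoint sub_conts (c : cmd) : seq (seq cmd) :=
  [:: c] ::
  match c with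
  | Nop => [::]
  | Act _ _ _ => [::]
  | Seq a b => [seq u ++ [:: b] | u <- sub_conts a] ++ sub_conts b
  | Switch i f => sub_conts (f None) ++ sub_conts (f (Some true))
                  ++ sub_conts (f (Some false))
  | While i p b => [seq u ++ [:: c] | u <- sub_conts b]
  | Run j q off => [seq [:: Run q' off] | q' <- enum (tm_state (mach j))]
  end.

Definition all_conts (c : cmd) : seq (seq cmd) := [::] :: sub_conts c.

Lemma sub_conts_self c : [:: c] \in sub_conts c.
Proof. by case: c => *; rewrite /= inE eqxx. Qed.

Lemma sub_conts_nonnil c u : u \in sub_conts c -> u != [::].
Proof.
elim: c u => [|i h mv|a IHa b IHb|i f IHf|i p b IHb|M q off] u /=; rewrite in_cons;
  case/orP=> [/eqP -> //|] //.
- rewrite mem_cat => /orP[/mapP[v _ ->]|]; last exact: IHb.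
  by case: v.
- by rewrite !mem_cat => /or3P[] /IHf.
- by case/mapP => v _ ->; case: v.
- by case/mapP => v _ ->.
Qed.

Lemma next_cont_cat u v r : u != [::] -> next_cont (u ++ v) r = next_cont u r ++ v.
Proof. by case: u => // -[] //= *; case: ifP. Qed.

Lemma next_cont_closed c u r :
  u \in sub_conts c -> next_cont u r \in all_conts c.
Proof.
elim: c u => [|i h mv|a IHa b IHb|i f IHf|i p b IHb|M q off] u /=; rewrite in_cons;
  case/orP=> [/eqP ->|] //=.
- by rewrite /all_conts /= !inE !mem_cat (map_f (fun u => u ++ [:: b]) (sub_conts_self a)) orbT.
- rewrite mem_cat => /orP[/mapP[v va ->]|ub].
    rewrite next_cont_cat ?(sub_conts_nonnil va) //.
    move: (IHa _ va); rewrite !inE => /orP[/eqP ->|w].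
      by rewrite /= mem_cat sub_conts_self !orbT.
    by rewrite mem_cat (map_f (fun u => u ++ [:: b]) w) !orbT.
  move: (IHb _ ub); rewrite !inE => /orP[->//|w].
  by rewrite mem_cat w !orbT.
- rewrite !inE !mem_cat.
  by case: (r i) => [[]|]; rewrite sub_conts_self !orbT.
- rewrite !mem_cat !inE !mem_cat => /or3P[] /IHf; rewrite !inE => /orP[->//|->];
  by rewrite !orbT.
- case: ifP => _; rewrite !inE //.
  by rewrite (map_f (fun u => u ++ [:: While i p b]) (sub_conts_self b)) !orbT.
- case/mapP => v va ->; rewrite next_cont_cat ?(sub_conts_nonnil va) //.
  move: (IHb _ va); rewrite !inE => /orP[/eqP -> /=|w].
    by rewrite eqxx.
  by rewrite (map_f (fun u => u ++ [:: While i p b]) w) !orbT.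
- case: ifP => _; rewrite !inE //.
  by rewrite (map_f (fun q' => [:: Run q' off])) ?mem_enum ?orbT.
- case/mapP => q' _ -> /=; case: ifP => _; rewrite !inE //.
  by rewrite (map_f (fun q' => [:: Run q' off])) ?mem_enum ?orbT.
Qed.

Definition cont_width (u : seq cmd) : nat :=
  match u with
  | Act i _ _ :: _ => i
  | Switch i _ :: _ => i
  | While i _ _ :: _ => i
  | Run j _ off :: _ => off + tm_extra (mach j)
  | _ => 0
  end.

(** Programs act on tapes indexed by all naturals; this bound on the indices consulted gives the
    compiled machine finitely many tapes. *)
Definition prog_width (c : cmd) : nat := \max_(u <- all_conts c) cont_width u.

Lemma prog_width_ge c u : u \in all_conts c -> cont_width u <= prog_width c.
Proof. by move=> uc; rewrite /prog_width; exact: leq_bigmax_seq. Qed.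

Definition ext_reads (m : nat) (r : {ffun 'I_m.+1 -> symbol}) (i : nat) : symbol :=
  if insub i is Some j then r j else None.

Definition start_cont (c : cmd) : seq_sub (all_conts c) :=
  @SeqSub _ (all_conts c) [:: c] (mem_behead (s := all_conts c) (sub_conts_self c)).

Definition prog_tm (c : cmd) : tm :=
  @TM (seq_sub (all_conts c)) (prog_width c) (start_cont c)
    (fun q => val q == [::])
    (fun q r => (insubd q (next_cont (val q) (ext_reads r)),
                 fun i => head_action (val q) (ext_reads r) (val i))).

Lemma next_cont_ext u r r' : (forall i, i <= cont_width u -> r i = r' i) ->
  next_cont u r = next_cont u r'.
Proof.
case: u => [|[|i h mv|a b|i f|i p b|M q off] u] //= rr.
- by rewrite rr.
- by rewrite rr.
- case: ifP => // _; congr (Run _ _ :: _); congr ((tm_trans _ _).1).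
  apply/ffunP => j; rewrite !ffunE rr // leq_add2l -ltnS; exact: ltn_ord.
Qed.

Lemma head_action_ext u r r' i : (forall i, i <= cont_width u -> r i = r' i) ->
  r i = r' i -> head_action u r i = head_action u r' i.
Proof.
case: u => [|[|j h mv|a b|j f|j p b|M q off] u] //= rr ri; rewrite ?ri ?rr //.
rewrite /run_action ri; case: ifP => // _; case: insubP => // j _ _.
congr ((tm_trans _ _).2 _).
apply/ffunP => k; rewrite !ffunE rr // leq_add2l -ltnS; exact: ltn_ord.
Qed.

Definition sim (c : cmd) (cf : config (prog_tm c)) (pc : pconfig) : Prop :=
  val cf.1 = pc.1 /\ forall i : 'I_(prog_width c).+1, cf.2 i = pc.2 i.

Lemma sim_step c cf pc : @sim c cf pc -> sim (tm_step cf) (pstep pc).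
Proof.
case: cf => [q t]; case: pc => [u ts] [/= qu tts].
have uc : u \in all_conts c by rewrite -qu; exact: valP.
have rr i : i <= cont_width u -> ext_reads [ffun j => read_tape (t j)] i = reads ts i.
  move=> iw; rewrite /ext_reads; case: insubP => [j _ ji|].
    by rewrite ffunE tts /reads ji.
  by rewrite ltnS (leq_trans iw (prog_width_ge uc)).
case: (eqVneq u [::]) => [u0|u0].
  have h : tm_halt q by rewrite /= qu u0.
  by rewrite /tm_step h u0; split; rewrite //= qu.
have -> : pstep (u, ts) = (next_cont u (reads ts),
    fun i => act_tape (head_action u (reads ts) i) (ts i)) by case: (u) u0.
have h : tm_halt q = false by rewrite /= qu (negPf u0).
rewrite /tm_step h.
split => [|i].
  rewrite [LHS]/= /insubd; case: insubP => [q' _ /= -> //|]; rewrite qu.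
    exact: next_cont_ext.
  (* The default value of [insubd] is never taken, since [all_conts] is closed under [next_cont]. *)
  rewrite (next_cont_ext rr) => /negP[].
  by move: uc; rewrite /all_conts inE (negPf u0) /=; exact: next_cont_closed.
rewrite [LHS]/= !ffunE tts /act_tape qu.
rewrite (@head_action_ext _ _ (reads ts) _ rr) //.
rewrite /ext_reads; case: insubP => [j _ ji|]; last by rewrite ltn_ord.
by rewrite ffunE tts /reads ji.
Qed.

Lemma sim_iter c n cf pc : @sim c cf pc ->
  sim (iter n (@tm_step (prog_tm c)) cf) (iter n pstep pc).
Proof. by move=> s; elim: n => //= n IH; exact: sim_step. Qed.

                                    

                                                                   
(** * Abstract tapes and timed triples for programs *)

Definition atape : Type := (seq symbol * int)%type.

Definition cell (s : seq symbol) (z : int) : symbol :=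
  if z is Posz k then @nth symbol None s k else None.

(** The abstract tape has a fixed origin, where its word starts, and an integer head position.
    Concrete tapes are only known up to trailing blanks, hence the comparison cell by cell. *)
Definition rep (t : tape) (a : atape) : Prop :=
  (forall k, @nth symbol None t.1 k = cell a.1 (a.2 - 1 - k%:Z)%R) /\
  (forall k, @nth symbol None t.2 k = cell a.1 (a.2 + k%:Z)%R).

Definition store : Type := nat -> atape.
Definition rep_store (ts : nat -> tape) (s : store) : Prop :=
  forall i, rep (ts i) (s i).

Definition scan (a : atape) : symbol := cell a.1 a.2.

Definition delta (m : move) : int :=
  match m with Left => (-1)%R | Stay => 0%R | Right => 1%R end.

Lemma rep_read t a : rep t a -> read_tape t = scan a.
Proof. by case=> _ /(_ 0%N); rewrite addr0 nth0. Qed.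

Lemma rep_move m t a : rep t a -> rep (move_tape m t) (a.1, (a.2 + delta m)%R).
Proof.
case: t => l r; case: a => s z [/= Hl Hr]; case: m => /=.
- split=> k /=.
    rewrite nth_behead Hl; congr cell; lia.
  case: k => [|k] /=; first by rewrite -nth0 Hl; congr cell; lia.
  by rewrite Hr; congr cell; lia.
- by split=> k /=; rewrite ?Hl ?Hr; congr cell; lia.
- split=> k /=.
    case: k => [|k] /=; first by rewrite -nth0 Hr; congr cell; lia.
    by rewrite Hl; congr cell; lia.
  by rewrite nth_behead Hr; congr cell; lia.
Qed.

Lemma rep_write_same t a : rep t a -> rep (write_tape (read_tape t) t) a.
Proof.
move=> [Hl Hr]; split=> k //=; case: k => [|k] /=.
  by rewrite -Hr nth0.
by rewrite nth_behead Hr.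
Qed.

Lemma rep_write_end t s x : rep t (s, Posz (size s)) ->
  rep (write_tape x t) (rcons s x, Posz (size s)).
Proof.
move=> [Hl Hr]; split=> k.
  rewrite /= Hl /=.
  case E : (Posz (size s) - 1 - Posz k)%R => [j|j] //=.
  have js : j < size s by lia.
  by rewrite nth_rcons js.
case: k => [|k] /=; first by rewrite addn0 nth_rcons ltnn eqxx.
rewrite nth_behead Hr /= nth_rcons [RHS]ifF ?ifF //; try lia.
by rewrite nth_default //; lia.
Qed.

Lemma rep_input s : rep ([::], s) (s, 0%R).
Proof.
split=> k //=.
by rewrite nth_nil; case E: (0 - 1 - Posz k)%R => [p|p] //; lia.
Qed.

Definition upd (s : store) (i : nat) (a : atape) : store :=
  fun j => if j == i then a else s j.

Lemma upd_eq s i a : upd s i a i = a.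
Proof. by rewrite /upd eqxx. Qed.

Lemma upd_ne s i j a : j <> i -> upd s i a j = s j.
Proof. by move=> /eqP ji; rewrite /upd (negPf ji). Qed.

(** A total-correctness triple with a time bound. The quantification over the rest [K] of the stack
    and over all tapes representing [s] is what makes triples compose. *)
Variant does (c : cmd) (n : nat) (s s' : store) : Prop :=
  Does of forall K ts, rep_store ts s ->
  exists m ts', [/\ m <= n, iter m pstep (c :: K, ts) = (K, ts') & rep_store ts' s'].

Lemma does_ext c n s s1 s2 : does c n s s1 -> (forall i, s1 i = s2 i) -> does c n s s2.
Proof.
case=> H e; split=> K ts /H-/(_ K) [m [ts' [mn E R]]]; exists m, ts'; split=> // i.
by rewrite -e.
Qed.

Lemma does_ext_l c n s1 s2 s : does c n s1 s -> (forall i, s1 i = s2 i) -> does c n s2 s.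
Proof. by case=> H e; split=> K ts R; apply: H => i; rewrite e. Qed.

Lemma does_le c n n' s s' : does c n s s' -> n <= n' -> does c n' s s'.
Proof.
case=> H nn; split=> K ts /H-/(_ K) [m [ts' [mn E R]]]; exists m, ts'; split=> //.
exact: leq_trans nn.
Qed.

Lemma rep_idle ts s (f : nat -> symbol * move) :
  (forall i, f i = (reads ts i, Stay)) -> rep_store ts s ->
  rep_store (fun i => act_tape (f i) (ts i)) s.
Proof. by move=> fE R i; rewrite fE /act_tape /=; exact: rep_write_same. Qed.

Lemma does_nop s : does Nop 1 s s.
Proof. by split=> K ts R; exists 1, (pstep (Nop :: K, ts)).2; split=> //; exact: rep_idle. Qed.

Lemma does_seq a b n1 n2 s s1 s2 : does a n1 s s1 -> does b n2 s1 s2 ->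
  does (Seq a b) (n1 + n2).+1 s s2.
Proof.
case=> Ha [Hb]; split=> K ts R.
have R0 : rep_store (pstep (Seq a b :: K, ts)).2 s by apply: rep_idle.
have [m1 [ts1 [m1n E1 /Hb-/(_ K)[m2 [ts2 [m2n E2 R2]]]]]] := Ha (b :: K) _ R0.
exists (m2 + m1.+1), ts2; split=> //; first lia.
by rewrite iterD iterSr [pstep _]surjective_pairing /= E1.
Qed.

Lemma does_switch i f n s s' : does (f (scan (s i))) n s s' ->
  does (Switch i f) n.+1 s s'.
Proof.
case=> H; split=> K ts R.
have R0 : rep_store (pstep (Switch i f :: K, ts)).2 s by apply: rep_idle.
have [m [ts1 [mn E1 R1]]] := H K _ R0.
exists m.+1, ts1; split=> //.
by rewrite iterSr [pstep _]surjective_pairing /= /reads (rep_read (R i)).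
Qed.

Lemma does_move i m s :
  does (Act i id m) 1 s (upd s i ((s i).1, ((s i).2 + delta m)%R)).
Proof.
split=> K ts R; exists 1, (pstep (Act i id m :: K, ts)).2; split=> // j /=.
rewrite /upd /act_tape; case: eqP => [->|_] /=; last exact: rep_write_same.
by apply: rep_move; exact: rep_write_same.
Qed.

Lemma does_emit i a s : (s i).2 = Posz (size (s i).1) ->
  does (Act i (fun=> a) Right) 1 s
    (upd s i (rcons (s i).1 a, Posz (size (s i).1).+1)).
Proof.
move=> e; split=> K ts R; exists 1, (pstep (Act i (fun=> a) Right :: K, ts)).2; split=> // j /=.
rewrite /upd /act_tape; case: eqP => [->|_] /=; last exact: rep_write_same.
have := R i; rewrite {1}[s i]surjective_pairing e => /(rep_write_end a) /(rep_move Right) /=.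
by rewrite -PoszD addn1.
Qed.

(** The family [S] plays the part of the loop invariant: [S k] is the store before round [k], and
    [m] is the exact number of rounds. *)
Lemma does_while i (p : pred symbol) c (S : nat -> store) m b :
  (forall k, k < m -> p (scan (S k i)) /\ does c b (S k) (S k.+1)) ->
  ~~ p (scan (S m i)) ->
  does (While i p c) (m * b.+1).+1 (S 0) (S m).
Proof.
elim: m S => [|m IH] S Hb Hp; split=> K ts R.
  exists 1, (pstep (While i p c :: K, ts)).2; split=> //; last by apply: rep_idle.
  by rewrite /= /pstep /= /reads (rep_read (R i)) (negPf Hp).
have [p0 [H0]] := Hb 0 isT.
have R0 : rep_store (pstep (While i p c :: K, ts)).2 (S 0) by apply: rep_idle.
have [m1 [ts1 [m1n E1 R1]]] := H0 (While i p c :: K) _ R0.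
have [|IH1] := IH (fun k => S k.+1) _ Hp; first by move=> k km; exact: Hb.
have [m2 [ts2 [m2n E2 R2]]] := IH1 K _ R1.
exists (m2 + m1.+1), ts2; split=> //; first lia.
rewrite iterD iterSr [pstep _]surjective_pairing.
have -> : (pstep (While i p c :: K, ts)).1 = c :: While i p c :: K.
  by rewrite /= /reads (rep_read (R i)) p0.
by rewrite E1.
Qed.

Lemma does_conv c n n' s s1 s2 : does c n s s1 -> (forall i, s1 i = s2 i) ->
  n <= n' -> does c n' s s2.
Proof. by move=> H e nn; apply: does_le nn; apply: does_ext e. Qed.

(** Equality up to trailing blanks. A called machine is started on tapes that agree with its initial
    ones only in this sense, and its transitions respect it. *)
Definition teq (t t' : tape) : Prop :=
  (forall k, @nth symbol None t.1 k = @nth symbol None t'.1 k) /\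
  (forall k, @nth symbol None t.2 k = @nth symbol None t'.2 k).

Lemma teq_read t t' : teq t t' -> read_tape t = read_tape t'.
Proof. by case=> _ /(_ 0); rewrite !nth0. Qed.

Lemma teq_act a t t' : teq t t' -> teq (act_tape a t) (act_tape a t').
Proof.
case: t => l r; case: t' => l' r' [/= Hl Hr]; case: a => x [] /=; split=> k /=;
  rewrite ?nth_behead ?Hl //; case: k => [|k] //=; rewrite ?nth_behead ?Hl ?Hr //;
  try by rewrite -!nth0.
by case: k => [|k] //=; rewrite !nth_behead Hr.
Qed.

Lemma teq_rep t t' a : teq t t' -> rep t' a -> rep t a.
Proof. by move=> [e1 e2] [r1 r2]; split=> k; rewrite ?e1 ?e2. Qed.

Definition of_tape (t : tape) : atape := (rev t.1 ++ t.2, Posz (size t.1)).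

Lemma rep_of_tape t : rep t (of_tape t).
Proof.
case: t => l r; split=> k /=; last by rewrite nth_cat size_rev ltnNge leq_addr /= addKn.
case E : (Posz (size l) - 1 - Posz k)%R => [j|j] /=; last by rewrite nth_default //; lia.
rewrite nth_cat size_rev ifT; last by lia.
by rewrite nth_rev; [congr nth; lia|lia].
Qed.

Lemma rep_teq t t' a : rep t a -> rep t' a -> teq t t'.
Proof. by move=> [e1 e2] [r1 r2]; split=> k; rewrite ?e1 ?e2 ?r1 ?r2. Qed.

Definition shows (a : atape) (y : seq bool) : Prop :=
  (forall k, k < size y -> cell a.1 (a.2 + k%:Z)%R = Some (nth false y k)) /\
  cell a.1 (a.2 + (size y)%:Z)%R = None.

Lemma bits_until_blankP s y :
  (forall k, k < size y -> @nth symbol None s k = Some (nth false y k)) ->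
  @nth symbol None s (size y) = None -> bits_until_blank s = y.
Proof.
elim: y s => [|b y IH] [|a s] //= H.
- by move=> ->.
- by have := H 0 isT.
- move=> e; have /= -> := H 0 isT; congr cons; apply: IH => // k ky.
  exact: (H k.+1).
Qed.

Lemma shows_bits a t y : rep t a -> shows a y -> bits_until_blank t.2 = y.
Proof.
by move=> [_ R] [s1 s2]; apply: bits_until_blankP => [k ky|]; rewrite R; [exact: s1|exact: s2].
Qed.

Lemma bits_until_blank_shows t : shows (of_tape t) (bits_until_blank t.2).
Proof.
have [_ R] := rep_of_tape t; split=> [k|]; rewrite -R.
  by elim: (t.2) k => [|[b|] s IH] [|k] //= /IH.
by elim: (t.2) => [|[b|] s IH].
Qed.

Lemma shows_self (y : seq bool) : shows ([seq Some b | b <- y], 0%R) y.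
Proof.
split=> [k ky|]; rewrite add0r /=; first by rewrite (nth_map false).
by rewrite nth_default ?size_map.
Qed.

Definition input_at (s : store) (off extra : nat) (x : seq bool) : Prop :=
  s off = ([seq Some b | b <- x], 0%R) /\
  forall j, 0 < j <= extra -> s (off + j) = ([::], 0%R).

(** The block at [off] follows the called machine step by step and the other tapes stay put; the
    additional step pops the halted call. *)
Lemma run_steps (jm : nat) (M := mach jm) off K n (q : tm_state M)
    (t : {ffun 'I_(tm_extra M).+1 -> tape}) ts :
  (forall j : 'I_(tm_extra M).+1, teq (ts (off + j)) (t j)) ->
  tm_halt (iter n (@tm_step M) (q, t)).1 ->
  exists m ts', [/\ m <= n.+1,
    iter m pstep (@Run jm q off :: K, ts) = (K, ts'),
    (forall j : 'I_(tm_extra M).+1,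
        teq (ts' (off + j)) ((iter n (@tm_step M) (q, t)).2 j)) &
    (forall i, ~ (off <= i <= off + tm_extra M) -> teq (ts' i) (ts i))].
Proof.
have idle (t0 : tape) : teq (act_tape (read_tape t0, Stay) t0) t0.
  by split=> k //; case: t0 => l [|a r] /=; case: k => //= -[].
elim: n q t ts => [|n IH] q t ts tts.
  move=> /= hq; exists 1, (pstep (@Run jm q off :: K, ts)).2; split=> //.
  - by rewrite /= /pstep /= hq.
  - move=> j; rewrite /= /run_action hq /=.
    by have [i1 i2] := idle (ts (off + j)); have [e1 e2] := tts j;
      split=> k; rewrite ?i1 ?i2 ?e1 ?e2.
  - by move=> i _; rewrite /= /run_action hq /=; exact: idle.
rewrite iterSr; case hq : (tm_halt q).
  have -> : tm_step (q, t) = (q, t) by rewrite /tm_step hq.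
  by move=> /(IH _ _ ts tts) [m [ts' [mn E T F]]]; exists m, ts'; split=> //; lia.
set r := machine_reads M off (reads ts).
have rE : [ffun i => read_tape (t i)] = r.
  by apply/ffunP => j; rewrite !ffunE /reads (teq_read (tts j)).
have -> : tm_step (q, t) = ((tm_trans q r).1,
    [ffun i => act_tape ((tm_trans q r).2 i) (t i)]) by rewrite /tm_step hq /= rE.
move=> h; have [|m [ts' [mn E T F]]] :=
  IH _ _ (pstep (@Run jm q off :: K, ts)).2 _ h.
- move=> j; rewrite ffunE /= /run_action hq /= ltnNge leq_addr /= addKn.
  case: insubP => [j' _ jj|]; last by rewrite ltn_ord.
  have -> : j' = j by exact: val_inj.
  exact: teq_act.
- exists m.+1, ts'; split=> //.
  + by rewrite iterSr [pstep _]surjective_pairing /= hq E.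
  + move=> i ni; have [f1 f2] := F i ni.
    have: teq ((pstep (@Run jm q off :: K, ts)).2 i) (ts i).
      rewrite /= /run_action hq /=; case: ltnP => oi /=; first exact: idle.
      case: insubP => [j ij _|_]; last exact: idle.
      by case: ni; rewrite /M; lia.
    by case=> g1 g2; split=> k; rewrite ?f1 ?f2 ?g1 ?g2.
Qed.

Lemma does_run (jm : nat) (M := mach jm) off n x y (s : store) :
  input_at s off (tm_extra M) x -> computes_within M n x y ->
  exists s', [/\ does (@Run jm (tm_start M) off) n.+1 s s',
    shows (s' off) y & forall i, ~ (off <= i <= off + tm_extra M) -> s' i = s i].
Proof.
move=> [i0 i1] [hh hy]; set cf := iter n _ _ in hh hy.
(* Inside the block, abstract the final tapes of the machine; outside, nothing changes. The origin
   chosen by [of_tape] is arbitrary, so a result is later consumed only through [shows]. *)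
pose s' i := if off <= i then
    (if insub (i - off) is Some j then of_tape (cf.2 j) else s i) else s i.
exists s'; split.
- split=> K ts R.
  have [|m [ts' [mn E T F]]] := @run_steps jm off K n (tm_start M)
      [ffun i => if i == ord0 then ([::], [seq Some b | b <- x]) else ([::], [::])] ts _ hh.
    move=> j; rewrite ffunE; have := R (off + j).
    case: (eqVneq j ord0) => [-> /=|j0].
      by rewrite addn0 i0 => H; apply: rep_teq H (rep_input _).
    rewrite i1; last by rewrite lt0n j0 -ltnS ltn_ord.
    by move=> H; apply: rep_teq H (rep_input _).
  exists m, ts'; split=> // i; rewrite /s'.
  have idl : ~ (off <= i <= off + tm_extra M) -> rep (ts' i) (s i).
    by move=> /F H; apply: teq_rep H (R i).
  case: leqP => oi; last by apply: idl; lia.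
  case: insubP => [j ji jj|ji]; last by apply: idl; lia.
  by have := T j; rewrite jj subnKC // => H; apply: teq_rep H (rep_of_tape _).
- rewrite /s' leqnn; case: insubP => [j _ jj|]; last by rewrite subnn.
  have -> : j = ord0 by apply: val_inj; rewrite jj subnn.
  by rewrite -hy; exact: bits_until_blank_shows.
- move=> i ni; rewrite /s'; case: leqP => // oi; case: insubP => // j.
  by rewrite ltnS => ij; case: ni; lia.
Qed.

Definition init_store (x : seq bool) : store :=
  fun i => if i == 0 then ([seq Some b | b <- x], 0%R) else ([::], 0%R).

Lemma does_computes c n x y s' : does c n (init_store x) s' -> shows (s' 0) y ->
  computes_within (prog_tm c) n x y.
Proof.
move=> [H] sy.
pose ts0 i : tape := if i == 0 then ([::], [seq Some b | b <- x]) else ([::], [::]).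
have R : rep_store ts0 (init_store x).
  by move=> i; rewrite /ts0 /init_store; case: eqP => _; exact: rep_input.
have [m [ts' [mn E R']]] := H [::] _ R.
have S0 : sim (tm_init (prog_tm c) x) ([:: c], ts0).
  split=> //= i; rewrite ffunE /ts0; case: eqP => [->//|].
  by move=> /eqP; rewrite -val_eqE /= => /negPf ->.
have := @sim_iter c m _ _ S0; rewrite E => -[/= q0 t0].
have fixd k cf : tm_halt cf.1 -> iter k (@tm_step (prog_tm c)) cf = cf.
  by move=> h; elim: k => //= k ->; rewrite /tm_step h.
have h : tm_halt (iter m (@tm_step (prog_tm c)) (tm_init (prog_tm c) x)).1.
  by rewrite /= q0.
rewrite /computes_within -(subnK mn) iterD fixd //; split=> //.
by rewrite /tm_output t0; exact: shows_bits sy.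
Qed.

End Programs.

Arguments Nop {mach}.
Arguments Act {mach}.
Arguments Seq {mach}.
Arguments Switch {mach}.
Arguments While {mach}.
Arguments does_nop {mach} s.
Arguments does_move {mach} i m s.
Arguments does_emit {mach i} a s.

(** * Basic programs: emitting, moving, rewinding, unary arithmetic *)

Section Library.
Variable mach : nat -> tm.
Notation cmd := (cmd mach).
Implicit Types (s : store) (y : seq bool).

Definition word y : atape := ([seq Some b | b <- y], 0%R).
Definition unary (n : nat) : atape := word (nseq n true).

Fixpoint seqs (l : seq cmd) : cmd := if l is c :: l' then Seq c (seqs l') else Nop.

Definition emits (o : nat) (l : seq symbol) : cmd :=
  seqs [seq Act o (fun=> a) Right | a <- l].

Lemma does_emits o l s t : s o = (t, Posz (size t)) ->
  does (emits o l) (2 * size l).+1 s (upd s o (t ++ l, Posz (size t + size l))).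
Proof.
elim: l s t => [|a l IH] s t e.
  by apply: does_ext (does_nop _) _ => i; rewrite cats0 addn0 /upd; case: eqP => [->|].
have H1 := @does_emit mach o a s; rewrite e in H1.
have := does_seq (H1 erefl) (IH _ (rcons t a) _).
rewrite upd_eq /= size_rcons => /(_ erefl) H2.
apply: does_le (does_ext H2 _) _; last by lia.
by move=> i; rewrite /upd; case: eqP => // _; rewrite cat_rcons addSnnS.
Qed.

Definition shift_heads (l : seq nat) (d : int) s : store :=
  fun i => if i \in l then ((s i).1, (s i).2 + d)%R else s i.

Definition moves (l : seq nat) (m : move) : cmd := seqs [seq Act i id m | i <- l].

Lemma does_moves (l : seq nat) m s : uniq l -> does (moves l m) (2 * size l).+1 s (shift_heads l (delta m) s).
Proof.
elim: l s => [|i l IH] s /=; first by move=> _; exact: (does_nop _).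
case/andP => il ul; apply: does_conv (does_seq (does_move i m s) (IH _ ul)) _ _.
  move=> j; rewrite /shift_heads /upd in_cons; case: (eqVneq j i) => [->|] //=.
  by rewrite (negPf il).
by lia.
Qed.

(** All heads in [l] move together, steered by [lead]. The first move to the left enters the word
    when the head of [lead] stands just past its end; the loop stops on the blank at position -1,
    and the last move steps back to the origin. *)
Definition rewind (lead : nat) (l : seq nat) : cmd :=
  Seq (moves l Left) (Seq (While lead isSome (moves l Left)) (moves l Right)).

Lemma shift_heads_comp l d d' s i : shift_heads l d (shift_heads l d' s) i = shift_heads l (d' + d)%R s i.
Proof. by rewrite /shift_heads; case: (i \in l) => //=; rewrite addrA. Qed.

Lemma does_rewind (lead : nat) (l : seq nat) s w k : uniq l -> lead \in l -> s lead = (w, Posz k) ->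
  k <= size w -> all isSome w ->
  does (rewind lead l) ((2 * size l + 3) * (k + 2)) s (shift_heads l (- k%:Z)%R s).
Proof.
move=> ul ll e kw wS.
pose S j := shift_heads l (- 1 - j%:Z)%R s.
have H1 := does_moves Left s ul.
have H2 : does (While lead isSome (moves l Left)) (k * (2 * size l).+2).+1 (S 0) (S k).
  apply: does_while => [j jk|]; last first.
    rewrite /S /shift_heads ll e /scan /=; case E: (Posz k + _)%R => [p|p] //=; lia.
  split.
    rewrite /S /shift_heads ll e /scan /=; case E: (Posz k + _)%R => [p|p] /=; last by lia.
    have pw : p < size w by lia.
    by move/all_nthP: wS => /(_ None _ pw).
  apply: does_ext (does_moves Left _ ul) _ => i.
  rewrite shift_heads_comp; congr (shift_heads l _ s i); rewrite /=; lia.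
have H1' : does (moves l Left) (2 * size l).+1 s (S 0).
  by apply: does_ext H1 _ => i; congr (shift_heads l _ s i).
apply: does_conv (does_seq H1' (does_seq H2 (does_moves Right _ ul))) _ _.
  move=> i; rewrite shift_heads_comp; congr (shift_heads l _ s i); rewrite /=; lia.
nia.
Qed.

Fixpoint switches (l : seq nat) (f : seq symbol -> cmd) : cmd :=
  if l is i :: l' then Switch i (fun a => switches l' (fun r => f (a :: r))) else f [::].

Lemma does_switches l f n s s' : does (f [seq scan (s i) | i <- l]) n s s' ->
  does (switches l f) (n + size l) s s'.
Proof.
elim: l f => [|i l IH] f /= H; first by rewrite addn0.
by rewrite addnS; apply: does_switch; exact: IH.
Qed.

Definition each (a o : nat) (g : symbol -> seq symbol) : cmd :=
  While a isSome (Seq (Switch a (fun x => emits o (g x))) (Act a id Right)).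

Definition images (g : symbol -> seq symbol) y : seq symbol :=
  flatten [seq g (Some b) | b <- y].

Lemma does_each a o g G s y t : a <> o -> shows (s a) y ->
  s o = (t, Posz (size t)) -> (forall b, size (g (Some b)) <= G) ->
  does (each a o g) (size y * (2 * G + 6)).+1 s
    (upd (upd s a ((s a).1, (s a).2 + (size y)%:Z)%R) o
         (t ++ images g y, Posz (size (t ++ images g y)))).
Proof.
move=> ao [sh1 sh2] e gG.
pose S k := upd (upd s a ((s a).1, (s a).2 + k%:Z)%R) o
         (t ++ images g (take k y), Posz (size (t ++ images g (take k y)))).
have Sa k : S k a = ((s a).1, (s a).2 + k%:Z)%R by rewrite /S upd_ne // upd_eq.
suff : does (each a o g) (size y * (2 * G + 6)).+1 (S 0) (S (size y)).
  rewrite /S take_size => H; apply: does_ext_l H _ => i.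
  rewrite /images take0 /= cats0 addr0 /upd; case: eqP => [->|_]; first by rewrite e.
  by case: eqP => [->|//]; case: (s a).
have -> : size y * (2 * G + 6) = size y * (2 * G + 5).+1 by rewrite -addnS.
apply: does_while => [k ky|]; rewrite Sa /scan; last by rewrite sh2.
rewrite sh1 //; split=> //.
have So : S k o = (t ++ images g (take k y), Posz (size (t ++ images g (take k y)))).
  by rewrite /S upd_eq.
have H1 : does (Switch a (fun x => emits o (g x))) (2 * G).+2 (S k)
   (upd (S k) o (t ++ images g (take k.+1 y), Posz (size (t ++ images g (take k.+1 y))))).
  apply: does_switch; rewrite Sa /scan sh1 //.
  apply: does_conv (does_emits _ So) _ _; last by rewrite ltnS leq_mul2l gG orbT.
  move=> i; rewrite /upd; case: eqP => // _.
  by rewrite (take_nth false) // /images map_rcons flatten_rcons catA -size_cat.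
apply: does_conv (does_seq H1 (does_move a Right _)) _ _; last by lia.
move=> i; rewrite /S /upd /=.
case: (eqVneq i a) => [->|ia] /=; last by case: (i == o).
move/eqP/negPf: ao => ->; rewrite eqxx /=; congr pair; lia.
Qed.

Definition eachr (a o : nat) (g : symbol -> seq symbol) : cmd :=
  Seq (each a o g) (rewind a [:: a]).

Lemma all_word y : all isSome [seq Some b | b <- y].
Proof. by apply/allP => x /mapP[b _ ->]. Qed.

Lemma does_eachr a o g G s y t : a <> o -> s a = word y ->
  s o = (t, Posz (size t)) -> (forall b, size (g (Some b)) <= G) ->
  does (eachr a o g) ((size y + 2) * (2 * G + 12)) s
    (upd s o (t ++ images g y, Posz (size (t ++ images g y)))).
Proof.
move=> ao ea eo gG.
have sh : shows (s a) y by rewrite ea; exact: shows_self.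
have H1 := does_each ao sh eo gG.
set s1 := upd _ _ _ in H1.
have s1a : s1 a = ([seq Some b | b <- y], Posz (size y)).
  by rewrite /s1 upd_ne // upd_eq ea /= add0r.
have H2 := @does_rewind a [:: a] s1 _ _ erefl (mem_head _ _) s1a _ (all_word y).
apply: does_conv (does_seq H1 (H2 _)) _ _.
- by rewrite size_map.
- move=> i; rewrite /shift_heads inE; case: (eqVneq i a) => [->|ia].
    by rewrite s1a /= subrr upd_ne // ea.
  by rewrite /s1 /upd (negPf ia).
- rewrite [size [:: a]]/=; nia.
Qed.

Lemma images_const l y : images (fun=> l) y = flatten (nseq (size y) l).
Proof. by rewrite /images; elim: y => //= b y ->. Qed.

Lemma flatten_nseq1 (T : Type) n (a : T) : flatten (nseq n [:: a]) = nseq n a.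
Proof. by elim: n => //= n ->. Qed.

Definition one : seq symbol := [:: Some true].

Definition mul_prog (a b o : nat) : cmd :=
  Seq (While a isSome (Seq (eachr b o (fun=> one)) (Act a id Right)))
      (Seq (rewind a [:: a]) (rewind o [:: o])).

Lemma does_rewind1 a s y : s a = ([seq Some b | b <- y], Posz (size y)) ->
  does (rewind a [:: a]) (5 * (size y + 2)) s (upd s a (word y)).
Proof.
move=> e; have H := @does_rewind a [:: a] s _ _ erefl (mem_head _ _) e _ (all_word y).
apply: does_ext (H _) _; first by rewrite size_map.
move=> i; rewrite /shift_heads /upd inE; case: eqP => // ->.
by rewrite e /= subrr.
Qed.

Lemma does_mul (a b o : nat) m y s : uniq [:: a; b; o] ->
  s a = unary m -> s b = word y -> s o = ([::], 0%R) ->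
  does (mul_prog a b o) ((m + 1) * (size y + 2) * 40) s (upd s o (unary (m * size y))).
Proof.
rewrite /= !inE negb_or andbT => /andP[/andP[/eqP ab /eqP ao] /eqP bo] ea eb eo.
have Som n : [seq Some b | b <- nseq n true] = nseq n (Some true : symbol).
  by rewrite map_nseq.
pose S k := upd (upd s a ((s a).1, Posz k)) o
    (nseq (k * size y) (Some true : symbol), Posz (k * size y)).
have So k : S k o = (nseq (k * size y) (Some true : symbol),
    Posz (size (nseq (k * size y) (Some true : symbol)))).
  by rewrite /S upd_eq size_nseq.
have Sb k : S k b = word y by rewrite /S !upd_ne //; congruence.
have H1 : does (While a isSome (Seq (eachr b o (fun=> one)) (Act a id Right)))
    (m * ((size y + 2) * 14 + 3)).+1 (S 0) (S m).
  have -> : (size y + 2) * 14 + 3 = ((size y + 2) * 14 + 2).+1 by lia.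
  apply: does_while => [k km|]; rewrite {1}/S upd_ne // upd_eq ea /scan /= Som nth_nseq;
    last by rewrite ltnn.
  rewrite km; split=> //.
  have := @does_eachr b o (fun=> one) 1 _ _ _ bo (Sb k) (So k) (fun=> isT).
  move=> H; apply: does_conv (does_seq H (does_move a Right _)) _ _; last by lia.
  move=> i; rewrite images_const flatten_nseq1 -nseqD size_nseq /S /upd /=.
  case: (eqVneq i a) => [->|ia] /=.
    by move/eqP/negPf: ao => ->; rewrite ?eqxx /=; congr pair; lia.
  by case: (i == o) => //; rewrite mulSnr.
have Sma : S m a = ([seq Some b | b <- nseq m true], Posz (size (nseq m true))).
  by rewrite /S upd_ne // upd_eq ea size_nseq.
have H2 := does_rewind1 Sma.
set s2 := upd _ _ _ in H2.
have s2o : s2 o = ([seq Some b | b <- nseq (m * size y) true], Posz (size (nseq (m * size y) true))).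
  by rewrite /s2 upd_ne ?So ?Som ?size_nseq //; congruence.
have H3 := does_rewind1 s2o.
have H1' : does (While a isSome (Seq (eachr b o (fun=> one)) (Act a id Right)))
    (m * ((size y + 2) * 14 + 3)).+1 s (S m).
  apply: does_ext_l H1 _ => i; rewrite /S /upd mul0n; case: eqP => [->//|_].
  by case: eqP => [->|//]; rewrite ea.
apply: does_conv (does_seq H1' (does_seq H2 H3)) _ _.
  move=> i; rewrite /s2 /S /upd; case: (i == o) => //.
  by case: eqP => // ->; rewrite ea.
rewrite !size_nseq; nia.
Qed.

(** Every intermediate power is kept, the [j]-th one on tape [base + j]; the row length and its
    square are later both taken from one such run. *)
Fixpoint pow_prog (base b d : nat) : cmd :=
  if d is d'.+1 then Seq (pow_prog base b d') (mul_prog (base + d') b (base + d'.+1))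
  else Seq (emits base one) (rewind base [:: base]).

Definition pow_store (base n d : nat) s : store :=
  fun i => if base <= i <= base + d then unary (n ^ (i - base)) else s i.

Lemma does_pow base b d s y : b < base -> s b = word y ->
  (forall j, j <= d -> s (base + j) = ([::], 0%R)) ->
  does (pow_prog base b d) (80 * d.+1 * (size y + 2) ^ d.+1) s (pow_store base (size y) d s).
Proof.
move=> bb eb; elim: d => [|d IH] e.
  have e0 : s base = ([::], Posz (size ([::] : seq symbol))) by rewrite -(addn0 base) e.
  have H1 := does_emits one e0.
  have H2 := @does_rewind1 base _ [:: true] (upd_eq s base _).
  apply: does_conv (does_seq H1 H2) _ _; last by rewrite /=; lia.
  move=> i; rewrite /pow_store /upd addn0 -eqn_leq; case: eqVneq => [->|_].
    by rewrite subnn.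
  by [].
have {}IH := IH (fun j jd => e j (leqW jd)).
set s1 := pow_store _ _ d s in IH.
have sa : s1 (base + d) = unary (size y ^ d).
  by rewrite /s1 /pow_store leq_addr leqnn /= addKn.
have sb : s1 b = word y by rewrite /s1 /pow_store leqNgt bb.
have so : s1 (base + d.+1) = ([::], 0%R).
  by rewrite /s1 /pow_store leq_add2l ltnn andbF e.
have un : uniq [:: base + d; b; base + d.+1] by rewrite /= !inE; lia.
have H := does_mul un sa sb so.
apply: does_conv (does_seq IH H) _ _.
  move=> i; rewrite /upd /s1 /pow_store; case: eqP => [->|ne].
    by rewrite leq_addr leqnn /= addKn expnSr.
  by have -> : (i <= base + d.+1) = (i <= base + d) by lia.
set X := size y + 2.
have h1 : size y ^ d + 1 <= X ^ d.+1.
  have : size y ^ d <= X ^ d by case: (d) => // d'; rewrite leq_exp2r // leq_addr.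
  have : 0 < X ^ d by rewrite expn_gt0 /X addn2.
  rewrite expnS /X; nia.
have h2 : X ^ d.+2 = X * X ^ d.+1 by rewrite expnS.
have h3 : 0 < X ^ d.+1 by rewrite expn_gt0 /X addn2.
have h4 : 2 <= X by rewrite /X; lia.
rewrite h2; nia.
Qed.

End Library.

                                              

(** * Instances with probabilities 0 and 1: execution is deterministic *)

Section Deterministic.
Variables (I : instance) (s : policy I).
Hypothesis prob01 : forall (i : workers I) (j : tasks I),
  prob i j = 0%R \/ prob i j = 1%R.

Definition successful (Y : {set tasks I}) : {set workers I} :=
  [set i | success_prob s Y i == 1%R]%SET.

Definition det_next (Y : {set tasks I}) : {set tasks I} :=
  after_round s Y (successful Y).

Definition det_run (k : nat) : {set tasks I} := iter k det_next finset.set0.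

Lemma success_prob01 Y i : success_prob s Y i = ((i \in successful Y) : nat)%:R%R.
Proof.
rewrite inE /success_prob; case: (s Y i) => [j|] //.
by case: (prob01 i j) => ->.
Qed.

Lemma outcome_prob_det Y W : outcome_prob s Y W = (W == successful Y)%:R%R.
Proof.
rewrite /outcome_prob; case: eqP => [->|/eqP ne].
  apply: big1 => i _; rewrite success_prob01.
  by case: (i \in _); rewrite ?subr0.
have [i ni] : exists i, (i \in W) != (i \in successful Y).
  case: (pickP [pred i | (i \in W) != (i \in successful Y)]) => [i|h]; first by exists i.
  by case/eqP: ne; apply/finset.setP => i; apply/eqP; move/negbFE: (h i).
rewrite (bigD1 i) //= success_prob01.
by case: (i \in W) ni => /=; case: (i \in _) => // _; rewrite ?subrr mul0r.
Qed.

Lemma sum_indicator (T : finType) (P : pred T) (g : T) :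
  (\sum_(W | P W) (W == g)%:R = (P g)%:R :> rat)%R.
Proof.
case: (boolP (P g)) => Pg.
  rewrite (bigD1 g) //= eqxx big1 ?addr0 // => W /andP[_ /negPf ->] //.
apply: big1 => W PW; case: eqP => // e; by rewrite e (negPf Pg) in PW.
Qed.

Lemma round_prob_det Y Y' : round_prob s Y Y' = (Y' == det_next Y)%:R%R.
Proof.
rewrite /round_prob (eq_bigr _ (fun W _ => outcome_prob_det Y W)).
by rewrite sum_indicator eq_sym.
Qed.

Definition alive (k : nat) : bool := all (fun j => ~~ finished (det_run j)) (iota 0 k).

Lemma aliveS k : alive k.+1 = alive k && ~~ finished (det_run k).
Proof. by rewrite /alive -addn1 iotaD all_cat /= andbT. Qed.

Lemma reach_prob_det k Y :
  reach_prob s finset.set0 k Y = ((Y == det_run k) && alive k)%:R%R.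
Proof.
elim: k Y => [|k IH] Y /=; first by rewrite andbT.
transitivity (\sum_(Z | ~~ finished Z && alive k && (Y == det_next Z))
    (Z == det_run k)%:R : rat)%R.
  rewrite [LHS]big_mkcond [RHS]big_mkcond; apply: eq_bigr => Z _.
  rewrite IH round_prob_det -natrM mulnb.
  case: (finished Z) => //=; case: (alive k) => //=; rewrite ?andbT ?andbF //=.
  by case: (Y == _); rewrite ?andbT ?andbF.
rewrite sum_indicator aliveS; congr (nat_of_bool _)%:R%R.
by rewrite -[Y == det_run k.+1]/(Y == det_next (det_run k)) andbC [(~~ _) && _]andbC.
Qed.

Lemma end_prob_det k :
  end_prob s finset.set0 k = (finished (det_run k) && alive k)%:R%R.
Proof.
rewrite /end_prob (eq_bigr _ (fun Y _ => reach_prob_det k Y)).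
case: (alive k); last by rewrite andbF big1 // => Y _; rewrite andbF.
rewrite andbT; under eq_bigr do rewrite andbT; exact: sum_indicator.
Qed.

Lemma det_next_sub (Y : {set tasks I}) : Y \subset det_next Y.
Proof. exact: finset.subsetUl. Qed.

Lemma finished_sub (Y Y' : {set tasks I}) : Y \subset Y' -> finished Y -> finished Y'.
Proof.
move=> /fintype.subsetP YY /forallP H; apply/forallP => v; apply/implyP => sv.
by apply: YY; have := H v; rewrite sv.
Qed.

Lemma det_run_mono k k' : k <= k' -> det_run k \subset det_run k'.
Proof.
move=> /subnK <-; elim: (k' - k) => // m IH.
by rewrite addSn; apply: fintype.subset_trans IH _; exact: det_next_sub.
Qed.

Lemma series_single (R : realType) (f : nat -> \bar R) K :
  (forall k, 0 <= f k)%E -> (forall k, k != K -> f k = 0%E) ->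
  (\sum_(0 <= k <oo) f k = f K)%E.
Proof.
move=> f0 fK; rewrite (nneseries_split 0 K.+1) // add0n.
rewrite eseries0; last by move=> k Kk _; rewrite fK //; lia.
by rewrite adde0 big_nat_recr //= big1_seq ?add0e // => k; rewrite mem_index_iota => kK; rewrite fK //; lia.
Qed.

(** The completion time is a point mass at [K], so the term that multiplies infinity is zero. *)
Lemma expected_time_finish (R : realType) K : finished (det_run K) -> alive K ->
  expected_time s R = (K%:R%:E)%E.
Proof.
move=> fK aK.
have eE k : end_prob s finset.set0 k = ((k == K) : nat)%:R%R.
  rewrite end_prob_det; congr (nat_of_bool _)%:R%R.
  apply/idP/eqP => [/andP[fk ak]|->]; last by rewrite fK.
  apply/eqP; rewrite eqn_leq; apply/andP; split; rewrite leqNgt; apply/negP => lt.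
    by move/allP: ak => /(_ K); rewrite mem_iota lt fK => /(_ isT).
  by move/allP: aK => /(_ k); rewrite mem_iota lt fk => /(_ isT).
rewrite /expected_time (@series_single _ _ K) => [|k|k kK]; last 2 first.
- by rewrite eE ratr_nat lee_fin mulr_ge0.
- by rewrite eE (negPf kK) ratr_nat mulr0.
rewrite (@series_single _ _ K) => [|k|k kK]; last 2 first.
- by rewrite eE ratr_nat lee_fin.
- by rewrite eE (negPf kK) ratr_nat.
by rewrite eE eqxx ratr_nat mulr1 subee // mule0 adde0.
Qed.

(** Here the finite times carry no mass, and infinity is multiplied by 1. *)
Lemma expected_time_never (R : realType) : (forall k, ~~ finished (det_run k)) ->
  expected_time s R = +oo%E.
Proof.
move=> nf.
have eE k : end_prob s finset.set0 k = 0%R.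
  by rewrite end_prob_det (negPf (nf k)).
rewrite /expected_time eseries0 => [|k _ _]; last by rewrite eE rmorph0 mulr0.
rewrite eseries0 => [|k _ _]; last by rewrite eE rmorph0.
by rewrite sube0 mule1 add0e.
Qed.

Lemma first_finish k : finished (det_run k) ->
  exists2 K, K <= k & finished (det_run K) /\ alive K.
Proof.
move=> fk; have ex : exists k, finished (det_run k) by exists k.
exists (ex_minn ex); case: ex_minnP => K fK minK; first exact: minK.
split=> //; apply/allP => j; rewrite mem_iota => /andP[_ jK].
by apply: contraTN jK => /minK; rewrite -leqNgt add0n.
Qed.

Lemma expected_time_le (R : realType) k : finished (det_run k) ->
  (expected_time s R <= k%:R%:E)%E.
Proof.
move=> /first_finish[K Kk [fK aK]].
by rewrite (expected_time_finish R fK aK) lee_fin ler_nat.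
Qed.

(** Completion times are integers or infinite; this rounding turns an expected time below 4 into
    completion within three rounds. *)
Lemma expected_time_lt (R : realType) k :
  (expected_time s R < k.+1%:R%:E)%E -> finished (det_run k).
Proof.
case: (pselect (exists k, finished (det_run k))) => [[m fm]|nf].
  have [K _ [fK aK]] := first_finish fm.
  rewrite (expected_time_finish R fK aK) lte_fin ltr_nat ltnS => Kk.
  exact: finished_sub (det_run_mono Kk) fK.
rewrite expected_time_never //.
by move=> m; apply/negP => fm; apply: nf; exists m.
Qed.

End Deterministic.

                                                     

                                                                                
                                                                               
                                                                               
                                                                               
                                                    
(** * The gadget: satisfiable clauses need three rounds, unsatisfiable ones at least four *)

Section Gadget.
Variables (V C : finType) (nt : nat).
Local Notation code := ((V * bool) + (C * 'I_6))%type.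
Variables (dec : 'I_nt -> code) (enc : code -> 'I_nt).
Hypotheses (decK : cancel dec enc) (encK : cancel enc dec).
Variable lit : C -> 'I_6 -> option (V * bool).

Definition gadget_arc (u v : 'I_nt) : bool :=
  match dec u, dec v with
  | inl l, inr cs => lit cs.1 cs.2 == Some l
  | _, _ => false
  end.

(** Workers are indexed by the same codes as tasks. Those coded [(v, false)] and [(c, 5)] can do
    nothing, which leaves one capable worker per variable and five per clause. *)
Definition able (w t : code) : bool :=
  match w, t with
  | inl vb, inl vb' => vb.2 && (vb.1 == vb'.1)
  | inr cs, inr cs' => (cs.1 == cs'.1) && (cs.2 < 5)
  | _, _ => false
  end.

Definition gadget_prob (i j : 'I_nt) : rat := (able (dec i) (dec j) : nat)%:R%R.

Lemma gadget_acyclic (c : seq 'I_nt) : c != [::] -> ~~ cycle gadget_arc c.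
Proof.
case: c => // x p _; apply/negP => /= h.
have to_inr u v : gadget_arc u v -> exists cs, dec v = inr cs.
  by rewrite /gadget_arc; case: (dec u) => [l|//]; case: (dec v) => [//|cs]; exists cs.
have from_inl u v : gadget_arc u v -> exists l, dec u = inl l.
  by rewrite /gadget_arc; case: (dec u) => [l|//]; exists l.
have [l dl] : exists l, dec x = inl l.
  by case: p h => [|y p] /= /andP[/from_inl].
move: h; rewrite rcons_path => /andP[_ /to_inr[cs]]; by rewrite dl.
Qed.

Lemma gadget_prob_ge0 i j : (0 <= gadget_prob i j)%R. Proof. exact: ler0n. Qed.

Lemma gadget_prob_le1 i j : (gadget_prob i j <= 1)%R.
Proof. by rewrite /gadget_prob; case: able. Qed.

Lemma gadget_prob_gt0 j : exists i, (0 < gadget_prob i j)%R.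
Proof.
case E : (dec j) => [[v b]|[c k]].
  by exists (enc (inl (v, true))); rewrite /gadget_prob encK E /= eqxx.
by exists (enc (inr (c, ord0))); rewrite /gadget_prob encK E /= eqxx.
Qed.

Definition gadget : instance :=
  Instance gadget_acyclic gadget_prob_ge0 gadget_prob_le1 gadget_prob_gt0.

Definition task (x : code) : tasks gadget := enc x.
Definition worker (x : code) : workers gadget := enc x.

(** An absent literal counts as true: its task has no parent and can be done at any time. *)
Definition lit_true (b : V -> bool) (o : option (V * bool)) : bool :=
  if o is Some l then b l.1 == l.2 else true.

Definition satisfies (b : V -> bool) : Prop :=
  forall c, exists k, lit_true b (lit c k).

Lemma gadget_prob01 (i : workers gadget) (j : tasks gadget) :
  prob i j = 0%R \/ prob i j = 1%R.
Proof. by rewrite /= /gadget_prob; case: able; [right|left]. Qed.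

Lemma det_nextP (s : policy gadget) (Y : {set tasks gadget}) (x : tasks gadget) :
  reflect (x \in Y \/ exists2 i, s Y i = Some x & able (dec i) (dec x))
    (x \in det_next s Y).
Proof.
rewrite /det_next /after_round !inE; apply: (iffP orP) => -[]; try by left.
  move=> /existsP[i /andP[]]; rewrite inE /success_prob => h /eqP e.
  right; exists i => //; move: h; rewrite e /= /gadget_prob.
  by case: able => // /eqP /eqP; rewrite eq_sym oner_eq0.
move=> [i e a]; right; apply/existsP; exists i.
by rewrite inE /success_prob e eqxx /= /gadget_prob a.
Qed.

Lemma clause_sink c k : sink (task (inr (c, k))).
Proof. by apply/forallP => u; rewrite /= /gadget_arc encK. Qed.

Lemma eligibleE (Y : {set tasks gadget}) x : (x \in eligible Y) =
  (x \notin Y) && (if dec x is inr cs then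
     (if lit cs.1 cs.2 is Some l then task (inl l) \in Y else true) else true).
Proof.
rewrite inE; congr andb; case E: (dec x) => [l|[c k]] /=.
  by apply/forallP => u; rewrite /gadget_arc E; case: (dec u).
apply/forallP/idP => [h|h u].
  case El: (lit c k) => [l|//]; have /implyP := h (task (inl l)); apply.
  by rewrite /gadget_arc E encK El /=.
apply/implyP; rewrite /gadget_arc E; case Eu: (dec u) => [l|//] /= /eqP El.
by move: h; rewrite El /task -Eu decK.
Qed.

Section Complete.
Variables (b : V -> bool) (slot : C -> 'I_6).
Hypothesis slotP : forall c, lit_true b (lit c (slot c)).

(** A variable worker first takes the literal made true by [b], then the other one. The five workers
    of a clause first all take the task in its true slot; afterwards [bump] spreads them over the
    five other slots. *)
Definition choice_of (Z : {set tasks gadget}) (i : workers gadget) : code :=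
  match dec i with
  | inl vb => inl (vb.1, if task (inl (vb.1, b vb.1)) \in Z then ~~ b vb.1 else b vb.1)
  | inr cs => inr (cs.1, if task (inr (cs.1, slot cs.1)) \in Z
                         then inord (bump (slot cs.1) cs.2) else slot cs.1)
  end.

Definition schedule : policy gadget := fun Z i =>
  if task (choice_of Z i) \in eligible Z then Some (task (choice_of Z i)) else None.

Lemma schedule_regimen : is_regimen schedule.
Proof. by move=> Z _ i j; rewrite /schedule; case: ifP => // h [<-]. Qed.

Lemma schedule_next (Z : {set tasks gadget}) i x : choice_of Z i = x -> able (dec i) x ->
  (task x \in Z) || (task x \in eligible Z) -> task x \in det_next schedule Z.
Proof.
move=> cx a /orP[xZ|xe]; apply/det_nextP; first by left.
by right; exists i; rewrite /task ?encK // /schedule cx xe.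
Qed.

Lemma schedule_lit1 (Z : {set tasks gadget}) v : task (inl (v, b v)) \in det_next schedule Z.
Proof.
case: (boolP (task (inl (v, b v)) \in Z)) => h; first by apply/det_nextP; left.
apply: (@schedule_next _ (worker (inl (v, true)))).
- by rewrite /choice_of encK /= (negPf h).
- by rewrite encK /= eqxx.
- by rewrite eligibleE h encK orbT.
Qed.

Lemma schedule_lit2 (Z : {set tasks gadget}) v b' : task (inl (v, b v)) \in Z ->
  task (inl (v, b')) \in det_next schedule Z.
Proof.
move=> h; case: (eqVneq b' (b v)) => [->|ne]; first by apply/det_nextP; left.
case: (boolP (task (inl (v, b')) \in Z)) => h'; first by apply/det_nextP; left.
apply: (@schedule_next _ (worker (inl (v, true)))).
- by rewrite /choice_of encK /= h; case: (b v) (b') ne => -[].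
- by rewrite encK /= eqxx.
- by rewrite eligibleE h' encK orbT.
Qed.

Lemma schedule_slot (Z : {set tasks gadget}) c : (forall v, task (inl (v, b v)) \in Z) ->
  task (inr (c, slot c)) \in det_next schedule Z.
Proof.
move=> hv; case: (boolP (task (inr (c, slot c)) \in Z)) => h; first by apply/det_nextP; left.
apply: (@schedule_next _ (worker (inr (c, ord0)))).
- by rewrite /choice_of encK /= (negPf h).
- by rewrite encK /= eqxx.
- apply/orP; right; rewrite eligibleE h encK /=; have := slotP c.
  by case: (lit _ _) => [[v b'] /= /eqP <-|]; rewrite ?hv.
Qed.

Lemma schedule_clause (Z : {set tasks gadget}) c k : (forall v b', task (inl (v, b')) \in Z) ->
  task (inr (c, slot c)) \in Z -> task (inr (c, k)) \in det_next schedule Z.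
Proof.
move=> hv hs; case: (boolP (task (inr (c, k)) \in Z)) => h; first by apply/det_nextP; left.
have ks : slot c != k by apply: contraNneq h => <-.
case: (unlift_some ks) => j kE _.
apply: (@schedule_next _ (worker (inr (c, widen_ord (leqnSn 5) j)))).
- rewrite /choice_of encK /= hs; congr (inr (_, _)); apply: val_inj.
  by rewrite kE /= inordK //; exact: (ltn_ord (lift (slot c) j)).
- by rewrite encK /= eqxx ltn_ord.
- apply/orP; right; rewrite eligibleE h encK /=.
  by case: (lit _ _) => [[v b']|] //; rewrite hv.
Qed.

Lemma schedule_finished : finished (det_run schedule 3).
Proof.
have l1 k v : task (inl (v, b v)) \in det_run schedule k.+1 by exact: schedule_lit1.
have l2 k v b' : task (inl (v, b')) \in det_run schedule k.+2 by apply: schedule_lit2; exact: l1.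
have c2 c : task (inr (c, slot c)) \in det_run schedule 2 by apply: schedule_slot => v; exact: (l1 0).
apply/forallP => x; apply/implyP => _.
have -> : x = task (dec x) by rewrite /task decK.
by case: (dec x) => [[v b']|[c k]]; [exact: (l2 1)|apply: schedule_clause => // v b'; exact: (l2 0)].
Qed.

End Complete.

Lemma gadget_complete b : satisfies b ->
  exists s : policy gadget, is_regimen s /\ finished (det_run s 3).
Proof.
move=> /choice[slot slotP]; exists (schedule b slot).
by split; [exact: schedule_regimen|exact: schedule_finished].
Qed.

Lemma det_next_closed (s : policy gadget) (Y : {set tasks gadget}) : is_regimen s -> prec_closed Y ->
  prec_closed (det_next s Y).
Proof.
move=> rs cY; apply/forallP => v; apply/implyP => /det_nextP[vY|[i e _]].
  apply/forallP => u; apply/implyP => uv; apply/det_nextP; left.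
  by move/forallP: cY => /(_ v) /implyP /(_ vY) /forallP /(_ u) /implyP /(_ uv).
have := rs _ cY _ _ e; rewrite inE => /andP[_ /forallP h].
apply/forallP => u; apply/implyP => uv; apply/det_nextP; left.
by have /implyP := h u; apply.
Qed.

(** The last hypothesis ties [b] only to variables whose worker attempts a literal in the first
    round; if the worker is idle, neither literal is executed in that round and any value will
    do. *)
Lemma gadget_sound (s : policy gadget) b : is_regimen s ->
  finished (det_run s 3) ->
  (forall v b', s finset.set0 (worker (inl (v, true))) = Some (task (inl (v, b'))) ->
     b v = b') ->
  satisfies b.
Proof.
move=> rs f3 hb c; apply: contrapT => nex.
have c0 : prec_closed (det_run s 0).
  by apply/forallP => v; rewrite inE.
have c1 : prec_closed (det_run s 1) by exact: det_next_closed.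
have c2 : prec_closed (det_run s 2) by exact: det_next_closed.
(* If no literal of [c] is true under [b], every slot holds a literal not executed in round 1, so no
   task of [c] is eligible before round 3. *)
have notin k : task (inr (c, k)) \notin det_run s 2.
  have [l El nl] : exists2 l, lit c k = Some l & task (inl l) \notin det_run s 1.
    case El: (lit c k) => [l|]; last by case: nex; exists k; rewrite El.
    exists l => //; apply/negP => /det_nextP[|[i e a]]; first by rewrite inE.
    case: nex; exists k; rewrite El /=; case: l El e a => v b' El e /=.
    rewrite encK; case Ei: (dec i) => [[v' b'']|//] /= /andP[b1 /eqP vv].
    have iE : i = worker (inl (v, true)).
      by rewrite /worker -(decK i) Ei vv; case: (b'') b1.
    by rewrite iE in e; rewrite (hb _ _ e).
  have step Y : prec_closed Y -> task (inl l) \notin Y -> task (inr (c, k)) \notin Y ->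
      task (inr (c, k)) \notin det_next s Y.
    move=> cY lY kY; apply/negP => /det_nextP[|[i e _]]; first by rewrite (negPf kY).
    by have := rs _ cY _ _ e; rewrite eligibleE kY encK /= El (negPf lY).
  have l0 : task (inl l) \notin det_run s 0 by rewrite inE.
  by apply: (step) => //; apply: (step) => //; rewrite inE.
(* All six tasks of [c] are sinks, so each needs its own worker in round 3, but only five workers
   can serve this clause. *)
have ex k : exists j : 'I_5, s (det_run s 2) (worker (inr (c, widen_ord (leqnSn 5) j)))
    = Some (task (inr (c, k))).
  have : task (inr (c, k)) \in det_run s 3.
    by move/forallP: f3 => /(_ (task (inr (c, k)))) /implyP; apply; exact: clause_sink.
  move=> /det_nextP[|[i e a]]; first by rewrite (negPf (notin k)).
  move: a; rewrite encK; case Ei: (dec i) => [//|[c' k']] /= /andP[/eqP cc k5].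
  exists (Ordinal k5); rewrite -e; congr (s _ _).
  by rewrite /worker -(decK i) Ei cc; congr (enc (inr (_, _))); apply: val_inj.
have /choice[f fP] := ex.
have finj : injective f.
  move=> k k' ff; have := fP k; rewrite ff fP => -[] /(can_inj encK) [//].
by have := leq_card f finj; rewrite !card_ord.
Qed.

End Gadget.

                                     

(** * The computation tableau as a sequence of tiles *)

Section Tableau.
Variable M : tm.
Local Notation Q := (tm_state M).

Definition syms : finType := {ffun 'I_(tm_extra M).+1 -> option bool}.

                                                                                  
                                                                                 
(** The action leading from a row to the next: [Some (q, r)] is the transition taken in state [q] on
    the symbols [r], and [None] is a dummy first action that moves head 0 right, onto the input.
    Thanks to the dummy, the action recorded in row 0 does not depend on the input. *)
Definition action : finType := option (Q * syms)%type.

                                                                                 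
                                                                                   
                                     
(** Tapes are folded at their heads: column [p] holds, for every tape, the cell at index [p] of the
    left half and that at index [p] of the right half. The heads thus stay in column 0 and the tapes
    slide. Only column 0 records a state; every column records the action of its row. *)
Definition tile : finType := (option Q * (syms * syms) * action)%type.

Definition tstate (g : tile) : option Q := g.1.1.
Definition tleft (g : tile) : syms := g.1.2.1.
Definition tright (g : tile) : syms := g.1.2.2.
Definition tact (g : tile) : action := g.2.

Definition act_target (a : action) : Q :=
  if a is Some qr then
    (if tm_halt qr.1 then qr.1 else (tm_trans qr.1 qr.2).1)
  else tm_start M.

Definition act_on (a : action) (i : 'I_(tm_extra M).+1) : symbol * move :=
  if a is Some qr then
    (if tm_halt qr.1 then (qr.2 i, Stay) else (tm_trans qr.1 qr.2).2 i)
  else (None, if i == ord0 then Right else Stay).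

                                                                               
                                                                              
(** [b], [c], [d] are the three tiles above, and [a] is the left neighbour in the new row, from
    which the new action is copied. In column 0, where [c] has a state, the action is computed
    afresh. *)
Definition next_tile (a b c d : tile) : tile :=
  let l : syms := [ffun i =>
    match (act_on (tact c) i).2 with
    | Stay => tleft c i
    | Right => if tstate c is Some _ then (act_on (tact c) i).1 else tleft b i
    | Left => tleft d i
    end] in
  let r : syms := [ffun i =>
    match (act_on (tact c) i).2 with
    | Stay => if tstate c is Some _ then (act_on (tact c) i).1 else tright c i
    | Right => tright d i
    | Left => if tstate c is Some _ then tleft c i
              else if tstate b is Some _ then (act_on (tact c) i).1 else tright b i
    end] in
  if tstate c is Some _
  then (Some (act_target (tact c)), (l, r), Some (act_target (tact c), r))
  else (None, (l, r), tact a).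

Lemma next_tile_col0 a a' b b' c d : tstate c != None ->
  next_tile a b c d = next_tile a' b' c d.
Proof.
by rewrite /next_tile; case: (tstate c).
Qed.

Definition row_tile (q : Q) (tp : 'I_(tm_extra M).+1 -> tape) (a : action) (p : nat) : tile :=
  (if p == 0 then Some q else None,
   ([ffun i => @nth symbol None (tp i).1 p], [ffun i => @nth symbol None (tp i).2 p]), a).

Lemma row_tile_next q tp a p g q' tp' :
  q' = act_target a -> (forall i, tp' i = act_tape (act_on a i) (tp i)) ->
  (0 < p -> tact g = Some (q', [ffun i => read_tape (tp' i)])) ->
  next_tile g (row_tile q tp a p.-1) (row_tile q tp a p) (row_tile q tp a p.+1) =
  row_tile q' tp' (Some (q', [ffun i => read_tape (tp' i)])) p.
Proof.
move=> qE tE gE; rewrite /next_tile /row_tile /= /tstate /tleft /tright /tact /=.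
have nb (l : seq symbol) k : nth None (behead l) k = nth None l k.+1 by exact: nth_behead.
case: p gE => [|p] gE /=.
  have re : ([ffun i => match (act_on a i).2 with
      | Left => @nth symbol None (tp i).1 0
      | Stay => (act_on a i).1 | Right => @nth symbol None (tp i).2 1 end] : syms)
      = [ffun i => nth None (tp' i).2 0].
    apply/ffunP => i; rewrite !ffunE tE /act_tape.
    case: (act_on a i) => x [] /=; rewrite ?nth_behead // -?nth0 //.
  have re' : ([ffun i => read_tape (tp' i)] : syms) = [ffun i => nth None (tp' i).2 0].
    by apply/ffunP => i; rewrite !ffunE /read_tape; case: (tp' i).2.
  rewrite re' -re -qE; congr (_, (_, _), Some (_, _)); apply/ffunP => i; rewrite !ffunE ?ffunE //.
  rewrite tE /act_tape; by case: (act_on a i) => x [] //=.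
rewrite -[g.2]/(tact g) gE //; congr (_, (_, _), _); apply/ffunP => i; rewrite !ffunE tE /act_tape;
  case: (act_on a i) => x [] //=; rewrite ?nb //.
by case: p {gE} => //= p; rewrite nb.
Qed.

Variable input : seq bool.

Definition tapes0 (i : 'I_(tm_extra M).+1) : tape :=
  if i == ord0 then ([::], None :: [seq Some b | b <- input]) else ([::], [::]).

Definition tab_conf : Type := (Q * ('I_(tm_extra M).+1 -> tape) * action)%type.

Definition tab_step (c : tab_conf) : tab_conf :=
  let q := act_target c.2 in
  let tp := fun i => act_tape (act_on c.2 i) (c.1.2 i) in
  (q, tp, Some (q, [ffun i => read_tape (tp i)])).

Definition tab (t : nat) : tab_conf := iter t tab_step (tm_start M, tapes0, None).

Definition true_tile (t p : nat) : tile := row_tile (tab t).1.1 (tab t).1.2 (tab t).2 p.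

(** Row 0 precedes the dummy action, so row [t + 1] is the configuration after [t] steps. *)
Lemma tab_run t :
  (tab t.+1).1.1 = (iter t (@tm_step M) (tm_init M input)).1 /\
  forall i, teq ((tab t.+1).1.2 i) ((iter t (@tm_step M) (tm_init M input)).2 i).
Proof.
elim: t => [|t [IHq IHt]].
  split=> //= i; rewrite ffunE /tapes0; case: (eqVneq i ord0) => _;
  by split=> -[|k] //=; rewrite ?nth_nil //; case: k.
rewrite iterS; set cf := iter t _ _ in IHq IHt *.
rewrite -[tab t.+2]/(tab_step (tab t.+1)).
have reE : [ffun i => read_tape ((tab t.+1).1.2 i)] = [ffun i => read_tape (cf.2 i)].
  by apply/ffunP => i; rewrite !ffunE (teq_read (IHt i)).
have aE : (tab t.+1).2 = Some (cf.1, [ffun i => read_tape (cf.2 i)]).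
  by rewrite -reE -IHq.
rewrite /tab_step aE /tm_step /=; case: ifP => h; split=> // i /=.
- rewrite ffunE; have [e1 e2] := IHt i; split=> k /=; first exact: e1.
  by rewrite -e2; case: k => [|k] /=; rewrite ?nth_behead // -(teq_read (IHt i)) nth0.
- by rewrite [X in teq _ X]ffunE; apply: teq_act; exact: IHt.
Qed.

Variable P : nat.
Hypothesis P_gt1 : 1 < P.

                                                                               
(** Rows of length [P] are laid end to end, so neighbours are found at the distances 1, [P + 1], [P]
    and [P - 1], without regard to row boundaries. The list of earlier tiles makes this a structural
    recursion. *)
Fixpoint hist (n : nat) : seq tile :=
  if n is m.+1 then
    let s := hist m in
    let h := nth (true_tile 0 0) s in
    rcons s (if m < P then true_tile 0 m
             else next_tile (h (m - 1)) (h (m - P - 1)) (h (m - P)) (h (m - P + 1)))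
  else [::].

Definition history (l : nat) : tile := nth (true_tile 0 0) (hist l.+1) l.

Lemma size_hist n : size (hist n) = n.
Proof. by elim: n => //= n IH; rewrite size_rcons IH. Qed.

Lemma nth_hist n l : l < n -> nth (true_tile 0 0) (hist n) l = history l.
Proof.
elim: n => // n IH; rewrite ltnS leq_eqVlt => /orP[/eqP -> //|ln].
by rewrite /= nth_rcons size_hist ln IH.
Qed.

Lemma historyE l : history l = if l < P then true_tile 0 l
  else next_tile (history (l - 1)) (history (l - P - 1)) (history (l - P))
                 (history (l - P + 1)).
Proof.
rewrite {1}/history /= nth_rcons size_hist ltnn eqxx; case: ltnP => // Pl.
by rewrite !nth_hist //; lia.
Qed.

                                                                     
(** In the last column, the neighbour above right is really the start of another row. The error it
    brings in spreads left by at most one column per row, which leaves the triangle [p + t < P]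
    intact; it contains column 0 of each of the first [P] rows. *)
Lemma history_true t p : p + t < P -> history (t * P + p) = true_tile t p.
Proof.
elim: t p => [|t IHt] p pt; first by rewrite historyE ifT //; lia.
elim: p pt => [|p IHp] pt.
  rewrite historyE ifF; last by nia.
  have -> : t.+1 * P + 0 - P = t * P + 0 by lia.
  have -> : t * P + 0 + 1 = t * P + 1 by lia.
  rewrite !IHt; try lia.
  (* In column 0 the two left neighbours belong to other rows, but [next_tile] ignores them
     there. *)
  rewrite (@next_tile_col0 _ (true_tile 0 0) _ (true_tile t 0)) //.
  exact: (@row_tile_next _ _ _ 0).
rewrite historyE ifF; last by nia.
have -> : t.+1 * P + p.+1 - P - 1 = t * P + p by lia.
have -> : t.+1 * P + p.+1 - P + 1 = t * P + p.+2 by lia.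
have -> : t.+1 * P + p.+1 - P = t * P + p.+1 by lia.
have -> : t.+1 * P + p.+1 - 1 = t.+1 * P + p by lia.
rewrite IHp ?IHt; try lia.
exact: (@row_tile_next _ _ _ p.+1).
Qed.

(** This holds for the erroneous tiles too, because the presence of a state is inherited from the
    tile directly above. *)
Lemma history_col0 l : (tstate (history l) != None) = (l %% P == 0).
Proof.
have [n] := ubnP l; elim: n l => // n IH l; rewrite ltnS => ln.
rewrite historyE; case: ltnP => lP.
  by rewrite modn_small // /tstate /=; case: (l == 0).
have -> : l %% P = (l - P) %% P by rewrite -{1}(subnK lP) modnDr.
rewrite -IH; last by lia.
by rewrite /next_tile; case E : (tstate (history (l - P))); rewrite /tstate.
Qed.

(** The condition on the action excludes row 0, where the start state may already be halting
    although the head is not yet on the input. *)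
Definition rejecting (g : tile) : bool :=
  if tstate g is Some q then
    [&& tm_halt q, tact g != None & tright g ord0 != Some true]
  else false.

Lemma read_output (c : config M) : read_tape (c.2 ord0) = ohead (tm_output c).
Proof. by rewrite /tm_output /read_tape; case: (c.2 ord0).2 => [|[]]. Qed.

Lemma true_tile_output t : tright (true_tile t.+1 0) ord0 =
  ohead (tm_output (iter t (@tm_step M) (tm_init M input))).
Proof.
rewrite -read_output /tright /= ffunE.
by have [_ /(_ ord0) /teq_read <-] := tab_run t; rewrite /read_tape nth0.
Qed.

Lemma halted_iter (c : config M) n m : tm_halt (iter n (@tm_step M) c).1 ->
  iter (n + m) (@tm_step M) c = iter n (@tm_step M) c.
Proof.
by move=> h; rewrite addnC; elim: m => //= m ->; rewrite /tm_step h.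
Qed.

Lemma accepting_history n b : computes_within M n input [:: b] -> n.+1 < P ->
  (forall l, l < P * P -> ~~ rejecting (history l)) -> b.
Proof.
move=> [h o] nP /(_ (n.+1 * P + 0)); rewrite history_true //.
have [e _] := tab_run n; have st : tstate (true_tile n.+1 0) = Some (tab n.+1).1.1 by [].
rewrite /rejecting st e h true_tile_output o /= => H.
have lP : n.+1 * P + 0 < P * P by nia.
by have := H lP; case: (b).
Qed.

Lemma history_accepting n : computes_within M n input [:: true] -> n.+1 < P ->
  forall l, l < P * P -> ~~ rejecting (history l).
Proof.
move=> [h o] nP l lP; case: (boolP (l %% P == 0)) => l0; last first.
  by move: l0; rewrite -history_col0 /rejecting; case: (tstate _).
have lE : l = l %/ P * P + 0 by rewrite addn0 {1}(divn_eq l P) (eqP l0) addn0.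
have lt : l %/ P < P by rewrite ltn_divLR //; lia.
rewrite lE history_true // /rejecting.
case: (l %/ P) lt => [|t] lt; first by rewrite /= /tact /= andbF.
have [e _] := tab_run t; have -> : tstate (true_tile t.+1 0) = Some (tab t.+1).1.1 by [].
rewrite e true_tile_output.
(* Two halted configurations of one run coincide, so this row already shows the accepting output. *)
apply/negP => /and3P[ht _]; rewrite (_ : iter t _ _ = iter n (@tm_step M) (tm_init M input)) ?o //.
case: (leqP t n) => tn; first by rewrite -(halted_iter (n - t) ht) subnKC.
by rewrite -(halted_iter (t - n) h) subnKC // ltnW.
Qed.

Definition first_tile : tile :=
  (Some (tm_start M), ([ffun=> None], [ffun=> None]), None).

Definition sym_tile (a : symbol) : tile :=
  (None, ([ffun=> None], [ffun i => if i == ord0 then a else None]), None).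

Lemma true_tile0 p : true_tile 0 p = if p is p'.+1
  then sym_tile (@nth symbol None [seq Some b | b <- input] p') else first_tile.
Proof.
rewrite /true_tile /row_tile /tab /= /first_tile /sym_tile.
case: p => [|p] /=; congr (_, (_, _), _); apply/ffunP => i; rewrite !ffunE;
  by rewrite /tapes0; case: (i == ord0); rewrite /= ?nth_nil.
Qed.

End Tableau.

                                              

(** * The clauses describing an accepting tableau *)

Variant class := First | Bit of bool | Wit | Blank | Later.

Definition is_wit (c : class) : bool := if c is Wit then true else false.

                                                                                 
                                                                            
(** The backward distances 0, 1, [P - 1], [P] and [P + 1] at which a clause looks; [OffL] leads to
    the tile above right, [OffR] to the one above left. *)
Variant offset := Off0 | Off1 | OffL | OffP | OffR.

Section Clauses.
Variable M : tm.
Local Notation tile := (tile M).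

                                                                                   
                                                                               
                            
(** Boolean variables of a location: whether the witness extends to it, the witness bit there, and,
    for every tile, whether that tile is present. *)
Definition vkind : finType := (bool + tile)%type.
Definition var_on : vkind := inl true.
Definition var_bit : vkind := inl false.
Definition var_tile (g : tile) : vkind := inr g.

Definition ckind : finType := (tile * tile * (tile * tile) + (tile + 'I_7))%type.

Definition olit : Type := (offset * (vkind * bool))%type.

Definition pos (v : vkind) : olit := (Off0, (v, true)).
Definition neg (v : vkind) : olit := (Off0, (v, false)).

(** An implication from the four neighbours to the new tile. Below a tile with a state, the literal
    for [b] is replaced by a copy of the one for [c]: at location [P] the distance [P + 1] leaves
    the sequence, and an absent literal would make the clause vacuous. *)
Definition step_clause (a b c d : tile) : seq olit :=
  [:: (Off1, (var_tile a, false));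
      (if tstate c is Some _ then (OffP, (var_tile c, false))
       else (OffR, (var_tile b, false)));
      (OffP, (var_tile c, false));
      (OffL, (var_tile d, false));
      pos (var_tile (next_tile a b c d))].

(** On witness locations, the first three clauses tie the tile to the two witness variables, a blank
    being used past the end of the witness; the fourth makes the part that is switched on an initial
    segment. *)
Definition init_clause (cl : class) (j : nat) : seq olit :=
  match cl with
  | First => if j == 0 then [:: pos (var_tile (first_tile M))] else [::]
  | Bit b => if j == 0 then [:: pos (var_tile (sym_tile M (Some b)))] else [::]
  | Blank => if j == 0 then [:: pos (var_tile (sym_tile M None))] else [::]
  | Wit => nth [::]
      [:: [:: neg var_on; neg var_bit; pos (var_tile (sym_tile M (Some true)))];
          [:: neg var_on; pos var_bit; pos (var_tile (sym_tile M (Some false)))];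
          [:: pos var_on; pos (var_tile (sym_tile M None))];
          [:: neg var_on; (Off1, (var_on, true))]] j
  | Later => [::]
  end.

                                                 
Definition clause_lits (cl : class) (k : ckind) : seq olit :=
  match k with
  | inl (a, b, (c, d)) => step_clause a b c d
  | inr (inl g) => if rejecting g then [:: neg (var_tile g)] else [::]
  | inr (inr j) => init_clause cl j
  end.

Lemma size_clause_lits cl k : size (clause_lits cl k) <= 6.
Proof.
case: k => [[[a b] [c d]]|[g|j]] //=; first by case: ifP.
case: cl => [|b|||] //=; try by case: ifP.
by case: j => [[|[|[|[|[|[|[|]]]]]]] H] /=.
Qed.

Section Formula.
Variables (P W : nat) (x : seq bool).
Hypothesis P_gt1 : 1 < P.
Hypothesis P_large : size (enc_word x) + W < P.

Definition dist (o : offset) : nat :=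
  match o with Off0 => 0 | Off1 => 1 | OffL => P - 1 | OffP => P | OffR => P + 1 end.

Definition class_of (l : nat) : class :=
  if P <= l then Later else if l is p.+1 then
    (if p < size (enc_word x) then Bit (nth false (enc_word x) p)
     else if p < size (enc_word x) + W then Wit else Blank)
  else First.

                                             
Definition olit_true (b : nat -> vkind -> bool) (l : nat) (o : olit) : bool :=
  (l < dist o.1) || (b (l - dist o.1) o.2.1 == o.2.2).

Definition clause_true (b : nat -> vkind -> bool) (l : nat) (k : ckind) : bool :=
  nilp (clause_lits (class_of l) k) || has (olit_true b l) (clause_lits (class_of l) k).

Definition wit_word (b : nat -> vkind -> bool) : seq bool :=
  flatten [seq if is_wit (class_of l) && b l var_on then [:: b l var_bit] else [::]
          | l <- iota 0 (P * P)].

Lemma wit_class l :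
  is_wit (class_of l) = (size (enc_word x) < l <= size (enc_word x) + W).
Proof.
rewrite /class_of; case: (leqP P l) => Pl /=; first by lia.
case: l Pl => [|p] Pl /=; first by lia.
case: ltnP => h1 /=; first by lia.
by case: ltnP => h2 /=; lia.
Qed.

Lemma wit_wordE b : wit_word b = flatten
  [seq if b ((size (enc_word x)).+1 + j) var_on then [:: b ((size (enc_word x)).+1 + j) var_bit]
       else [::] | j <- iota 0 W].
Proof.
rewrite /wit_word; set e := (size (enc_word x)).+1.
have -> : P * P = e + W + (P * P - e - W) by rewrite /e; nia.
rewrite !iotaD !map_cat !flatten_cat add0n.
have nil (s : seq nat) : (forall l, l \in s -> ~~ (e <= l < e + W)) ->
    flatten [seq if is_wit (class_of l) && b l var_on then [:: b l var_bit] else [::]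
            | l <- s] = [::].
  elim: s => //= l s IH h; rewrite wit_class IH => [|m ms]; last by apply: h; rewrite inE ms orbT.
  have := h l (mem_head _ _); rewrite /e => nl; rewrite ifF //; apply/negP; lia.
rewrite (nil (iota 0 e)) => [|l]; last by rewrite mem_iota; lia.
rewrite (nil (iota (0 + (e + W)) _)) ?cats0 => [|l]; last by rewrite mem_iota; lia.
rewrite cat0s -[in LHS](addn0 e) iotaDl -map_comp; congr flatten.
apply/eq_in_map => j; rewrite mem_iota => jW /=.
have h : size (enc_word x) < e + j <= size (enc_word x) + W by rewrite /e; lia.
by rewrite wit_class h.
Qed.

Lemma size_wit_word b : size (wit_word b) <= W.
Proof.
rewrite wit_wordE -[X in _ <= X](size_iota 0); elim: (iota 0 W) => //= j s IH.
by rewrite size_cat; case: (b _ var_on); rewrite /= ?add0n ?add1n ?ltnS // ltnW.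
Qed.

(** As [E] is decreasing, the word collects the values of [B] on an initial segment, so its
    positions agree with the indices. *)
Lemma nth_prefix_word (E B : nat -> bool) n :
  (forall j, j.+1 < n -> E j.+1 -> E j) ->
  forall j, @nth symbol None
    [seq Some b | b <- flatten [seq if E j then [:: B j] else [::] | j <- iota 0 n]] j
  = if (j < n) && E j then Some (B j) else None.
Proof.
elim: n => [|n IH] mono j; first by rewrite nth_nil.
have {}IH := IH (fun j jn => mono j (leqW jn)).
rewrite -addn1 iotaD map_cat flatten_cat map_cat nth_cat add0n /= cats0.
case En : (E n) => /=; last first.
  rewrite nth_nil; case: ltnP => h; rewrite ?IH.
    have -> : (j < n + 1) && E j = (j < n) && E j; last by [].
    by rewrite addn1 ltnS leq_eqVlt andb_orl; case: eqP => [->|]; rewrite ?En.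
  case: ifP => // /andP[]; rewrite addn1 ltnS leq_eqVlt => /orP[/eqP ->|jn Ej].
    by rewrite En.
  by have := IH j; rewrite jn Ej nth_default // => -[].
have all_E k : k <= n -> E (n - k).
  elim: k => [|k IHk] kn; first by rewrite subn0.
  apply: mono; first by lia.
  by rewrite (_ : (n - k.+1).+1 = n - k) ?IHk //; lia.
have sz : size [seq Some b | b <- flatten [seq if E j then [:: B j] else [::] | j <- iota 0 n]] = n.
  have sz (s : seq nat) : (forall k, k \in s -> E k) ->
      size (flatten [seq if E j then [:: B j] else [::] | j <- s]) = size s.
    elim: s => //= k s IHs h; rewrite size_cat h ?mem_head // IHs // => m ms.
    by apply: h; rewrite inE ms orbT.
  rewrite size_map sz ?size_iota // => k; rewrite mem_iota add0n => kn.
  by have := all_E (n - k) (leq_subr _ _); rewrite subKn // ltnW.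
rewrite sz; case: ltnP => jn; first by rewrite IH jn ltn_addr.
rewrite addn1 ltnS; case: (ltngtP j n) jn => // [jn|->] _.
  by rewrite nth_default //=; lia.
by rewrite subnn /= En.
Qed.

Section Soundness.
Variable b : nat -> vkind -> bool.
Hypothesis bT : forall l k, l < P * P -> clause_true b l k.

Let input := enc_word x ++ wit_word b.

(** The assignment [b] fixes row 0 of the tableau: it is the row for the word [input], which
    includes the witness read off from [b]. *)
Lemma nth_input p : p < P.-1 -> @nth symbol None [seq Some a | a <- input] p =
  match class_of p.+1 with
  | Bit a => Some a
  | Wit => if b p.+1 var_on then Some (b p.+1 var_bit) else None
  | _ => None
  end.
Proof.
move=> pP; rewrite /class_of leqNgt (_ : p.+1 < P) /=; last by lia.
rewrite /input map_cat nth_cat size_map; case: ltnP => h1.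
  by rewrite (nth_map false).
rewrite wit_wordE (@nth_prefix_word (fun j => b ((size (enc_word x)).+1 + j) var_on)
  (fun j => b ((size (enc_word x)).+1 + j) var_bit)).
  rewrite addSn subnKC //.
  have -> : (p - size (enc_word x) < W) = (p < size (enc_word x) + W) by lia.
  by case: (p < _).
move=> j jW; set l := _ + j.+1.
have lP : l < P * P by rewrite /l; nia.
have cl : class_of l = Wit.
  by have := wit_class l; rewrite (_ : _ && _ = true); [case: class_of|rewrite /l; lia].
have := bT (inr (inr (@Ordinal 7 3 isT))) lP.
rewrite /clause_true cl /= /olit_true /= orbF subn0 => H on.
have <- : l - 1 = (size (enc_word x)).+1 + j by rewrite /l; lia.
by move: H; rewrite on /= => /eqP.
Qed.

(** No clause says that a location carries a single tile. The implications force the tiles of the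
    actual run to be present, and further ones do no harm: since rejecting tiles are forbidden
    outright, the actual run contains none. *)
Lemma history_holds l : l < P * P -> b l (var_tile (history M input P l)).
Proof.
have [n] := ubnP l; elim: n l => // n IH l; rewrite ltnS => ln lP.
have [lt|ge] := ltnP l P.
  rewrite historyE // lt true_tile0.
  have cT j := bT (inr (inr j)) lP.
  case: l {ln} lP lt cT => [|p] lP lt cT.
    have := cT (@Ordinal 7 0 isT); rewrite /clause_true /class_of.
    rewrite leqNgt lt /= /olit_true /= orbF => /eqP //.
  rewrite nth_input; last by lia.
  move: cT; rewrite /clause_true.
  case E : (class_of p.+1) => [|a|||] cT.
  - by move: E; rewrite /class_of leqNgt lt /=; case: ifP => //; case: ifP.
  - have := cT (@Ordinal 7 0 isT); rewrite /= /olit_true /= orbF subn0 => /eqP //.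
  - have := cT (@Ordinal 7 0 isT); have := cT (@Ordinal 7 1 isT).
    have := cT (@Ordinal 7 2 isT); rewrite /= /olit_true /= !orbF !subn0.
    case: (b p.+1 var_on) => /=; last by move=> /eqP.
    by case: (b p.+1 var_bit) => /= _; [move=> _ /eqP|move=> /eqP].
  - have := cT (@Ordinal 7 0 isT); rewrite /= /olit_true /= orbF subn0 => /eqP //.
  - by move: E; rewrite /class_of leqNgt lt /=; case: ifP => //; case: ifP.
rewrite historyE // ltnNge ge /=.
set ga := history _ _ _ (l - 1); set gb := history _ _ _ (l - P - 1).
set gc := history _ _ _ (l - P); set gd := history _ _ _ (l - P + 1).
have ha : b (l - 1) (var_tile ga) by apply: IH; lia.
have hb : b (l - (P + 1)) (var_tile gb) by rewrite subnDA; apply: IH; lia.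
have hc : b (l - P) (var_tile gc) by apply: IH; lia.
have hd : b (l - (P - 1)) (var_tile gd).
  by rewrite (_ : l - (P - 1) = l - P + 1); [apply: IH; lia|lia].
have := bT (inl (ga, gb, (gc, gd))) lP.
rewrite /clause_true /= /olit_true /= ha hc hd subn0 orbF !orbF.
have -> : l < 1 = false by lia.
have -> : l < P = false by lia.
have -> : l < P - 1 = false by lia.
rewrite /=; case E : (tstate gc) => [q|] /=.
  by rewrite hc (_ : l < P = false) /=; [move=> /eqP|lia].
(* At location [P] the tile above is in column 0; elsewhere the distance [P + 1] stays within the
   sequence, so the literal for [b] is present. *)
have lP1 : P < l.
  have := history_col0 M input P_gt1 (l - P); rewrite -/gc E eqxx /=.
  by case: ltngtP ge => // <- _; rewrite subnn mod0n.
by rewrite hb (_ : l < P + 1 = false) /=; [move=> /eqP|lia].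
Qed.

Lemma clauses_sound n r : computes_within M n input [:: r] -> n.+1 < P -> r.
Proof.
move=> cw nP; apply: (accepting_history P_gt1 cw nP) => l lP.
apply/negP => rj; have := bT (inr (inl (history M input P l))) lP.
by rewrite /clause_true /= rj /= /olit_true /= subn0 history_holds.
Qed.

End Soundness.

Section Completeness.
Variables (w : seq bool) (n : nat).
Hypothesis w_size : size w <= W.
Hypothesis w_acc : computes_within M n (enc_word x ++ w) [:: true].
Hypothesis nP : n.+1 < P.

Let input := enc_word x ++ w.

(** [var_on] is true on every location up to the end of the witness, also before the witness starts:
    the monotonicity clause of the first witness location refers to its predecessor. *)
Definition run_assignment (l : nat) (v : vkind) : bool :=
  match v with
  | inl true => l <= size (enc_word x) + size w
  | inl false => nth false w (l - (size (enc_word x)).+1)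
  | inr g => g == history M input P l
  end.

Lemma clauses_complete l k : l < P * P -> clause_true run_assignment l k.
Proof.
move=> lP; rewrite /clause_true; case: k => [[[ga gb] [gc gd]]|[g|j]] /=.
- rewrite /olit_true /= subn0 orbF; case: ltnP => h1 //=; rewrite eqbF_neg.
  case: eqP => //= ->; case: (ltnP l P) => hP /=; first by rewrite !orbT.
  rewrite eqbF_neg; case: (eqVneq gc) => [gcE|] /=; last by rewrite !orbT.
  case: (ltnP l (P - 1)) => hL /=; first by rewrite !orbT.
  rewrite eqbF_neg; case: (eqVneq gd) => [gdE|] /=; last by rewrite !orbT.
  rewrite eqb_id; have hE := historyE M input P_gt1 l; rewrite ltnNge hP /= in hE.
  have -> : gd = history M input P (l - P + 1) by rewrite gdE; congr history; lia.
  case E : (tstate gc) => [q|] /=.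
    by rewrite hE gcE (@next_tile_col0 _ _ (history M input P (l - 1)) _
      (history M input P (l - P - 1))) ?eqxx ?orbT // -gcE E.
  case: (ltnP l (P + 1)) => hR //=; rewrite eqbF_neg.
  case: (eqVneq gb) => [->|] //=; rewrite subnDA hE gcE eqxx ?orbT //.
- case: ifP => // rj; rewrite /= /olit_true /= subn0 orbF eqbF_neg.
  by apply: contraTneq rj => ->; exact: (history_accepting P_gt1 w_acc nP).
- case: (ltnP l P) => [lt|ge]; last by rewrite /class_of ge.
  have hE : history M input P l = true_tile M input 0 l by rewrite historyE // lt.
  case: l lt {lP} hE => [|p] lt hE.
    rewrite /class_of leqNgt lt /=; case: eqP => //= _.
    by rewrite /olit_true /= hE true_tile0 eqxx.
  move: hE; rewrite true_tile0 /input map_cat nth_cat size_map => hE.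
  rewrite /class_of leqNgt lt /=; case: ltnP hE => h1 hE.
    rewrite /=; case: eqP => //= _; rewrite /olit_true /= subn0 hE.
    by rewrite (nth_map false) // eqxx.
  case: ltnP => h2 /=; last first.
    case: eqP => //= _; rewrite /olit_true /= subn0 hE nth_default ?eqxx //.
    by rewrite size_map; lia.
  have onE : run_assignment p.+1 var_on = (p - size (enc_word x) < size w).
    by rewrite /=; lia.
  have bitE : run_assignment p.+1 var_bit = nth false w (p - size (enc_word x)).
    by rewrite /= subSS.
  have tE a : run_assignment p.+1 (var_tile a) = (a == sym_tile M (if p - size (enc_word x) < size w
      then Some (nth false w (p - size (enc_word x))) else None)).
    rewrite /= hE; congr (_ == sym_tile _ _); case: ltnP => h.
      by rewrite (nth_map false).
    by rewrite nth_default // size_map.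
  case: j => [[|[|[|[|j]]]] jP] //=; rewrite /olit_true ?[(_.1)]/= ?[(_.2)]/= ?subn0.
  + rewrite onE bitE tE; case: (p - size (enc_word x) < size w) => //=.
    by case: (nth _ _ _); rewrite //= !eqxx.
  + rewrite onE bitE tE; case: (p - size (enc_word x) < size w) => //=.
    by case: (nth _ _ _); rewrite //= !eqxx.
  + by rewrite onE tE; case: (p - size (enc_word x) < size w); rewrite //= !eqxx.
  + by rewrite onE subSS subn0 /=; lia.
  + by rewrite nth_nil.
Qed.

End Completeness.

End Formula.
End Clauses.

                                  

(** * Numbering the tasks and encoding the instance *)

Section Instance.
Variable M : tm.
Local Notation vkind := (vkind M).
Local Notation ckind := (ckind M).

Definition kind : finType := ((vkind * bool) + (ckind * 'I_6))%type.

Definition wit_kinds : seq kind :=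
  [:: inl (var_on M, true); inl (var_on M, false);
      inl (var_bit M, true); inl (var_bit M, false)].

                                                                                  
                                                                                
(** Within each location, the tasks of the two witness variables come first, at known positions, so
    that a machine can find them in an encoded assignment. The rest of the enumeration stays
    opaque. *)
Lemma kinds_exist : {ks : seq kind | [/\ uniq ks, forall k, k \in ks,
  forall b, index (inl (var_on M, b)) ks = ~~ b &
  forall b, index (inl (var_bit M, b)) ks = 2 + ~~ b]}.
Proof.
exists (wit_kinds ++ [seq k <- enum kind | k \notin wit_kinds]); split.
- rewrite cat_uniq filter_uniq ?enum_uniq // andbT; apply/andP; split=> //.
  by apply/hasPn => k; rewrite mem_filter => /andP[].
- by move=> k; rewrite mem_cat mem_filter mem_enum andbT orbN.
- by case; rewrite index_cat.
- by case; rewrite index_cat.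
Qed.

Definition kinds : seq kind := sval kinds_exist.

Definition nkinds : nat := size kinds.

Lemma uniq_kinds : uniq kinds.
Proof. by rewrite /kinds; case: kinds_exist => ks /= []. Qed.

Lemma mem_kinds k : k \in kinds.
Proof. by rewrite /kinds; case: kinds_exist => ks /= []. Qed.

Lemma index_var_on b : index (inl (var_on M, b)) kinds = ~~ b.
Proof. by rewrite /kinds; case: kinds_exist => ks /= []. Qed.

Lemma index_var_bit b : index (inl (var_bit M, b)) kinds = 2 + ~~ b.
Proof. by rewrite /kinds; case: kinds_exist => ks /= []. Qed.

(** Literal kinds come in twos and clause kinds in sixes. Hence the parity of a task number depends
    only on the position of its kind, not on its location. *)
Lemma odd_nkinds : odd nkinds = false.
Proof.
rewrite /nkinds (perm_size (uniq_perm uniq_kinds (enum_uniq kind) _)); last first.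
  by move=> k; rewrite mem_kinds mem_enum.
by rewrite -cardE card_sum !card_prod card_bool card_ord oddD !oddM !andbF.
Qed.

Lemma nkinds_ge4 : 4 <= nkinds.
Proof.
by rewrite -(_ : (index (inl (var_bit M, false)) kinds).+1 = 4) ?index_mem ?mem_kinds // index_var_bit.
Qed.

Lemma nkinds_gt0 : 0 < nkinds. Proof. exact: leq_trans nkinds_ge4. Qed.

Definition kind0 : kind := inl (var_on M, true).

Definition kind_at (j : nat) : kind := nth kind0 kinds (j %% nkinds).

Section Blocks.
Variable N : nat.

Lemma flatten_blocks (T : Type) (F : nat -> seq T) m :
  flatten [seq F u | u <- iota 0 (N * m)] =
  flatten [seq flatten [seq F (l * m + k) | k <- iota 0 m] | l <- iota 0 N].
Proof.
elim: N => // n IH.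
rewrite -addn1 mulnDl mul1n !iotaD !map_cat !flatten_cat IH /= cats0; congr cat.
by rewrite !add0n -[in LHS](addn0 (n * m)) iotaDl -map_comp.
Qed.

Lemma flatten_kinds (T : Type) (G : nat -> kind -> seq T) :
  flatten [seq G (u %/ nkinds) (kind_at u) | u <- iota 0 (N * nkinds)] =
  flatten [seq flatten [seq G l k | k <- kinds] | l <- iota 0 N].
Proof.
rewrite (flatten_blocks (fun u => G (u %/ nkinds) (kind_at u))); congr flatten.
apply: eq_map => l; congr flatten.
rewrite -[in RHS](mkseq_nth kind0 kinds) /mkseq -map_comp.
apply/eq_in_map => k; rewrite mem_iota add0n => /andP[_ km] /=.
by rewrite /kind_at divnMDl ?nkinds_gt0 // divn_small // addn0 modnMDl modn_small.
Qed.

Lemma map_enum_ord (T : Type) n (F : nat -> T) :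
  [seq F (val i) | i <- enum 'I_n] = [seq F i | i <- iota 0 n].
Proof. by rewrite -val_enum_ord -map_comp. Qed.

End Blocks.

Section Layout.
Variables (P W : nat) (x : seq bool).

Let N := P * P.

Definition vloc : finType := ('I_N * vkind)%type.
Definition cloc : finType := ('I_N * ckind)%type.
Local Notation code := ((vloc * bool) + (cloc * 'I_6))%type.

Definition pack (l : 'I_N) (k : kind) : code :=
  match k with
  | inl vb => inl ((l, vb.1), vb.2)
  | inr cs => inr ((l, cs.1), cs.2)
  end.

Definition code_loc (c : code) : 'I_N :=
  match c with inl vb => vb.1.1 | inr cs => cs.1.1 end.

Definition code_kind (c : code) : kind :=
  match c with inl vb => inl (vb.1.2, vb.2) | inr cs => inr (cs.1.2, cs.2) end.

Lemma packK c : pack (code_loc c) (code_kind c) = c.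
Proof. by case: c => [[[l v] b]|[[l c] s]]. Qed.

Lemma pack_loc l k : code_loc (pack l k) = l. Proof. by case: k => -[]. Qed.
Lemma pack_kind l k : code_kind (pack l k) = k. Proof. by case: k => -[]. Qed.

Lemma loc_proof (j : 'I_(N * nkinds)) : j %/ nkinds < N.
Proof. by rewrite ltn_divLR ?nkinds_gt0. Qed.

Definition dec_task (j : 'I_(N * nkinds)) : code :=
  pack (Ordinal (loc_proof j)) (kind_at j).

Lemma enc_proof (c : code) :
  code_loc c * nkinds + index (code_kind c) kinds < N * nkinds.
Proof.
have: index (code_kind c) kinds < nkinds by rewrite index_mem mem_kinds.
have := ltn_ord (code_loc c); nia.
Qed.

Definition enc_task (c : code) : 'I_(N * nkinds) := Ordinal (enc_proof c).

Lemma dec_taskK : cancel dec_task enc_task.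
Proof.
move=> j; apply: val_inj; rewrite /= pack_loc pack_kind /=.
by rewrite /kind_at index_uniq ?uniq_kinds -?divn_eq // ltn_pmod ?nkinds_gt0.
Qed.

Lemma enc_taskK : cancel enc_task dec_task.
Proof.
move=> c; rewrite /dec_task -[RHS]packK.
have km : index (code_kind c) kinds < nkinds by rewrite index_mem mem_kinds.
congr pack; first by apply: val_inj; rewrite /= divnMDl ?nkinds_gt0 // divn_small ?addn0.
by rewrite /kind_at /= modnMDl modn_small // nth_index // mem_kinds.
Qed.

Lemma back_proof (l : 'I_N) d : l - d < N.
Proof. exact: leq_ltn_trans (leq_subr _ _) (ltn_ord l). Qed.

(** Short clauses are padded to six slots by repeating their first literal; an empty clause has no
    literal in any slot and counts as true. *)
Definition slot_lit (cl : class) (c : ckind) (s : nat) : option (olit M) :=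
  if clause_lits cl c is o :: ls then Some (nth o (o :: ls) s) else None.

Definition tab_lit (c : cloc) (s : 'I_6) : option (vloc * bool) :=
  if slot_lit (class_of P W x c.1) c.2 s is Some o then
    (if dist P o.1 <= c.1 then Some ((Ordinal (back_proof c.1 (dist P o.1)), o.2.1), o.2.2)
     else None)
  else None.

Definition tab_instance : instance := gadget enc_taskK tab_lit.

Lemma tab_satisfies (b : nat -> vkind -> bool) :
  satisfies tab_lit (fun v => b v.1 v.2) <->
  forall l k, l < N -> clause_true P W x b l k.
Proof.
have key (l : 'I_N) k : (exists s, lit_true (fun v : vloc => b v.1 v.2) (tab_lit (l, k) s)) <->
    clause_true P W x b l k.
  rewrite /clause_true /tab_lit /slot_lit /=.
  have := size_clause_lits (class_of P W x l) k.
  case E : (clause_lits _ _) => [|o ls] sz; first by split=> // _; exists ord0.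
  rewrite (_ : nilp (o :: ls) = false) // orFb; split=> [ [s ht]|].
    apply/(has_nthP o); exists (if s <= size ls then val s else 0) => /=.
      by case: ifP.
    rewrite (_ : nth o (o :: ls) (if _ then _ else _) = nth o (o :: ls) s); last first.
      by case: ifPn => //; rewrite -ltnNge => h; rewrite [RHS]nth_default.
    by move: ht; rewrite /olit_true; case: leqP.
  move=> /(has_nthP o)[s ss ht]; exists (inord s).
  rewrite inordK; last exact: leq_trans ss sz.
  move: ht; rewrite /olit_true; case: leqP => //= h.
split=> [h l k lN|h [l k]]; last by apply/key; exact: h.
exact: (key (Ordinal lN) k).1 (h (Ordinal lN, k)).
Qed.

Definition arc_bit (cl : class) (near : offset -> bool) (k k' : kind) : bool :=
  match k, k' with
  | inl vb, inr cs =>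
      if slot_lit cl cs.1 cs.2 is Some o then near o.1 && (o.2 == vb) else false
  | _, _ => false
  end.

Definition arc_bits (cl : class) (near : offset -> bool) (k : kind) : seq bool :=
  [seq arc_bit cl near k k' | k' <- kinds].

Definition able_kind (k k' : kind) : bool :=
  match k, k' with
  | inl vb, inl vb' => vb.2 && (vb.1 == vb'.1)
  | inr cs, inr cs' => (cs.1 == cs'.1) && (cs.2 < 5)
  | _, _ => false
  end.

Definition prob_bits (cl : class) (near : offset -> bool) (k : kind) : seq bool :=
  flatten [seq enc_rat ((near Off0 && able_kind k k') : nat)%:R%R | k' <- kinds].

(** Both matrices have this shape: an entry depends on the kinds of its row and column, on the class
    of the column location, and on which offsets separate the two locations. This is finite
    information, so a table suffices to emit all entries of a row within one location. *)
Definition matrix_bits (em : class -> (offset -> bool) -> kind -> seq bool) : seq bool :=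
  flatten [seq flatten [seq flatten
    [seq em (class_of P W x l') (fun o => l' == l + dist P o) k
    | l' <- iota 0 N] | k <- kinds] | l <- iota 0 N].

Lemma arc_nat (u v : 'I_(N * nkinds)) : gadget_arc dec_task tab_lit u v =
  arc_bit (class_of P W x (v %/ nkinds)) (fun o => v %/ nkinds == u %/ nkinds + dist P o)
    (kind_at u) (kind_at v).
Proof.
rewrite /gadget_arc /dec_task; case: (kind_at u) => [[v0 b0]|[c0 s0]] //=;
  case: (kind_at v) => [[v1 b1]|[c1 s1]] //=.
rewrite /tab_lit /=; case: (slot_lit _ _ _) => [ [d [v2 b2] ]|] //=.
case: leqP => h /=; last first.
  have -> : (v %/ nkinds == u %/ nkinds + dist P d) = false; last by [].
  by apply/negbTE; rewrite neq_ltn (leq_trans h (leq_addl _ _)).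
apply/eqP/andP => [[] <- -> ->|[/eqP e /eqP[-> ->]]]; first by rewrite subnK.
by congr (Some (_, _, _)); apply: val_inj; rewrite /= e addnK.
Qed.

Lemma prob_nat (u v : 'I_(N * nkinds)) : gadget_prob dec_task u v =
  ((v %/ nkinds == u %/ nkinds + dist P Off0) && able_kind (kind_at u) (kind_at v) : nat)%N%:R%R.
Proof.
rewrite /gadget_prob /dec_task /= addn0; congr (nat_of_bool _)%:R%R.
case: (kind_at u) => [[v0 b0]|[c0 s0]] //=; case: (kind_at v) => [[v1 b1]|[c1 s1]] //=;
  rewrite ?andbF //.
  rewrite xpair_eqE -val_eqE /= [v %/ _ == _]eq_sym.
  by case: b0; rewrite ?andbF.
by rewrite xpair_eqE -val_eqE /= [v %/ _ == _]eq_sym andbA.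
Qed.

Lemma enc_tab_instance : enc_instance tab_instance =
  enc_unary (N * nkinds) ++ enc_unary (N * nkinds) ++
  matrix_bits arc_bits ++ matrix_bits prob_bits.
Proof.
rewrite /enc_instance; congr (_ ++ (_ ++ (_ ++ _))).
  pose A u v := arc_bit (class_of P W x (v %/ nkinds))
    (fun o => v %/ nkinds == u %/ nkinds + dist P o) (kind_at u) (kind_at v).
  transitivity (flatten [seq [seq A u v | v <- iota 0 (N * nkinds)] | u <- iota 0 (N * nkinds)]).
    rewrite -(map_enum_ord (N * nkinds) (fun u => [seq A u v | v <- iota 0 (N * nkinds)])).
    congr flatten; apply: eq_map => u.
    by rewrite -map_enum_ord; apply: eq_map => v; exact: arc_nat.
  pose G l (k : kind) := flatten [seq arc_bits (class_of P W x l') (fun o => l' == l + dist P o) k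
    | l' <- iota 0 N].
  rewrite -[RHS]/(flatten [seq flatten [seq G l k | k <- kinds] | l <- iota 0 N]).
  rewrite -(flatten_kinds _ G); congr flatten; apply: eq_map => u.
  pose H l' (k' : kind) := [:: arc_bit (class_of P W x l')
    (fun o => l' == u %/ nkinds + dist P o) (kind_at u) k'].
  transitivity (flatten [seq H (v %/ nkinds) (kind_at v) | v <- iota 0 (N * nkinds)]).
    by rewrite flatten_map1.
  by rewrite (flatten_kinds _ H) /G; congr flatten; apply: eq_map => l'; rewrite /H flatten_map1.
pose B u v := enc_rat ((v %/ nkinds == u %/ nkinds + dist P Off0)
  && able_kind (kind_at u) (kind_at v) : nat)%N%:R%R.
transitivity (flatten [seq flatten [seq B u v | v <- iota 0 (N * nkinds)] | u <- iota 0 (N * nkinds)]).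
  rewrite -(map_enum_ord (N * nkinds) (fun u => flatten [seq B u v | v <- iota 0 (N * nkinds)])).
  transitivity (flatten (flatten [seq [seq enc_rat (gadget_prob dec_task u v)
     | v <- enum 'I_(N * nkinds)] | u <- enum 'I_(N * nkinds)])); first by [].
  have gen s : flatten (flatten [seq [seq enc_rat (gadget_prob dec_task u v)
     | v <- enum 'I_(N * nkinds)] | u <- s]) =
      flatten [seq flatten [seq B (val i) v | v <- iota 0 (N * nkinds)] | i <- s].
    elim: s => //= u s IH; rewrite flatten_cat {}IH; congr (_ ++ _); congr flatten.
    by rewrite -map_enum_ord; apply: eq_map => v; rewrite prob_nat.
  exact: gen.
pose G l (k : kind) := flatten [seq prob_bits (class_of P W x l') (fun o => l' == l + dist P o) k
  | l' <- iota 0 N].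
rewrite -[RHS]/(flatten [seq flatten [seq G l k | k <- kinds] | l <- iota 0 N]).
  rewrite -(flatten_kinds _ G); congr flatten; apply: eq_map => u.
pose H l' (k' : kind) := enc_rat ((l' == u %/ nkinds + dist P Off0)
  && able_kind (kind_at u) k' : nat)%N%:R%R.
by rewrite -[LHS]/(flatten [seq H (v %/ nkinds) (kind_at v) | v <- iota 0 (N * nkinds)]) (flatten_kinds _ H).
Qed.

Definition assigned (s : policy tab_instance) (j : nat) : nat :=
  if insub j is Some i then
    (if s finset.set0 i is Some t then (t : 'I_(N * nkinds)).+1 else 0) else 0.

(** Task [j] is encoded as [j.+1] and the literal [true] precedes the literal [false], so an odd
    number means that the true literal is attempted. *)
Definition read_off (v : nat -> nat) (l : nat) (k : vkind) : bool :=
  match k with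
  | inl true => odd (v (l * nkinds))
  | inl false => odd (v (l * nkinds + 2))
  | inr _ => false
  end.

Lemma enc_assignment_tab (s : policy tab_instance) :
  enc_assignment (s finset.set0) =
  flatten [seq flatten [seq enc_unary (assigned s (l * nkinds + k)) | k <- iota 0 nkinds]
          | l <- iota 0 N].
Proof.
rewrite -(flatten_blocks N (fun u => enc_unary (assigned s u))) /enc_assignment.
rewrite -map_enum_ord; congr flatten; apply: eq_map => i.
by rewrite /assigned; case: insubP => [j _ /val_inj ->|]; rewrite ?ltn_ord.
Qed.

Lemma wit_word_ext (b b' : nat -> vkind -> bool) :
  (forall l, l < N -> b l (var_on M) = b' l (var_on M) /\ b l (var_bit M) = b' l (var_bit M)) ->
  wit_word P W x b = wit_word P W x b'.
Proof.
move=> e; congr flatten; apply/eq_in_map => l; rewrite mem_iota add0n => /andP[_ lN].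
by have [-> ->] := e l lN.
Qed.

Hypothesis P_gt1 : 1 < P.
Hypothesis P_large : size (enc_word x) + W < P.

Lemma min_time_tab (R : realType) w n : size w <= W ->
  computes_within M n (enc_word x ++ w) [:: true] -> n.+1 < P ->
  (min_expected_time R tab_instance <= 3%:R%:E)%E.
Proof.
move=> wW wacc nP.
have /tab_satisfies/(gadget_complete dec_taskK enc_taskK) [s [rs fs]] :=
  clauses_complete P_gt1 P_large wW wacc nP.
apply: (@le_trans _ _ (expected_time s R)).
  by apply: ereal_inf_lbound; exists s.
by apply: expected_time_le fs; exact: gadget_prob01.
Qed.

(** On a regimen faster than four rounds, the word read off from its first round is a witness that
    the verifier accepts. *)
Lemma extract_tab (R : realType) (s : policy tab_instance) n r :
  is_regimen s -> (expected_time s R < 4%:R%:E)%E ->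
  computes_within M n (enc_word x ++ wit_word P W x (read_off (assigned s))) [:: r] ->
  n.+1 < P -> r.
Proof.
move=> rs es cw nP.
have f3 := expected_time_lt (@gadget_prob01 _ _ _ _ _ _ _) es.
pose wk (v : vloc) := worker enc_taskK tab_lit (inl (v, true)).
(* Witness variables are read through parities, exactly as the decider does; tile variables are read
   directly, as they only matter for the proof. *)
pose b (l : nat) (k : vkind) := match k with
  | inr g => if insub l is Some i then
       s finset.set0 (wk (i, k)) == Some (task enc_taskK tab_lit (inl ((i, k), true)))
     else false
  | _ => read_off (assigned s) l k end.
have sat : satisfies tab_lit (fun v => b v.1 v.2).
  apply: (gadget_sound dec_taskK rs f3) => -[l k] b' e.
  have av j t : s finset.set0 j = Some t -> assigned s (j : 'I_(N * nkinds)) =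
      (t : 'I_(N * nkinds)).+1.
    by move=> st; rewrite /assigned; case: insubP => [i _ /val_inj ->|]; rewrite ?ltn_ord ?st.
  case: k e => [[]|g] e.
  - have := av _ _ e; rewrite [_ (wk _)]/= !index_var_on addn0 => aE.
    by rewrite /b /read_off aE /= index_var_on oddD oddM odd_nkinds andbF /=; case: (b').
  - have := av _ _ e; rewrite [_ (wk _)]/= !index_var_bit addn0 => aE.
    by rewrite /b /read_off aE /= index_var_bit !oddD oddM odd_nkinds andbF /=; case: (b').
  - rewrite /b /=; case: insubP => [i _ /val_inj ->|]; last by rewrite ltn_ord.
    rewrite e; case: (b'); first exact: eqxx.
    by apply/negP => /eqP /(congr1 (omap (@dec_task))); rewrite /= !enc_taskK.
have bT := (tab_satisfies b).1 sat.
rewrite (wit_word_ext (b' := b)) // in cw.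
exact: (clauses_sound P_gt1 P_large bT cw nP).
Qed.

End Layout.
End Instance.

(** * Programs that write words and matrices *)

Section Writing.
Variable mach : nat -> tm.
Notation cmd := (cmd mach).
Implicit Types (s : store) (y : nat -> seq bool).

Definition bits (u : seq bool) : seq symbol := [seq Some b | b <- u].

Variant piece := Lit of seq bool | Map of nat & (bool -> seq bool).

Definition piece_written y (p : piece) : seq bool :=
  match p with Lit u => u | Map a g => flatten [seq g b | b <- y a] end.

Definition written y (ps : seq piece) : seq bool :=
  flatten [seq piece_written y p | p <- ps].

Definition piece_cost y (p : piece) : nat :=
  match p with
  | Lit u => 2 * size u + 1
  | Map a g => (size (y a) + 2) * (2 * (size (g true) + size (g false)) + 12)
  end.

Definition cost y (ps : seq piece) : nat := sumn [seq piece_cost y p + 1 | p <- ps] + 1.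

Definition put_piece (o : nat) (p : piece) : cmd :=
  match p with
  | Lit u => emits mach o (bits u)
  | Map a g => eachr mach a o (fun x => if x is Some b then bits (g b) else [::])
  end.

Definition append (o : nat) (ps : seq piece) : cmd := seqs [seq put_piece o p | p <- ps].

Definition source_ok y (o : nat) s (p : piece) : Prop :=
  if p is Map a _ then a <> o /\ s a = word (y a) else True.

Lemma size_bits u : size (bits u) = size u. Proof. exact: size_map. Qed.

Lemma images_bits g (u : seq bool) :
  images (fun x => if x is Some b then bits (g b) else [::]) u = bits (flatten [seq g b | b <- u]).
Proof. by rewrite /images /bits map_flatten -map_comp. Qed.

Lemma does_append y o ps s t : s o = (t, Posz (size t)) ->
  (forall i, (i < size ps)%N -> source_ok y o s (nth (Lit [::]) ps i)) ->
  does (append o ps) (cost y ps) s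
    (upd s o (t ++ bits (written y ps), Posz (size t + size (written y ps)))).
Proof.
elim: ps s t => [|p ps IH] s t e ok.
  apply: does_ext (does_nop _) _ => i; rewrite /upd cats0 addn0.
  by case: eqP => [->|].
have H1 : does (put_piece o p) (piece_cost y p) s
    (upd s o (t ++ bits (piece_written y p), Posz (size (t ++ bits (piece_written y p))))).
  have := ok 0 isT; case: p {ok} => [u _|a g [ao ea]] /=.
    have H := does_emits mach (bits u) e.
    by apply: does_conv H _ _ => [i|]; rewrite ?size_cat ?size_bits // addn1.
  have gG b : size (bits (g b)) <= size (g true) + size (g false).
    by rewrite size_bits; case: b; rewrite ?leq_addr ?leq_addl.
  have H := @does_eachr mach a o (fun x => if x is Some b then bits (g b) else [::])
     (size (g true) + size (g false)) s (y a) t ao ea e gG.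
  by apply: does_conv H _ _ => [i|]; rewrite ?images_bits.
set s1 := upd _ _ _ in H1.
have e1 : s1 o = (t ++ bits (piece_written y p), Posz (size (t ++ bits (piece_written y p)))).
  by rewrite /s1 upd_eq.
have H2 := IH _ _ e1; rewrite /append /= in H2 *.
apply: does_conv (does_seq H1 (H2 _)) _ _.
- move=> i ips; have := ok i.+1 ips; rewrite /=.
  case: (nth _ ps i) => // a g [ao ea]; split=> //.
  by rewrite /s1 upd_ne.
- move=> i; rewrite /s1 /upd; case: eqP => // _.
  by rewrite /written /= /bits map_cat catA !size_cat size_map addnA.
- by rewrite /cost /=; lia.
Qed.

Definition fill (o : nat) (ps : seq piece) : cmd := Seq (append o ps) (rewind mach o [:: o]).

Lemma does_fill y o ps s : s o = ([::], 0%R) ->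
  (forall i, (i < size ps)%N -> source_ok y o s (nth (Lit [::]) ps i)) ->
  does (fill o ps) (cost y ps + 5 * (size (written y ps) + 2) + 1) s
    (upd s o (word (written y ps))).
Proof.
move=> e ok; have H1 := does_append (t := [::]) e ok.
set s1 := upd _ _ _ in H1.
have e1 : s1 o = ([seq Some b | b <- written y ps], Posz (size (written y ps))).
  by rewrite /s1 upd_eq.
apply: does_conv (does_seq H1 (does_rewind1 mach e1)) _ _; last by lia.
by move=> i; rewrite /s1 /upd; case: eqP.
Qed.

Section Matrix.
Variables (K : Type) (em : seq symbol -> K -> seq bool) (G : nat).
Hypothesis emG : forall r k, size (em r k) <= G.
Variables (lead out cnt : nat) (rl dl : seq nat).
Hypothesis uniq_rl : uniq (lead :: rl).
Hypothesis uniq_dl : uniq dl.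
Hypothesis dl_rl : {subset dl <= rl}.
Hypothesis out_rl : out \notin lead :: rl.
Hypothesis cnt_out : cnt \notin [:: out, lead & rl].
Variable N : nat.

Definition inner (k : K) : cmd :=
  Seq (While lead isSome
        (Seq (switches rl (fun r => emits mach out (bits (em r k)))) (moves mach (lead :: rl) Right)))
      (rewind mach lead (lead :: rl)).

Definition inner_bits s (k : K) : seq bool :=
  flatten [seq em [seq cell (s i).1 ((s i).2 + j%:Z)%R | i <- rl] k | j <- iota 0 N].

Definition inner_cost : nat := (N + 2) * (2 * G + 8 * size rl + 20).

Lemma does_inner s k t : s lead = unary N -> s out = (t, Posz (size t)) ->
  does (inner k) inner_cost s
    (upd s out (t ++ bits (inner_bits s k), Posz (size (t ++ bits (inner_bits s k))))).
Proof.
move=> el eo.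
pose outs j := t ++ bits (flatten [seq em [seq cell (s i).1 ((s i).2 + j%:Z)%R | i <- rl] k
                          | j <- iota 0 j]).
pose S j := upd (shift_heads (lead :: rl) j%:Z s) out (outs j, Posz (size (outs j))).
have Sl j : S j lead = (nseq N (Some true : symbol), Posz j).
  rewrite /S upd_ne; last by move=> e; move: out_rl; rewrite -e mem_head.
  by rewrite /shift_heads mem_head el /= map_nseq add0r.
have H1 : does (While lead isSome
        (Seq (switches rl (fun r => emits mach out (bits (em r k)))) (moves mach (lead :: rl) Right)))
      (N * (2 * G + 3 * size rl + 8)).+1 (S 0) (S N).
  have -> : 2 * G + 3 * size rl + 8 = (2 * G + 3 * size rl + 7).+1 by lia.
  apply: does_while => [j jN|]; rewrite Sl /scan /= nth_nseq ?ltnn // jN; split=> //.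
  have rE : [seq scan (S j i) | i <- rl] = [seq cell (s i).1 ((s i).2 + j%:Z)%R | i <- rl].
    apply/eq_in_map => i irl; rewrite /S upd_ne; last first.
      by move=> e; move: out_rl; rewrite -e inE irl orbT.
    by rewrite /shift_heads inE irl orbT.
  have So : S j out = (outs j, Posz (size (outs j))) by rewrite /S upd_eq.
  have Ha := does_switches (l := rl) (f := fun r => emits mach out (bits (em r k)))
    (s := S j) (does_emits mach _ So).
  apply: does_conv (does_seq Ha (does_moves mach Right _ uniq_rl)) _ _.
    move=> i; rewrite /S rE /shift_heads /upd; case: (eqVneq i out) => [->|io].
      rewrite (negPf out_rl); congr (_, _).
        by rewrite /outs -addn1 iotaD map_cat flatten_cat /= cats0 /bits map_cat catA.
      by rewrite /outs -addn1 iotaD map_cat flatten_cat /= cats0 /bits map_cat catA [in RHS]size_cat.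
    by case: (i \in lead :: rl) => //=; congr (_, _); lia.
  by rewrite size_bits /=; have := emG [seq scan (S j i) | i <- rl] k; lia.
have kN : N <= size (nseq N (Some true : symbol)) by rewrite size_nseq.
have al : all isSome (nseq N (Some true : symbol)) by rewrite all_nseq orbT.
have H2 := does_rewind mach uniq_rl (mem_head _ _) (Sl N) kN al.
have S0 i : S 0 i = s i.
  rewrite /S /outs /= cats0 /upd /shift_heads; case: eqP => [->//|_].
  by case: ifP => // _; rewrite addr0; case: (s i).
apply: does_conv (does_seq (does_ext_l H1 S0) H2) _ _.
  move=> i; rewrite /shift_heads /S /upd; case: (eqVneq i out) => [->|io].
    by rewrite (negPf out_rl).
  by rewrite /shift_heads; case: (i \in lead :: rl) => //=; rewrite addrK; case: (s i).
by rewrite /inner_cost /=; nia.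
Qed.

Definition row_bits s (ks : seq K) : seq bool := flatten [seq inner_bits s k | k <- ks].

Lemma inner_bits_ext s s' k : (forall i, i \in rl -> s i = s' i) ->
  inner_bits s k = inner_bits s' k.
Proof.
move=> e; congr flatten; apply: eq_map => j; congr em.
by apply/eq_in_map => i /e ->.
Qed.

Lemma does_row s ks t : s lead = unary N -> s out = (t, Posz (size t)) ->
  does (seqs [seq inner k | k <- ks]) (size ks * (inner_cost + 1) + 1) s
    (upd s out (t ++ bits (row_bits s ks), Posz (size (t ++ bits (row_bits s ks))))).
Proof.
elim: ks s t => [|k ks IH] s t el eo.
  apply: does_ext (does_nop _) _ => i; rewrite /upd /row_bits /= cats0.
  by case: eqP => [->|].
have H1 := does_inner k el eo; set s1 := upd _ _ _ in H1.
have e1 : s1 out = (t ++ bits (inner_bits s k), Posz (size (t ++ bits (inner_bits s k)))).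
  by rewrite /s1 upd_eq.
have l1 : s1 lead = unary N.
  by rewrite /s1 upd_ne // => e; move: out_rl; rewrite -e mem_head.
have rE : row_bits s1 ks = row_bits s ks.
  congr flatten; apply: eq_map => k'; apply: inner_bits_ext => i irl.
  by rewrite /s1 upd_ne // => e; move: out_rl; rewrite -e inE irl orbT.
have H2 := IH _ _ l1 e1; rewrite rE in H2.
apply: does_conv (does_seq H1 H2) _ _; last by rewrite /=; lia.
move=> i; rewrite /s1 /upd; case: eqP => // _.
by rewrite /row_bits /= /bits map_cat catA.
Qed.

Variable ks : seq K.

(** The inner loop runs over the column location [j] with the heads [rl] advancing; after each row
    location the heads [dl] step left. The tapes [dl] are thus read at positions depending on
    [j - l], which reveals the offset between the locations. The final loop restores the heads. *)
Definition matrix_prog : cmd :=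
  Seq (While cnt isSome (Seq (seqs [seq inner k | k <- ks])
                             (Seq (moves mach dl Left) (Act cnt id Right))))
 (Seq (rewind mach cnt [:: cnt])
 (Seq (While lead isSome (moves mach (lead :: dl) Right)) (rewind mach lead [:: lead]))).

Definition matrix_bits_of s : seq bool :=
  flatten [seq row_bits (shift_heads dl (- l%:Z)%R s) ks | l <- iota 0 N].

Definition matrix_cost : nat :=
  (N + 2) * (size ks * (inner_cost + 1) + 8 * size dl + 20).

Lemma does_matrix s t : s lead = unary N -> s cnt = unary N -> s out = (t, Posz (size t)) ->
  does matrix_prog matrix_cost s
    (upd s out (t ++ bits (matrix_bits_of s), Posz (size (t ++ bits (matrix_bits_of s))))).
Proof.
move=> el ec eo.
have [co cl crl] : [/\ cnt <> out, cnt <> lead & cnt \notin rl].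
  by move: cnt_out; rewrite !inE !negb_or => /and3P[/eqP ? /eqP ? ?].
have [ol orl] : out <> lead /\ out \notin rl.
  by move: out_rl; rewrite inE negb_or => /andP[/eqP].
have ldl : lead \notin dl.
  by apply/negP => /dl_rl; move: uniq_rl => /= /andP[/negPf ->].
have cdl : cnt \notin dl by apply: contra crl; exact: dl_rl.
have odl : out \notin dl by apply: contra orl; exact: dl_rl.
pose outs j := t ++ bits (flatten [seq row_bits (shift_heads dl (- l%:Z)%R s) ks | l <- iota 0 j]).
pose S j := upd (upd (shift_heads dl (- j%:Z)%R s) cnt ((s cnt).1, Posz j)) out
   (outs j, Posz (size (outs j))).
have Sc j : S j cnt = (nseq N (Some true : symbol), Posz j).
  by rewrite /S upd_ne // upd_eq ec /= map_nseq.
have So j : S j out = (outs j, Posz (size (outs j))) by rewrite /S upd_eq.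
have Sl j : S j lead = unary N.
  by rewrite /S !upd_ne //; try congruence; rewrite /shift_heads (negPf ldl).
have H1 : does (While cnt isSome (Seq (seqs [seq inner k | k <- ks])
                             (Seq (moves mach dl Left) (Act cnt id Right))))
    (N * (size ks * (inner_cost + 1) + 2 * size dl + 6)).+1 (S 0) (S N).
  have -> : size ks * (inner_cost + 1) + 2 * size dl + 6 =
    (size ks * (inner_cost + 1) + 2 * size dl + 5).+1 by lia.
  apply: does_while => [j jN|]; rewrite Sc /scan /= nth_nseq ?ltnn // jN; split=> //.
  have rE : row_bits (S j) ks = row_bits (shift_heads dl (- j%:Z)%R s) ks.
    congr flatten; apply: eq_map => k'; apply: inner_bits_ext => i irl.
    rewrite /S !upd_ne //; first by move=> e; rewrite -e irl in crl.
    by move=> e; rewrite -e irl in orl.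
  have Ha := does_row ks (Sl j) (So j); rewrite rE in Ha.
  apply: does_conv (does_seq Ha (does_seq (does_moves mach Left _ uniq_dl)
    (does_move cnt Right _))) _ _; last by lia.
  move=> i; rewrite /S /upd /shift_heads; case: (eqVneq i cnt) => [->|ic].
    by rewrite (negPf cdl); move/eqP/negPf: co => ->; rewrite ?eqxx /=; congr (_, _); lia.
  case: (eqVneq i out) => [->|io].
    rewrite (negPf odl) /outs -[in RHS]addn1 iotaD map_cat flatten_cat /= cats0.
    by rewrite /bits map_cat catA.
  by case: (i \in dl) => //=; congr (_, _); lia.
have SN : S N cnt = ([seq Some b | b <- nseq N true], Posz (size (nseq N true))).
  by rewrite Sc map_nseq size_nseq.
have H2 := does_rewind1 mach SN.
set s2 := upd (S N) _ _ in H2.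
pose T j := shift_heads (lead :: dl) j%:Z s2.
have uld : uniq (lead :: dl) by rewrite /= ldl.
have s2l : s2 lead = unary N by rewrite /s2 upd_ne //; congruence.
have Tl j : T j lead = (nseq N (Some true : symbol), Posz j).
  by rewrite /T /shift_heads mem_head s2l /= map_nseq add0r.
have H3 : does (While lead isSome (moves mach (lead :: dl) Right))
    (N * (2 * size dl + 4)).+1 (T 0) (T N).
  have -> : 2 * size dl + 4 = (2 * size dl + 3).+1 by lia.
  apply: does_while => [j jN|]; rewrite Tl /scan /= nth_nseq ?ltnn // jN; split=> //.
  apply: does_conv (does_moves mach Right _ uld) _ _; last by rewrite /=; lia.
  by move=> i; rewrite /T shift_heads_comp; congr (shift_heads _ _ _ _); rewrite /=; lia.
have TN : T N lead = ([seq Some b | b <- nseq N true], Posz (size (nseq N true))).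
  by rewrite Tl map_nseq size_nseq.
have H4 := does_rewind1 mach TN.
have S0 i : S 0 i = s i.
  rewrite /S /outs /= cats0 /upd /shift_heads; case: eqP => [->//|_].
  case: eqP => [->|_]; first by rewrite ec.
  by case: ifP => // _; rewrite oppr0 addr0; case: (s i).
have T0 i : T 0 i = s2 i.
  by rewrite /T /shift_heads; case: ifP => // _; rewrite addr0; case: (s2 i).
apply: does_conv (does_seq (does_ext_l H1 S0) (does_seq H2 (does_seq (does_ext_l H3 T0) H4))) _ _.
  move=> i; rewrite {1}/upd; case: (eqVneq i lead) => [->|il].
    by rewrite upd_ne ?el //; congruence.
  rewrite /T /shift_heads inE (negPf il) /= /s2 /S /upd.
  case: (eqVneq i cnt) => [->|ic].
    by rewrite (negPf cdl); move/eqP/negPf: co => ->; rewrite ec.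
  case: (eqVneq i out) => [->|io]; first by rewrite (negPf odl).
  by rewrite /shift_heads; case: (i \in dl) => //=; rewrite subrK; case: (s i).
by rewrite !size_nseq /matrix_cost; nia.
Qed.

End Matrix.
End Writing.

(** Automation for stores: solve tape disequalities, look up updated tapes, and split on comparisons
    of indices. *)
Ltac distinct := solve [assumption | apply: nesym; assumption].

Ltac look := repeat first [rewrite upd_eq | rewrite upd_ne; [|distinct]].

Ltac decide_eqs :=
  repeat match goal with
  | |- context [@eq_op ?T ?a ?b] =>
      first [ rewrite (@eqxx T a)
            | rewrite (_ : (@eq_op T a b) = false); [|apply/eqP; distinct]
            | case: (@eqP T a b) => ?; [subst a|] ]
  end.

(** * Reading the witness from an encoded assignment *)

Section Parsing.
Variable mach : nat -> tm.
Notation cmd := (cmd mach).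
Implicit Types (s : store).

Definition reads_at (c : seq symbol) (z : int) (y : seq bool) : Prop :=
  forall k, k < size y -> cell c (z + k%:Z)%R = Some (nth false y k).

Lemma reads_at_cat c z y1 y2 : reads_at c z (y1 ++ y2) ->
  reads_at c z y1 /\ reads_at c (z + (size y1)%:Z)%R y2.
Proof.
move=> h; split=> k ky.
  by rewrite h ?size_cat ?(leq_trans ky) ?leq_addr // nth_cat ky.
have := h (size y1 + k); rewrite size_cat ltn_add2l ky => /(_ isT).
rewrite nth_cat (_ : (size y1 + k < size y1) = false); last by lia.
by rewrite addKn => <-; congr cell; lia.
Qed.

Definition is_one (a : symbol) : bool := a == Some true.

Definition skip (e : nat) : cmd := Seq (While e is_one (Act e id Right)) (Act e id Right).

Lemma size_enc_unary n : size (enc_unary n) = n.+1.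
Proof. by rewrite size_cat size_nseq addn1. Qed.

Lemma nth_enc_unary n k : nth false (enc_unary n) k = (k < n).
Proof.
rewrite nth_cat size_nseq nth_nseq; case: ltnP => // h.
by case: (k - n) => [|[]].
Qed.

Lemma does_skip e s c z n : s e = (c, z) -> reads_at c z (enc_unary n) ->
  does (skip e) (2 * n + 4) s (upd s e (c, z + n.+1%:Z)%R).
Proof.
move=> se re; pose S k := upd s e (c, z + k%:Z)%R.
have sc k : k <= n -> scan (S k e) = Some (k < n).
  by move=> kn; rewrite /S upd_eq /scan /= re ?size_enc_unary ?nth_enc_unary.
have H : does (While e is_one (Act e id Right : cmd)) (n * 2).+1 (S 0) (S n).
  apply: does_while => [k kn|]; rewrite sc ?ltnn ?kn // 1?ltnW //; split=> //.
  apply: does_conv (does_move e Right _) _ _ => // i.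
  by rewrite /S /upd eqxx; case: eqP => //= _; congr (_, _); lia.
have S0 i : S 0 i = s i by rewrite /S /upd addr0; case: eqP => [->|].
apply: does_conv (does_seq (does_ext_l H S0) (does_move e Right _)) _ _; last by lia.
by move=> i; rewrite /S /upd eqxx; case: eqP => //= _; congr (_, _); lia.
Qed.

Lemma does_skips e s c z ns : s e = (c, z) ->
  reads_at c z (flatten [seq enc_unary n | n <- ns]) ->
  does (seqs (nseq (size ns) (skip e)))
    (5 * size (flatten [seq enc_unary n | n <- ns]) + 1) s
    (upd s e (c, z + (size (flatten [seq enc_unary n | n <- ns]))%:Z)%R).
Proof.
elim: ns s z => [|n ns IH] s z se /=.
  by move=> _; apply: does_ext (does_nop _) _ => i; rewrite /upd addr0; case: eqP => [->|].
move=> /reads_at_cat[r1 r2]; have H1 := does_skip se r1.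
rewrite size_enc_unary in r2.
apply: does_conv (does_seq H1 (IH _ _ (upd_eq _ _ _) r2)) _ _.
  move=> i; rewrite /upd; case: eqP => // _; congr (_, _).
  by rewrite size_cat size_enc_unary; lia.
by rewrite size_cat size_enc_unary; lia.
Qed.

                                                                              
(** One bit held in a head position: the tape is never rewritten, and a blank under the head means
    odd. *)
Definition parity_tape (b : bool) : atape := ([:: Some true], Posz b).

Lemma scan_parity b : scan (parity_tape b) = if b then None else Some true.
Proof. by case: b. Qed.

Definition toggle (r : nat) : cmd :=
  Switch r (fun a => if a is Some _ then Act r id Right else Act r id Left).

Lemma does_toggle r s b : s r = parity_tape b ->
  does (toggle r) 2 s (upd s r (parity_tape (~~ b))).
Proof.
move=> e; apply: does_switch; rewrite e scan_parity.
by case: b e => e; [have H := @does_move mach r Left s|have H := @does_move mach r Right s];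
  apply: does_ext H _ => i; rewrite /upd; case: eqP => // _; rewrite e.
Qed.

Definition reset (r : nat) : cmd :=
  Switch r (fun a => if a is Some _ then Nop else Act r id Left).

Lemma does_reset r s b : s r = parity_tape b ->
  does (reset r) 2 s (upd s r (parity_tape false)).
Proof.
move=> e; apply: does_switch; rewrite e scan_parity; case: b e => e.
  by apply: does_ext (does_move r Left s) _ => i; rewrite /upd; case: eqP => // _; rewrite e.
by apply: does_ext (does_nop s) _ => i; rewrite /upd; case: eqP => // ->.
Qed.

Definition parity (e r : nat) : cmd :=
  Seq (While e is_one (Seq (Act e id Right) (toggle r))) (Act e id Right).

Lemma does_parity e r s c z n : e <> r -> s e = (c, z) -> s r = parity_tape false ->
  reads_at c z (enc_unary n) ->
  does (parity e r) (5 * n + 4) s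
    (upd (upd s r (parity_tape (odd n))) e (c, z + n.+1%:Z)%R).
Proof.
move=> er se sr re; pose S k := upd (upd s r (parity_tape (odd k))) e (c, z + k%:Z)%R.
have sc k : k <= n -> scan (S k e) = Some (k < n).
  by move=> kn; rewrite /S upd_eq /scan /= re ?size_enc_unary ?nth_enc_unary.
have H : does (While e is_one (Seq (Act e id Right) (toggle r))) (n * 5).+1 (S 0) (S n).
  apply: does_while => [k kn|]; rewrite sc ?ltnn ?kn // 1?ltnW //; split=> //.
  have H1 := @does_move mach e Right (S k).
  set s1 := upd _ _ _ in H1.
  have e1 : s1 r = parity_tape (odd k).
    by rewrite /s1 upd_ne; [rewrite /S upd_ne ?upd_eq //|]; congruence.
  apply: does_conv (does_seq H1 (does_toggle e1)) _ _ => // i.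
  by rewrite /s1 /S /upd eqxx /=; decide_eqs => //; congr (_, _); clear; lia.
have S0 i : S 0 i = s i.
  by rewrite /S /upd addr0; case: eqP => [->//|_]; case: eqP => [->|].
apply: does_conv (does_seq (does_ext_l H S0) (does_move e Right _)) _ _; last by lia.
by move=> i; rewrite /S /upd eqxx; case: eqP => //= _; congr (_, _); lia.
Qed.

Variables (e re rb out lead A1 A2 : nat).
Hypothesis tapes_uniq : uniq [:: e; re; rb; out; lead; A1; A2].
Variable m : nat.
Hypothesis m_ge4 : 4 <= m.

Definition wit_syms (a b : symbol) : bool := (a == Some false) && (b == Some true).

Definition emit_wit : cmd :=
  switches [:: re; rb; A1; A2] (fun r =>
    if [&& nth None r 0 == None & wit_syms (nth None r 2) (nth None r 3)]
    then emits mach out [:: Some (nth None r 1 == None)] else Nop).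

(** Each location contributes [m] unary numbers. Those at positions 0 and 2 belong to the workers of
    [var_on] and [var_bit], and only their parities are kept. *)
Definition parse_loc : cmd :=
  seqs [:: parity e re; skip e; parity e rb; skip e; seqs (nseq (m - 4) (skip e));
           emit_wit; reset re; reset rb; moves mach [:: lead; A1; A2] Right].

Definition loc_text (v : nat -> nat) : seq bool :=
  flatten [seq enc_unary (v k) | k <- iota 0 m].

Definition loc_wit (a b : symbol) (v : nat -> nat) : seq bool :=
  if wit_syms a b && odd (v 0) then [:: odd (v 2)] else [::].

Lemma does_parse_loc s c z t v : s e = (c, z) -> reads_at c z (loc_text v) ->
  s re = parity_tape false -> s rb = parity_tape false -> s out = (t, Posz (size t)) ->
  let w := bits (loc_wit (scan (s A1)) (scan (s A2)) v) in
  does parse_loc (5 * size (loc_text v) + 50) s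
    (shift_heads [:: lead; A1; A2] 1%R
       (upd (upd s e (c, z + (size (loc_text v))%:Z)%R) out (t ++ w, Posz (size (t ++ w))))).
Proof.
move=> se rz sre srb so w; move: tapes_uniq; rewrite /= !inE !negb_or andbT.
move=> /and5P[u1 u2 u3 u4 /andP[u5 u6]].
have {}u1 : [/\ e <> re, e <> rb, e <> out, e <> lead & e <> A1 /\ e <> A2].
  by split; move: u1; clear; lia.
have {}u2 : [/\ re <> rb, re <> out, re <> lead, re <> A1 & re <> A2]
  by split; move: u2; clear; lia.
have {}u3 : [/\ rb <> out, rb <> lead, rb <> A1 & rb <> A2]
  by split; move: u3; clear; lia.
have {}u4 : [/\ out <> lead, out <> A1 & out <> A2]
  by split; move: u4; clear; lia.
have {}u5 : lead <> A1 /\ lead <> A2 by move: u5; clear; lia.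
have {}u6 : A1 <> A2 by move: u6; clear; lia.
case: u1 => n1 n2 n3 n4 [n5 n6]; case: u2 => n7 n8 n9 n10 n11.
case: u3 => n12 n13 n14 n15; case: u4 => n16 n17 n18; case: u5 => n19 n20.
have tE : loc_text v = enc_unary (v 0) ++ enc_unary (v 1) ++ enc_unary (v 2) ++
    enc_unary (v 3) ++ flatten [seq enc_unary n | n <- [seq v k | k <- iota 4 (m - 4)]].
  by rewrite /loc_text -{1}(subnKC m_ge4) iotaD map_cat flatten_cat /= cats0 -map_comp -!catA.
move: rz; rewrite tE => /reads_at_cat[r0 /reads_at_cat[r1 /reads_at_cat[r2 /reads_at_cat[r3 r4]]]].
rewrite !size_enc_unary in r1 r2 r3 r4.
have H0 := does_parity n1 se sre r0; set s0 := upd _ e _ in H0.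
have e0 : s0 e = (c, z + (v 0).+1%:Z)%R by rewrite /s0 upd_eq.
have H1 := does_skip e0 r1; set s1 := upd s0 _ _ in H1.
have e1 : s1 e = (c, z + (v 0).+1%:Z + (v 1).+1%:Z)%R by rewrite /s1 upd_eq.
have b1 : s1 rb = parity_tape false by rewrite /s1 /s0; look.
have H2 := does_parity n2 e1 b1 r2; set s2 := upd _ e _ in H2.
have e2 : s2 e = (c, z + (v 0).+1%:Z + (v 1).+1%:Z + (v 2).+1%:Z)%R by rewrite /s2 upd_eq.
have H3 := does_skip e2 r3; set s3 := upd s2 _ _ in H3.
have e3 : s3 e = (c, z + (v 0).+1%:Z + (v 1).+1%:Z + (v 2).+1%:Z + (v 3).+1%:Z)%R.
  by rewrite /s3 upd_eq.
have H4 := does_skips e3 r4; rewrite size_map size_iota in H4.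
set s4 := upd s3 _ _ in H4.
have s4r : s4 re = parity_tape (odd (v 0)).
  by rewrite /s4 /s3 /s2 /s1 /s0; look.
have s4b : s4 rb = parity_tape (odd (v 2)).
  by rewrite /s4 /s3 /s2; look.
have s4o : s4 out = (t, Posz (size t)).
  by rewrite /s4 /s3 /s2 /s1 /s0; look.
have s4a : s4 A1 = s A1 by rewrite /s4 /s3 /s2 /s1 /s0; look.
have s4c : s4 A2 = s A2 by rewrite /s4 /s3 /s2 /s1 /s0; look.
have H5 : does emit_wit 7 s4 (upd s4 out (t ++ w, Posz (size (t ++ w)))).
  apply: (@does_switches mach [:: re; rb; A1; A2] _ 3); rewrite /= s4r s4b s4a s4c !scan_parity.
  have -> : (((if odd (v 0) then None else Some true) == None) &&
      wit_syms (scan (s A1)) (scan (s A2))) = wit_syms (scan (s A1)) (scan (s A2)) && odd (v 0).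
    by case: (odd (v 0)); rewrite ?andbT ?andbF.
  rewrite /w /loc_wit; case: ifP => _; last first.
    apply: does_conv (does_nop _) _ _ => // i; rewrite cats0 /upd.
    by case: eqP => [->|].
  have -> : ((if odd (v 2) then None else Some true) == None) = odd (v 2) by case: (odd (v 2)).
  apply: does_conv (does_emits mach _ s4o) _ _ => // i.
  by rewrite size_cat.
set s5 := upd s4 _ _ in H5.
have s5r : s5 re = parity_tape (odd (v 0)) by rewrite /s5; look.
have H6 := does_reset s5r; set s6 := upd s5 _ _ in H6.
have s6b : s6 rb = parity_tape (odd (v 2)) by rewrite /s6 /s5; look.
have H7 := does_reset s6b; set s7 := upd s6 _ _ in H7.
have un : uniq [:: lead; A1; A2].
  exact: (subseq_uniq (suffix_subseq [:: e; re; rb; out] [:: lead; A1; A2]) tapes_uniq).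
have H8 := does_moves mach Right s7 un.
have H9 := does_seq H0 (does_seq H1 (does_seq H2 (does_seq H3 (does_seq H4 (does_seq H5
  (does_seq H6 (does_seq H7 (does_seq H8 (does_nop _))))))))).
apply: does_conv H9 _ _; last first.
  by do 4 rewrite size_cat size_enc_unary; rewrite /=; clear; lia.
move=> i; rewrite /shift_heads.
have -> : s7 i = upd (upd s e (c, z + (size (loc_text v))%:Z)%R) out (t ++ w, Posz (size (t ++ w))) i.
  rewrite /s7 /s6 /s5 /s4 /s3 /s2 /s1 /s0 /upd; decide_eqs => //.
  by congr (_, _); rewrite tE; do 4 rewrite size_cat size_enc_unary PoszD addrA.
by rewrite tE.
Qed.

Variable N : nat.

Definition parse_prog : cmd := While lead isSome parse_loc.

Definition all_text (v : nat -> nat) (n : nat) : seq bool :=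
  flatten [seq loc_text (fun k => v (l * m + k)) | l <- iota 0 n].

Definition all_wit s (v : nat -> nat) (n : nat) : seq bool :=
  flatten [seq loc_wit (cell (s A1).1 ((s A1).2 + l%:Z)%R) (cell (s A2).1 ((s A2).2 + l%:Z)%R)
             (fun k => v (l * m + k)) | l <- iota 0 n].

Lemma does_parse s c z t v : s lead = unary N -> s e = (c, z) ->
  reads_at c z (all_text v N) -> s re = parity_tape false -> s rb = parity_tape false ->
  s out = (t, Posz (size t)) ->
  let w := bits (all_wit s v N) in
  does parse_prog (N * (5 * size (all_text v N) + 51)).+1 s
    (shift_heads [:: lead; A1; A2] N%:Z
       (upd (upd s e (c, z + (size (all_text v N))%:Z)%R) out (t ++ w, Posz (size (t ++ w))))).
Proof.
move=> sl se rz sre srb so w.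
have uE := tapes_uniq; move: (uE); rewrite /= !inE !negb_or andbT.
move=> /and5P[u1 u2 u3 u4 /andP[u5 u6]].
pose ou l := t ++ bits (all_wit s v l).
pose S l := shift_heads [:: lead; A1; A2] l%:Z
   (upd (upd s e (c, z + (size (all_text v l))%:Z)%R) out (ou l, Posz (size (ou l)))).
have S0 i : S 0 i = s i.
  rewrite /S /shift_heads /ou /all_wit /= cats0 /all_text /= addr0 /upd; case: ifP => [il|_].
    rewrite !ifF ?addr0; first by case: (s i).
    - by apply/negP => /eqP ie; move: il; rewrite ie !inE; move: u1; clear; lia.
    - by apply/negP => /eqP ie; move: il; rewrite ie !inE; move: u4; clear; lia.
  by case: eqP => [->//|_]; case: eqP => [->|].
suff H : does parse_prog (N * (5 * size (all_text v N) + 51)).+1 (S 0) (S N).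
  exact: does_ext_l H S0.
have -> : 5 * size (all_text v N) + 51 = (5 * size (all_text v N) + 50).+1 by lia.
have nin i : i \notin [:: lead; A1; A2] -> forall l, S l i =
    upd (upd s e (c, z + (size (all_text v l))%:Z)%R) out (ou l, Posz (size (ou l))) i.
  by move=> il l; rewrite /S /shift_heads (negPf il).
have Se l : S l e = (c, z + (size (all_text v l))%:Z)%R.
  rewrite nin; last by rewrite !inE; move: u1; clear; lia.
  by rewrite upd_ne ?upd_eq //; move: u1; clear; lia.
have So l : S l out = (ou l, Posz (size (ou l))).
  rewrite nin; last by rewrite !inE; move: u4; clear; lia.
  by rewrite upd_eq.
have Sr l : S l re = parity_tape false.
  rewrite nin; last by rewrite !inE; move: u2; clear; lia.
  by rewrite !upd_ne //; move: u1 u2; clear; lia.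
have Sb l : S l rb = parity_tape false.
  rewrite nin; last by rewrite !inE; move: u3; clear; lia.
  by rewrite !upd_ne //; move: u1 u3; clear; lia.
have Sm i l : i \in [:: lead; A1; A2] -> S l i = ((s i).1, (s i).2 + l%:Z)%R.
  move=> il; rewrite /S /shift_heads il !upd_ne //.
    by move=> ie; move: il; rewrite ie !inE; move: u1; clear; lia.
  by move=> ie; move: il; rewrite ie !inE; move: u4; clear; lia.
have Slead l : S l lead = (nseq N (Some true : symbol), Posz l).
  by rewrite Sm ?mem_head // sl /= map_nseq ?add0r.
apply: does_while => [l lN|]; rewrite Slead /scan /= nth_nseq ?ltnn // lN; split=> //.
have atS : all_text v l.+1 = all_text v l ++ loc_text (fun k => v (l * m + k)).
  by rewrite /all_text -addn1 iotaD map_cat flatten_cat /= cats0.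
have awS : all_wit s v l.+1 = all_wit s v l ++
    loc_wit (scan (S l A1)) (scan (S l A2)) (fun k => v (l * m + k)).
  by rewrite /all_wit -addn1 iotaD map_cat flatten_cat /= cats0 !Sm ?inE ?eqxx ?orbT.
have [y2 yE] : exists y2, all_text v N = all_text v l ++ loc_text (fun k => v (l * m + k)) ++ y2.
  exists (flatten [seq loc_text (fun k => v (l * m + k)) | l <- iota l.+1 (N - l.+1)]).
  by rewrite catA -atS /all_text -{1}(subnKC lN) iotaD map_cat flatten_cat.
have rl : reads_at c (z + (size (all_text v l))%:Z)%R (loc_text (fun k => v (l * m + k))).
  by move: rz; rewrite yE => /reads_at_cat[_ /reads_at_cat[]].
have H := does_parse_loc (Se l) rl (Sr l) (Sb l) (So l).
apply: does_conv H _ _; last by rewrite leq_add2r leq_mul2l yE !size_cat addnCA leq_addr orbT.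
move=> i; case: (boolP (i \in [:: lead; A1; A2])) => il.
  rewrite {1}/shift_heads il (Sm _ _ il) !upd_ne ?(Sm _ _ il) /=.
  - by congr (_, _); lia.
  - by move=> ie; move: il; rewrite ie !inE; move: u1; clear; lia.
  - by move=> ie; move: il; rewrite ie !inE; move: u4; clear; lia.
rewrite {1}/shift_heads (negPf il) (nin _ il) /upd; case: eqP => [_|io].
  by rewrite /ou awS /bits map_cat catA.
case: eqP => [_|ie]; first by congr (_, _); rewrite atS size_cat; lia.
rewrite (nin _ il) /upd; by move/eqP/negPf: io => ->; move/eqP/negPf: ie => ->.
Qed.

End Parsing.

                          

(** * Polynomial bounds, and programs running within them *)

Section PolyBound.
Variable X : Type.
Variable len : X -> nat.
Implicit Types f g : X -> nat.

Definition poly_bounded f : Prop := exists c d, forall x, f x <= c * len x ^ d + c.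

Lemma pb_le f g : poly_bounded g -> (forall x, f x <= g x) -> poly_bounded f.
Proof. by move=> [c [d h]] fg; exists c, d => x; exact: leq_trans (fg x) (h x). Qed.

Lemma pb_const c : poly_bounded (fun=> c).
Proof. by exists c, 0 => x; rewrite leq_addl. Qed.

Lemma pb_len : poly_bounded len.
Proof. by exists 1, 1 => x; rewrite expn1 mul1n leq_addr. Qed.

(** The summand 1 covers base 0, where the power with exponent 0 is the larger one. *)
Lemma expn_le_add n d e : n ^ d <= n ^ (d + e) + 1.
Proof.
case: n => [|n]; first by case: d => [|d]; rewrite ?expn0 ?leq_addl // exp0n.
by rewrite (leq_trans _ (leq_addr _ _)) // leq_pexp2l // leq_addr.
Qed.

Lemma pb_add f g : poly_bounded f -> poly_bounded g -> poly_bounded (fun x => f x + g x).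
Proof.
move=> [c1 [d1 h1]] [c2 [d2 h2]]; exists (2 * (c1 + c2)), (d1 + d2) => x.
apply: leq_trans (leq_add (h1 x) (h2 x)) _.
have := expn_le_add (len x) d1 d2; have := expn_le_add (len x) d2 d1.
rewrite [d2 + d1]addnC; nia.
Qed.

Lemma pb_mul f g : poly_bounded f -> poly_bounded g -> poly_bounded (fun x => f x * g x).
Proof.
move=> [c1 [d1 h1]] [c2 [d2 h2]]; exists (3 * (c1 * c2)), (d1 + d2) => x.
apply: leq_trans (leq_mul (h1 x) (h2 x)) _.
have := expn_le_add (len x) d1 d2; have := expn_le_add (len x) d2 d1.
rewrite [d2 + d1]addnC expnD; set a := _ ^ d1; set b := _ ^ d2; set c := c1 * c2 => e1 e2.
have -> : (c1 * a + c1) * (c2 * b + c2) = c * (a * b) + c * a + c * b + c by rewrite /c; lia.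
have : c * a <= c * (a * b + 1) by rewrite leq_mul2l e2 orbT.
have : c * b <= c * (a * b + 1) by rewrite leq_mul2l e1 orbT.
rewrite !mulnDr !muln1; lia.
Qed.

Lemma pb_exp f k : poly_bounded f -> poly_bounded (fun x => f x ^ k).
Proof.
move=> pf; elim: k => [|k IH]; first exact: pb_const.
by under eq_fun do rewrite expnS; exact: pb_mul.
Qed.

Lemma pb_poly f c d : poly_bounded f -> poly_bounded (fun x => c * f x ^ d + c).
Proof.
by move=> pf; apply: pb_add (pb_const c); apply: pb_mul (pb_const c) (pb_exp d pf).
Qed.

Lemma pb_sumn (I : Type) (l : seq I) (F : I -> X -> nat) :
  (forall i, i < size l -> forall i0, poly_bounded (F (nth i0 l i))) ->
  poly_bounded (fun x => sumn [seq F i x | i <- l]).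
Proof.
elim: l => [|a l IH] h /=; first exact: pb_const.
by apply: pb_add; [exact: (h 0 isT a)|apply: IH => i il i0; exact: (h i.+1 il i0)].
Qed.

End PolyBound.

                                            

Section PolyPrograms.
Variable mach : nat -> tm.
Variable X : Type.
Variable len : X -> nat.
Local Notation pb := (poly_bounded len).
Notation cmd := (cmd mach).

(** A triple uniform in the input: one program, with a time bound polynomial in the length of the
    input. *)
Definition pdoes (c : cmd) (s s' : X -> store) : Prop :=
  exists2 f, pb f & forall x, does c (f x) (s x) (s' x).

Lemma pdoes_seq a b s s1 s2 : pdoes a s s1 -> pdoes b s1 s2 -> pdoes (Seq a b) s s2.
Proof.
move=> [f pf hf] [g pg hg]; exists (fun x => f x + g x + 1).
  by apply: pb_add (pb_const _ _); exact: pb_add.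
by move=> x; rewrite addn1; exact: does_seq (hf x) (hg x).
Qed.

Lemma pdoes_ext c s s1 s2 : pdoes c s s1 -> (forall x i, s1 x i = s2 x i) -> pdoes c s s2.
Proof. by move=> [f pf hf] e; exists f => // x; exact: does_ext (hf x) (e x). Qed.

Lemma pb_cost (us : nat -> X -> seq bool) ps :
  (forall i, i < size ps -> if nth (Lit [::]) ps i is Map a _ then pb (fun x => size (us a x))
     else True) ->
  pb (fun x => cost (us^~ x) ps).
Proof.
move=> h; apply: pb_add (pb_const _ _).
apply: (pb_sumn (F := fun p x => piece_cost (us^~ x) p + 1)) => i il i0.
apply: pb_add (pb_const _ _).
have := h i il; rewrite (set_nth_default i0) //; case: (nth i0 ps i) => [u _|a g ha] /=.
  exact: pb_const.
by apply: pb_mul (pb_const _ _); apply: pb_add (pb_const _ _).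
Qed.

Definition psource (us : nat -> X -> seq bool) o (s : X -> store) (p : piece) : Prop :=
  if p is Map a _ then [/\ a <> o, forall x, s x a = word (us a x)
                         & pb (fun x => size (us a x))] else True.

Lemma pdoes_append us o ps s (t u : X -> seq bool) :
  (forall x, s x o = (bits (t x), Posz (size (t x)))) ->
  (forall i, i < size ps -> psource us o s (nth (Lit [::]) ps i)) ->
  (forall x, written (us^~ x) ps = u x) ->
  pdoes (append mach o ps) s
    (fun x => upd (s x) o (bits (t x ++ u x), Posz (size (t x ++ u x)))).
Proof.
move=> so ok uE; exists (fun x => cost (us^~ x) ps).
  by apply: pb_cost => i /ok; case: (nth _ ps i) => // a g [].
move=> x; have so' : s x o = (bits (t x), Posz (size (bits (t x)))) by rewrite size_bits.
apply: does_ext (does_append mach so' _) _.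
  by move=> i /ok; case: (nth _ ps i) => // a g [].
move=> i; rewrite /upd; case: eqP => // _; rewrite uE /bits map_cat size_cat.
by rewrite size_map.
Qed.

Lemma pdoes_fill us o ps s (u : X -> seq bool) :
  (forall x, s x o = ([::], 0%R)) ->
  (forall i, i < size ps -> psource us o s (nth (Lit [::]) ps i)) ->
  (forall x, written (us^~ x) ps = u x) -> pb (fun x => size (u x)) ->
  pdoes (fill mach o ps) s (fun x => upd (s x) o (word (u x))).
Proof.
move=> so ok uE pu; exists (fun x => cost (us^~ x) ps + 5 * (size (u x) + 2) + 1).
  apply: pb_add (pb_const _ _); apply: pb_add.
    by apply: pb_cost => i /ok; case: (nth _ ps i) => // a g [].
  by apply: pb_mul (pb_const _ _) _; apply: pb_add (pb_const _ _).
move=> x; rewrite -uE; apply: does_fill (so x) _.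
by move=> i /ok; case: (nth _ ps i) => // a g [].
Qed.

Lemma pdoes_rewind o s (u : X -> seq bool) :
  (forall x, s x o = (bits (u x), Posz (size (u x)))) -> pb (fun x => size (u x)) ->
  pdoes (rewind mach o [:: o]) s (fun x => upd (s x) o (word (u x))).
Proof.
move=> so pu; exists (fun x => 5 * (size (u x) + 2)).
  by apply: pb_mul (pb_const _ _) _; apply: pb_add (pb_const _ _).
by move=> x; exact: does_rewind1.
Qed.

Lemma pdoes_pow base b d s (y : X -> seq bool) : b < base ->
  (forall x, s x b = word (y x)) -> (forall x j, j <= d -> s x (base + j) = ([::], 0%R)) ->
  pb (fun x => size (y x)) ->
  pdoes (pow_prog mach base b d) s (fun x => pow_store base (size (y x)) d (s x)).
Proof.
move=> bb sb s0 py; exists (fun x => 80 * d.+1 * (size (y x) + 2) ^ d.+1).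
  by apply: pb_mul (pb_const _ _) _; apply: pb_exp; apply: pb_add (pb_const _ _).
by move=> x; exact: (does_pow mach bb (sb x) (s0 x)).
Qed.

Lemma pdoes_move i m s :
  pdoes (Act i id m) s (fun x => upd (s x) i ((s x i).1, ((s x i).2 + delta m)%R)).
Proof. by exists (fun=> 1); [exact: pb_const|move=> x; exact: does_move]. Qed.

Lemma pdoes_each a o (g : bool -> seq bool) s (y t : X -> seq bool) : a <> o ->
  (forall x, shows (s x a) (y x)) -> (forall x, s x o = (bits (t x), Posz (size (t x)))) ->
  pb (fun x => size (y x)) ->
  pdoes (each mach a o (fun c => if c is Some b then bits (g b) else [::])) s
    (fun x => upd (upd (s x) a ((s x a).1, (s x a).2 + (size (y x))%:Z)%R) o
       (bits (t x ++ flatten [seq g b | b <- y x]),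
        Posz (size (t x ++ flatten [seq g b | b <- y x])))).
Proof.
move=> ao sa so py.
exists (fun x => size (y x) * (2 * (size (g true) + size (g false)) + 6) + 1).
  by apply: pb_add (pb_const _ _); apply: pb_mul (pb_const _ _).
move=> x; have so' : s x o = (bits (t x), Posz (size (bits (t x)))) by rewrite size_bits.
have gG b : size (bits (g b)) <= size (g true) + size (g false).
  by rewrite size_bits; case: b; rewrite ?leq_addr ?leq_addl.
have H := @does_each mach a o (fun c => if c is Some b then bits (g b) else [::])
  (size (g true) + size (g false)) (s x) (y x) (bits (t x)) ao (sa x) so' gG.
apply: does_conv H _ _; last by rewrite addn1.
by move=> i; rewrite /upd; case: eqP => // _; rewrite images_bits /bits map_cat !size_cat !size_map.
Qed.

Lemma pdoes_run jm off s (inp outp : X -> seq bool) (tm : X -> nat) :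
  (forall x, input_at (s x) off (tm_extra (mach jm)) (inp x)) ->
  (forall x, computes_within (mach jm) (tm x) (inp x) (outp x)) -> pb tm ->
  exists s', [/\ pdoes (@Run mach jm (tm_start (mach jm)) off) s s',
    forall x, shows (s' x off) (outp x) &
    forall x i, ~ (off <= i <= off + tm_extra (mach jm)) -> s' x i = s x i].
Proof.
move=> hi hc ptm; have /choice[s' hs'] := fun x => does_run (hi x) (hc x).
exists s'; split=> [|x|x]; last 2 first.
- by case: (hs' x).
- by case: (hs' x).
exists (fun x => tm x + 1); first by apply: pb_add (pb_const _ _).
by move=> x; rewrite addn1; case: (hs' x).
Qed.

End PolyPrograms.

(** A step lengthens the stored half-tape by at most two cells. This keeps the outputs of the
    approximation algorithm and of the evaluator polynomially long. *)
Lemma size_tm_output (M : tm) n x y :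
  computes_within M n x y -> size y <= size x + 2 * n.
Proof.
move=> [_ <-]; rewrite /tm_output.
set c := iter n _ _.
have le : size (c.2 ord0).2 <= size x + 2 * n.
  rewrite /c; elim: n {c} => [|n IH]; first by rewrite /= ffunE eqxx size_map muln0 addn0.
  rewrite iterS; set c := iter n _ _ in IH *; rewrite /tm_step.
  case: ifP => _; first by apply: leq_trans IH _; lia.
  rewrite /= ffunE /move_tape /write_tape.
  case: (c.2 ord0) IH => l r /= IH.
  by case: ((_.2 ord0).2) => /=; rewrite size_behead; lia.
apply: leq_trans le; elim: (c.2 ord0).2 => [|[b|] s IH] //=.
Qed.

Lemma poly_time_prog (T : Type) (encT : T -> seq bool) (mach : nat -> tm) (c : cmd mach)
    (s' : T -> store) (U : Type) (encU : U -> seq bool) (f : T -> U) :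
  pdoes (fun x => size (encT x)) c (fun x => init_store (encT x)) s' ->
  (forall x, shows (s' x 0) (encU (f x))) -> poly_time encT encU f.
Proof.
move=> [g [a [d hg]] hc] hs; exists (prog_tm c), a, d => x.
by apply: does_computes (hs x); exact: does_le (hc x) (hg x).
Qed.

Section Finish.
Variable mach : nat -> tm.
Variable X : Type.
Variable len : X -> nat.
Local Notation pb := (poly_bounded len).

(** The output extends from the head of tape 0 to the first blank, so the answer is written just
    after the input and the head is put back on it. *)
Definition finish (v : nat) : cmd mach :=
  Seq (While 0 isSome (Act 0 id Right))
      (Switch v (fun a => Seq (emits mach 0 [:: a]) (Act 0 id Left))).

Lemma pdoes_finish v s (u : X -> seq bool) (k : X -> nat) (b : X -> bool) : v <> 0 ->
  (forall x, s x 0 = (bits (u x), Posz (k x))) -> (forall x, k x <= size (u x)) ->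
  (forall x, shows (s x v) [:: b x]) -> pb (fun x => size (u x)) ->
  exists2 s', pdoes len (finish v) s s' & forall x, shows (s' x 0) [:: b x].
Proof.
move=> v0 s0 ku sv pu.
exists (fun x => upd (s x) 0 (bits (u x ++ [:: b x]), Posz (size (u x)))); last first.
  move=> x; rewrite upd_eq; split=> [[|] //= _|].
    by rewrite /= addn0 /bits map_cat nth_cat size_map ltnn subnn.
  by rewrite /= nth_default // size_bits size_cat /= addn1.
exists (fun x => size (u x) * 2 + 10); first by apply: pb_add (pb_const _ _); apply: pb_mul (pb_const _ _).
move=> x; pose S j := upd (s x) 0 (bits (u x), Posz (k x + j)).
have H : does (While 0 isSome (Act 0 id Right : cmd mach)) ((size (u x) - k x) * 2).+1
    (S 0) (S (size (u x) - k x)).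
  apply: does_while => [j jk|]; rewrite /S upd_eq /scan /=; last first.
    by rewrite subnKC // nth_default ?size_bits.
  split; first by rewrite (nth_map false) //; lia.
  apply: does_conv (does_move 0 Right _) _ _ => // i.
  by rewrite /upd eqxx; case: eqP => //= _; congr (_, _); lia.
have S0 i : S 0 i = s x i by rewrite /S /upd addn0; case: eqP => [->|].
set s1 := S (size (u x) - k x) in H.
have s1v : scan (s1 v) = Some (b x).
  rewrite /s1 /S upd_ne // /scan; have [h _] := sv x.
  by have := h 0 isT; rewrite addr0.
have s10 : s1 0 = (bits (u x), Posz (size (bits (u x)))).
  by rewrite /s1 /S upd_eq subnKC // size_bits.
have H2 := does_seq (does_emits mach [:: Some (b x)] s10) (does_move 0 Left _).
have H3 := @does_switch mach v (fun a => Seq (emits mach 0 [:: a]) (Act 0 id Left)) _ s1.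
rewrite s1v in H3.
apply: does_conv (does_seq (does_ext_l H S0) (H3 _ _ H2)) _ _; last by rewrite /=; lia.
move=> i; rewrite /s1 /S /upd eqxx /=; case: eqP => // _.
by rewrite /bits map_cat size_map; congr (_, _); lia.
Qed.

End Finish.

                             

(** * P is contained in NP *)

Section FirstComponent.
Variable M : tm.
Let mach : nat -> tm := fun=> M.

(** The code of a word alternates flags and letters: the loop copies the letters to tape 1 and stops
    on the flag [false]. *)
Definition take_first : cmd mach :=
  While 0 is_one (Seq (Act 0 id Right)
    (Seq (Switch 0 (fun a => emits mach 1 [:: a])) (Act 0 id Right))).

Lemma nth_enc_word x (w : seq bool) k : k < size x ->
  nth false (enc_word x ++ w) (k * 2) = true /\
  nth false (enc_word x ++ w) (k * 2).+1 = nth false x k.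
Proof.
elim: x k => // b x IH [|k] //= kx.
exact: IH.
Qed.

Lemma size_enc_word x : size (enc_word x) = size x * 2 + 1.
Proof. by elim: x => //= b x IH; rewrite /enc_word /= in IH *; rewrite IH; lia. Qed.

Lemma nth_enc_word_end x (w : seq bool) : nth false (enc_word x ++ w) (size x * 2) = false.
Proof. by elim: x => //= b x IH; rewrite mulSn. Qed.

Lemma does_take_first x w s : s 0 = word (enc_word x ++ w) -> s 1 = ([::], 0%R) ->
  does take_first (size x * 9).+1 s
    (upd (upd s 0 (bits (enc_word x ++ w), Posz (size x * 2))) 1 (bits x, Posz (size x))).
Proof.
move=> s0 s1.
pose S k := upd (upd s 0 (bits (enc_word x ++ w), Posz (k * 2))) 1 (bits (take k x), Posz k).
have S0 i : S 0 i = s i by rewrite /S take0 /upd; case: eqP => [->|_]; [|case: eqP => [->|]].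
suff H : does take_first (size x * 9).+1 (S 0) (S (size x)).
  by move: H; rewrite {2}/S take_size => H; exact: does_ext_l H S0.
have sz k : k <= size x -> k * 2 < size (enc_word x ++ w).
  by move=> kx; rewrite size_cat size_enc_word; lia.
apply: does_while => [k kx|]; rewrite {1}/S upd_ne // upd_eq /scan /=; last first.
  by rewrite (nth_map false) ?sz // nth_enc_word_end.
have [e1 e2] := nth_enc_word w kx.
rewrite (nth_map false) ?sz 1?ltnW // e1; split=> //.
have H1 := @does_move mach 0 Right (S k); set s2 := upd _ _ _ in H1.
have s20 : s2 0 = (bits (enc_word x ++ w), Posz (k * 2 + 1)) by rewrite /s2 upd_eq.
have s21 : s2 1 = (bits (take k x), Posz (size (bits (take k x)))).
  by rewrite /s2 /S upd_ne // upd_eq size_bits size_takel // ltnW.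
have H2 := @does_switch mach 0 (fun a => emits mach 1 [:: a]) _ s2.
have sc : scan (s2 0) = Some (nth false x k).
  rewrite s20 /scan /= addn1 (nth_map false) ?e2 //.
  by rewrite size_cat size_enc_word; lia.
rewrite sc in H2.
have H3 := does_seq H1 (does_seq (H2 _ _ (does_emits mach _ s21)) (does_move 0 Right _)).
apply: does_conv H3 _ _ => // i.
rewrite /s2 /S /upd /=; case: eqP => [->//=|i0]; first by congr (_, _); lia.
case: eqP => // _; rewrite (take_nth false) // /bits map_rcons -cats1 size_map size_takel ?addn1 //.
exact: ltnW.
Qed.

End FirstComponent.

(** The verifier decodes its first component and decides it; the empty word serves as witness, so
    the length bound can be 0. *)
Lemma classP_sub_classNP (L : language) : classP L -> classNP L.
Proof.
move=> [f [[M [c [d hM]]] hL]].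
exists (fun xw => f xw.1), 0, 0; split; last first.
  move=> x; rewrite hL; split=> [fx|[w [_ //]]].
  by exists [::].
pose len (xw : seq bool * seq bool) := size (enc_pair xw).
have px : poly_bounded len (fun xw => size xw.1).
  apply: pb_le (pb_len _) _ => -[x w]; rewrite /len /enc_pair size_cat size_enc_word /=; lia.
pose mach : nat -> tm := fun=> M.
pose s0 (xw : seq bool * seq bool) := init_store (enc_pair xw).
pose s1 (xw : seq bool * seq bool) := upd (upd (s0 xw) 0
  (bits (enc_word xw.1 ++ xw.2), Posz (size xw.1 * 2))) 1 (bits xw.1, Posz (size xw.1)).
have H1 : pdoes len (take_first M) s0 s1.
  exists (fun xw => size xw.1 * 9 + 1).
    by apply: pb_add (pb_const _ _); apply: pb_mul (pb_const _ _).
  by move=> [x w]; rewrite addn1; apply: does_take_first.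
have H2 := @pdoes_rewind mach _ len 1 s1 (fun xw => xw.1) (fun=> erefl) px.
set s2 := fun x => upd (s1 x) _ _ in H2.
have [|||s3 [H3 o3 f3]] := @pdoes_run mach _ len 0 1 s2 (fun xw => xw.1)
    (fun xw => [:: f xw.1]) (fun xw => c * size xw.1 ^ d + c).
- move=> xw; split; first by rewrite /s2 upd_eq.
  by move=> [|j] //= _; rewrite /s2 /s1 /s0 /init_store !upd_ne.
- by move=> xw; exact: hM.
- exact: pb_poly.
have [||||s4 H4 o4] := @pdoes_finish mach _ len 1 s3 (fun xw => enc_word xw.1 ++ xw.2)
  (fun xw => size xw.1 * 2) (fun xw => f xw.1) _ _ _ o3 _.
- by [].
- by move=> xw; rewrite f3 ?ltnn // /s2 /s1 upd_ne // upd_ne // upd_eq.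
- by move=> xw; rewrite size_cat size_enc_word; lia.
- exact: pb_len.
exact: poly_time_prog (pdoes_seq H1 (pdoes_seq H2 (pdoes_seq H3 H4))) o4.
Qed.

                                       

(** * Preparing the tapes from which the matrices are written *)

Section Tags.
Variables (P W : nat) (x : seq bool).
Hypothesis P_gt0 : 0 < P.
Hypothesis P_large : size (enc_word x) + W < P.

                                                                                
                                                                    
(** The class of a location is coded by a pair of symbols, one on each of two tapes; blanks mean
    [Blank] or [Later], which are told apart by a tape of length [P]. *)
Definition class_word1 : seq bool := false :: nseq (size (enc_word x)) true ++ nseq W false.
Definition class_word2 : seq bool := false :: enc_word x ++ nseq W true.

Definition mark : seq bool := nseq P false ++ [:: true].

Definition reads_class (r : seq symbol) : class :=
  if nth None r 0 is None then Later else
  match nth None r 1, nth None r 2 with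
  | Some false, Some false => First
  | Some true, Some b => Bit b
  | Some false, Some true => Wit
  | _, _ => Blank
  end.

Definition reads_near (r : seq symbol) (o : offset) : bool :=
  match o with
  | Off0 => nth None r 3 == Some true
  | Off1 => nth None r 3 == Some false
  | OffL => nth None r 4 == Some true
  | OffP => nth None r 5 == Some true
  | OffR => nth None r 6 == Some true
  end.

Lemma cell_bits u (k : nat) :
  cell (bits u) k = if k < size u then Some (nth false u k) else None.
Proof.
by rewrite /=; case: ltnP => h; [rewrite (nth_map false)|rewrite nth_default // size_bits].
Qed.

Definition class_syms (c : class) : symbol * symbol :=
  match c with
  | First => (Some false, Some false)
  | Bit b => (Some true, Some b)
  | Wit => (Some false, Some true)
  | _ => (None, None)
  end.

Lemma class_cells (l : nat) :
  cell (bits class_word1) l = (class_syms (class_of P W x l)).1 /\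
  cell (bits class_word2) l = (class_syms (class_of P W x l)).2.
Proof.
have sz1 : size class_word1 = (size (enc_word x) + W).+1.
  by rewrite /= size_cat !size_nseq.
have sz2 : size class_word2 = (size (enc_word x) + W).+1.
  by rewrite [LHS]/= size_cat size_nseq.
rewrite !cell_bits sz1 sz2 /class_of.
case: (leqP P l) => Pl.
  by have -> : (l < (size (enc_word x) + W).+1) = false by lia.
case: l Pl => [|p] Pl //; rewrite ltnS.
have e1 : nth false class_word1 p.+1 = (p < size (enc_word x)).
  by rewrite [LHS]/= nth_cat size_nseq !nth_nseq; case: ltnP => // _; case: ifP.
have e2 : nth false class_word2 p.+1 = if p < size (enc_word x) then nth false (enc_word x) p
    else p - size (enc_word x) < W.
  by rewrite [LHS]/= nth_cat nth_nseq; case: ltnP => // _; case: ifP.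
rewrite e1 e2.
case: (ltnP p (size (enc_word x))) => h1; first by rewrite ltn_addr.
case: (ltnP p (size (enc_word x) + W)) => h2 //.
by rewrite (_ : p - size (enc_word x) < W) //; lia.
Qed.

Lemma reads_class_of (l : nat) r :
  reads_class [:: cell (bits (nseq P true)) l, cell (bits class_word1) l,
                  cell (bits class_word2) l & r] = class_of P W x l.
Proof.
have [-> ->] := class_cells l; rewrite (cell_bits (nseq P true)) size_nseq /reads_class /=.
case: (ltnP l P) => h; last by rewrite /class_of h.
case E : (class_of P W x l) => [|b|||] //=.
by move: E; rewrite /class_of leqNgt h /=; case: (l) => // p; case: ifP => //; case: ifP.
Qed.

Lemma wit_syms_class (l : nat) :
  wit_syms (cell (bits class_word1) l) (cell (bits class_word2) l) = is_wit (class_of P W x l).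
Proof. by have [-> ->] := class_cells l; case: class_of. Qed.

Lemma cell_mark z : (cell (bits mark) z == Some true) = (z == Posz P).
Proof.
case: z => k; last by [].
rewrite cell_bits size_cat size_nseq addn1 ltnS nth_cat size_nseq nth_nseq.
case: ltngtP => h //=; last by rewrite h subnn eqxx.
  by apply/esym/eqP => -[]; lia.
by apply/esym/eqP => -[]; lia.
Qed.

(** The only [true] of a mark is at position [P], so the initial head positions 1, 0 and -1 detect
    the distances [P - 1], [P] and [P + 1]; the word [true], [false] detects 0 and 1. *)
Lemma reads_near_dist (l j : nat) a b c o :
  reads_near [:: a; b; c; cell (bits [:: true; false]) (0 - l%:Z + j%:Z)%R;
    cell (bits mark) (1 - l%:Z + j%:Z)%R; cell (bits mark) (0 - l%:Z + j%:Z)%R;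
    cell (bits mark) (-1 - l%:Z + j%:Z)%R] o = (j == l + dist P o).
Proof.
have c0 (z : int) b' : (cell (bits [:: true; false]) z == Some b') = (z == Posz (~~ b')).
  by case: z => [[|[|k]]|k]; case: b'; rewrite /= ?nth_nil.
case: o; rewrite [LHS]/= ?c0 ?cell_mark /=; apply/eqP/eqP; lia.
Qed.

End Tags.

Section Preparation.
Variables (mach : nat -> tm) (cw dw cy D : nat).

Definition wit_bound (x : seq bool) : nat := cw * size x ^ dw + cw.
(** Large enough to cover the input of the verifier; with [cy] and [D] taken from its time bound,
    the power [row_len] also exceeds its running time, see [row_len_time]. *)
Definition base_len (x : seq bool) : nat := 2 * size x + wit_bound x + cy.
Definition row_len (x : seq bool) : nat := base_len x ^ D.
Definition hist_len (x : seq bool) : nat := row_len x * row_len x.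

Local Notation tw := (12 + dw).
Local Notation tP := (13 + dw + D).
Local Notation tN := (13 + dw + 2 * D).
Local Notation pb := (poly_bounded (X := seq bool) (fun x => size x)).

Lemma pb_size : pb (fun x => size x). Proof. exact: pb_len. Qed.

Lemma pb_wit_bound : pb wit_bound. Proof. exact: pb_poly pb_size. Qed.

Lemma pb_base_len : pb base_len.
Proof.
apply: pb_add (pb_const _ _); apply: pb_add pb_wit_bound.
exact: pb_mul (pb_const _ _) pb_size.
Qed.

Lemma pb_row_len : pb row_len. Proof. exact: pb_exp pb_base_len. Qed.

Lemma pb_hist_len : pb hist_len. Proof. exact: pb_mul pb_row_len pb_row_len. Qed.

(** Tapes: 0 the input; 1 and 2 the unary values of [wit_bound] and [base_len]; 3 and 4 the class
    words; 5 to 8 the distance detectors; 9 a counter; 10 and 11 parity bits; from 12 on the powers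
    of the input length, then those of [base_len]. *)
Definition prepare : cmd mach :=
  seqs [:: pow_prog mach 12 0 dw;
    fill mach 1 [:: Map tw (fun=> nseq cw true); Lit (nseq cw true)];
    fill mach 2 [:: Map 0 (fun=> [:: true; true]); Map 1 (fun=> [:: true]); Lit (nseq cy true)];
    pow_prog mach (13 + dw) 2 (2 * D);
    fill mach 3 [:: Lit [:: false]; Map 0 (fun=> [:: true; true]); Lit [:: true];
                    Map 1 (fun=> [:: false])];
    fill mach 4 [:: Lit [:: false]; Map 0 (fun b => [:: true; b]); Lit [:: false];
                    Map 1 (fun=> [:: true])];
    fill mach 5 [:: Lit [:: true; false]];
    fill mach 6 [:: Map tP (fun=> [:: false]); Lit [:: true]];
    fill mach 7 [:: Map tP (fun=> [:: false]); Lit [:: true]];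
    fill mach 8 [:: Map tP (fun=> [:: false]); Lit [:: true]];
    Act 6 id Right;
    Act 8 id Left;
    fill mach 9 [:: Map tN (fun=> [:: true])];
    fill mach 10 [:: Lit [:: true]];
    fill mach 11 [:: Lit [:: true]]].

Record prepared (x : seq bool) (s : store) : Prop := Prepared {
  prep_x : s 0 = word x;
  prep_1 : s 3 = word (class_word1 (wit_bound x) x);
  prep_2 : s 4 = word (class_word2 (wit_bound x) x);
  prep_d : s 5 = word [:: true; false];
  prep_dL : s 6 = (bits (mark (row_len x)), 1%R);
  prep_dP : s 7 = word (mark (row_len x));
  prep_dR : s 8 = (bits (mark (row_len x)), (-1)%R);
  prep_cnt : s 9 = unary (hist_len x);
  prep_re : s 10 = parity_tape false;
  prep_rb : s 11 = parity_tape false;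
  prep_P : s tP = unary (row_len x);
  prep_N : s tN = unary (hist_len x) }.

Lemma prepared_frame x s s' : prepared x s -> (forall i, i <= tN -> s' i = s i) ->
  prepared x s'.
Proof. by case=> h1 h2 h3 h4 h5 h6 h7 h8 h9 h10 h11 h12 e; split; rewrite e //; lia. Qed.

Lemma flatten_map_nseq j (u : seq bool) (c : bool) : flatten [seq nseq j c | _ <- u] = nseq (size u * j) c.
Proof. by elim: u => //= b u ->; rewrite -nseqD. Qed.

Lemma flatten_map_seq1 (u : seq bool) (c : bool) : flatten [seq [:: c] | _ <- u] = nseq (size u) c.
Proof. by elim: u => //= b u ->. Qed.

Lemma pow_store_in base n d s i : base <= i <= base + d ->
  pow_store base n d s i = unary (n ^ (i - base)).
Proof. by rewrite /pow_store => ->. Qed.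

Lemma pow_store_out base n d s i : ~ (base <= i <= base + d) -> pow_store base n d s i = s i.
Proof. by rewrite /pow_store => /negP/negPf ->. Qed.

Ltac find := repeat first [ rewrite upd_eq | rewrite upd_ne; [|lia]
  | rewrite pow_store_out; [|lia] | rewrite pow_store_in; [|lia] ].

Lemma pdoes_nop s : pdoes (X := seq bool) (fun x => size x) (Nop : cmd mach) s s.
Proof. by exists (fun=> 1); [exact: pb_const|move=> x; exact: does_nop]. Qed.

Lemma prepare_does : exists2 s, pdoes (fun x : seq bool => size x) prepare init_store s
  & forall x, prepared x (s x) /\ forall i, tN < i -> s x i = ([::], 0%R).
Proof.
pose len := fun x : seq bool => size x.
have i0 x : init_store x 0 = word x by [].
have ib x i : 0 < i -> init_store x i = ([::], 0%R) by case: i.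
have H1 := @pdoes_pow mach _ len 12 0 dw init_store id isT i0
  (fun x j _ => ib x (12 + j) isT) pb_size.
set s1 := fun x => pow_store _ _ _ _ in H1.
have psz (f : seq bool -> nat) c : pb f -> pb (fun x => size (nseq (f x) c : seq bool)).
  by move=> pf; apply: pb_le pf _ => x; rewrite size_nseq.
pose s2 x := upd (s1 x) 1 (unary (wit_bound x)).
have H2 : pdoes len (fill mach 1 [:: Map tw (fun=> nseq cw true); Lit (nseq cw true)]) s1 s2.
  apply: (@pdoes_fill mach _ len (fun _ x => nseq (size x ^ dw) true)).
  - by move=> x; rewrite /s1; find; rewrite ib.
  - case=> [|[|]] //= _; split; first lia.
      by move=> x; rewrite /s1; find; rewrite addKn.
    exact: psz (pb_exp _ pb_size).
  - by move=> x; rewrite /written /= cats0 flatten_map_nseq -nseqD size_nseq /wit_bound mulnC.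
  - exact: psz pb_wit_bound.
pose us (a : nat) (x : seq bool) := if a is 0 then x else nseq (wit_bound x) true.
have pus a : pb (fun x => size (us a x)).
  by case: a => [|a]; [exact: pb_size|exact: psz pb_wit_bound].
have src a o s g : a <> o -> (forall x, s x a = word (us a x)) ->
    psource len us o s (Map a g) by [].
pose s3 x := upd (s2 x) 2 (unary (base_len x)).
have H3 : pdoes len (fill mach 2 [:: Map 0 (fun=> [:: true; true]); Map 1 (fun=> [:: true]);
    Lit (nseq cy true)]) s2 s3.
  apply: (@pdoes_fill mach _ len us).
  - by move=> x; rewrite /s2 /s1; find; rewrite ib.
  - by case=> [|[|[|]]] // _; apply: src => // x; rewrite /s2 /s1; find; rewrite ?i0.
  - move=> x; rewrite /written /= cats0 (flatten_map_nseq 2) flatten_map_seq1 size_nseq.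
    by rewrite -!nseqD addnA mulnC.
  - exact: psz pb_base_len.
have H4 : pdoes len (pow_prog mach (13 + dw) 2 (2 * D)) s3
    (fun x => pow_store (13 + dw) (base_len x) (2 * D) (s3 x)).
  have := @pdoes_pow mach _ len (13 + dw) 2 (2 * D) s3 (fun x => nseq (base_len x) true).
  move=> H; have {}H := H isT _ _ (psz _ _ pb_base_len); apply: pdoes_ext (H _ _) _.
  - by move=> x; rewrite /s3; find.
  - by move=> x j jD; rewrite /s3 /s2 /s1; find; rewrite ib.
  - by move=> x i; rewrite size_nseq.
set s4 := fun x => pow_store _ _ _ _ in H4.
have s4P x : s4 x tP = unary (row_len x).
  by rewrite /s4; find; rewrite addKn.
have s4N x : s4 x tN = unary (hist_len x).
  by rewrite /s4; find; rewrite addKn /hist_len /row_len -expnD mul2n addnn.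
have s40 x : s4 x 0 = word x by rewrite /s4 /s3 /s2 /s1; find.
have s41 x : s4 x 1 = unary (wit_bound x) by rewrite /s4 /s3 /s2 /s1; find.
have s4b x i : 2 < i < 12 -> s4 x i = ([::], 0%R).
  by move=> hi; rewrite /s4 /s3 /s2 /s1; find; rewrite ib //; lia.
have s4e x i : tN < i -> s4 x i = ([::], 0%R).
  by move=> hi; rewrite /s4 /s3 /s2 /s1; find; rewrite ib //; lia.
clearbody s4.
pose s5 x := upd (s4 x) 3 (word (class_word1 (wit_bound x) x)).
have pcw1 : pb (fun x => size (class_word1 (wit_bound x) x)).
  apply: (@pb_le _ _ _ (fun x => 2 * size x + wit_bound x + 2)).
    apply: pb_add (pb_const _ _); apply: pb_add pb_wit_bound.
    exact: pb_mul (pb_const _ _) pb_size.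
  by move=> x; rewrite /= size_cat !size_nseq size_enc_word; lia.
have pcw2 : pb (fun x => size (class_word2 (wit_bound x) x)).
  apply: pb_le pcw1 _ => x; rewrite [size _]/= size_cat size_nseq.
  by rewrite /= size_cat !size_nseq.
have H5 : pdoes len (fill mach 3 [:: Lit [:: false]; Map 0 (fun=> [:: true; true]); Lit [:: true];
                    Map 1 (fun=> [:: false])]) s4 s5.
  apply: (@pdoes_fill mach _ len us) => //.
  - by move=> x; rewrite s4b.
  - by case=> [|[|[|[|]]]] // _; apply: src => // x; rewrite ?s40 ?s41.
  - move=> x; rewrite /written /= cats0 (flatten_map_nseq 2) flatten_map_seq1 size_nseq.
    by rewrite /class_word1 size_enc_word nseqD -catA.
pose s6 x := upd (s5 x) 4 (word (class_word2 (wit_bound x) x)).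
have H6 : pdoes len (fill mach 4 [:: Lit [:: false]; Map 0 (fun b => [:: true; b]); Lit [:: false];
                    Map 1 (fun=> [:: true])]) s5 s6.
  apply: (@pdoes_fill mach _ len us) => //.
  - by move=> x; rewrite /s5; find; rewrite s4b.
  - by case=> [|[|[|[|]]]] // _; apply: src => // x; rewrite /s5; find; rewrite ?s40 ?s41.
  - move=> x; rewrite /written /= cats0 flatten_map_seq1 size_nseq.
    by rewrite /class_word2 /enc_word -catA.
pose s7 x := upd (s6 x) 5 (word [:: true; false]).
have H7 : pdoes len (fill mach 5 [:: Lit [:: true; false]]) s6 s7.
  apply: (@pdoes_fill mach _ len us) => //.
  - by move=> x; rewrite /s6 /s5; find; rewrite s4b.
  - by case.
  - exact: pb_const.
have pmark : pb (fun x => size (mark (row_len x))).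
  apply: (@pb_le _ _ _ (fun x => row_len x + 1)); first exact: pb_add pb_row_len (pb_const _ _).
  by move=> x; rewrite size_cat size_nseq.
have Hm o s : 5 < o < 9 -> (forall x, s x o = ([::], 0%R)) ->
    (forall x, s x tP = unary (row_len x)) ->
    pdoes len (fill mach o [:: Map tP (fun=> [:: false]); Lit [:: true]]) s
      (fun x => upd (s x) o (word (mark (row_len x)))).
  move=> ho so sP; apply: (@pdoes_fill mach _ len (fun _ x => nseq (row_len x) true)) => //.
  - by case=> [|[|]] //= _; split; [lia|exact: sP|exact: psz pb_row_len].
  - by move=> x; rewrite /written /= flatten_map_seq1 size_nseq.
pose s8 x := upd (s7 x) 6 (word (mark (row_len x))).
have H8 : pdoes len (fill mach 6 [:: Map tP (fun=> [:: false]); Lit [:: true]]) s7 s8.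
  by apply: (Hm 6 s7) => // x; rewrite /s7 /s6 /s5; find; rewrite ?s4b.
pose s9 x := upd (s8 x) 7 (word (mark (row_len x))).
have H9 : pdoes len (fill mach 7 [:: Map tP (fun=> [:: false]); Lit [:: true]]) s8 s9.
  by apply: (Hm 7 s8) => // x; rewrite /s8 /s7 /s6 /s5; find; rewrite ?s4b.
pose s10 x := upd (s9 x) 8 (word (mark (row_len x))).
have H10 : pdoes len (fill mach 8 [:: Map tP (fun=> [:: false]); Lit [:: true]]) s9 s10.
  by apply: (Hm 8 s9) => // x; rewrite /s9 /s8 /s7 /s6 /s5; find; rewrite ?s4b.
have H11 := @pdoes_move mach _ len 6 Right s10.
set s11 := fun x => upd _ _ _ in H11.
have H12 := @pdoes_move mach _ len 8 Left s11.
set s12 := fun x => upd _ _ _ in H12.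
pose s13 x := upd (s12 x) 9 (unary (hist_len x)).
have H13 : pdoes len (fill mach 9 [:: Map tN (fun=> [:: true])]) s12 s13.
  apply: (@pdoes_fill mach _ len (fun _ x => nseq (hist_len x) true)).
  - by move=> x; rewrite /s12 /s11 /s10 /s9 /s8 /s7 /s6 /s5; find; rewrite s4b.
  - case=> [|] //= _; split; [lia| |exact: psz pb_hist_len].
    by move=> x; rewrite /s12 /s11 /s10 /s9 /s8 /s7 /s6 /s5; find.
  - by move=> x; rewrite /written /= cats0 flatten_map_seq1 size_nseq.
  - exact: psz pb_hist_len.
pose s14 x := upd (s13 x) 10 (word [:: true]).
have H14 : pdoes len (fill mach 10 [:: Lit [:: true]]) s13 s14.
  apply: (@pdoes_fill mach _ len us) => //; [|by case|exact: pb_const].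
  by move=> x; rewrite /s13 /s12 /s11 /s10 /s9 /s8 /s7 /s6 /s5; find; rewrite s4b.
pose s15 x := upd (s14 x) 11 (word [:: true]).
have H15 : pdoes len (fill mach 11 [:: Lit [:: true]]) s14 s15.
  apply: (@pdoes_fill mach _ len us) => //; [|by case|exact: pb_const].
  by move=> x; rewrite /s14 /s13 /s12 /s11 /s10 /s9 /s8 /s7 /s6 /s5; find; rewrite s4b.
exists s15.
  exact: (pdoes_seq H1 (pdoes_seq H2 (pdoes_seq H3 (pdoes_seq H4 (pdoes_seq H5 (pdoes_seq H6
    (pdoes_seq H7 (pdoes_seq H8 (pdoes_seq H9 (pdoes_seq H10 (pdoes_seq H11 (pdoes_seq H12
    (pdoes_seq H13 (pdoes_seq H14 (pdoes_seq H15 (pdoes_nop s15)))))))))))))))).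
move=> x; split=> [|i hi]; last first.
  by rewrite /s15 /s14 /s13 /s12 /s11 /s10 /s9 /s8 /s7 /s6 /s5; find; rewrite s4e.
by split; rewrite /s15 /s14 /s13 /s12 /s11 /s10 /s9 /s8 /s7 /s6 /s5; find; rewrite ?s40 ?s4P ?s4N.
Qed.

End Preparation.

                                                 

(** * The decider *)

Lemma size_flatten_le (T U : Type) (F : T -> seq U) B (l : seq T) :
  (forall i, size (F i) <= B) -> size (flatten [seq F i | i <- l]) <= size l * B.
Proof.
move=> FB; elim: l => //= i l IH.
by rewrite size_cat mulSn leq_add.
Qed.

Section Decider.
Variables (Ma Me Mv : tm) (cw dw cy D : nat).
Hypothesis D_gt0 : 0 < D.
Hypothesis cy_gt1 : 1 < cy.

Definition machines (j : nat) : tm := match j with 0 => Ma | 1 => Me | _ => Mv end.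

Local Notation W := (wit_bound cw dw).
Local Notation P := (row_len cw dw cy D).
Local Notation N := (hist_len cw dw cy D).
Local Notation m := (nkinds Mv).
Local Notation tP := (13 + dw + D).
Local Notation tN := (13 + dw + 2 * D).
Local Notation a0 := (14 + dw + 2 * D).
Local Notation e0 := (15 + dw + 2 * D + tm_extra Ma).
Local Notation v0 := (16 + dw + 2 * D + tm_extra Ma + tm_extra Me).
Local Notation len := (fun x : seq bool => size x).
Local Notation pb := (poly_bounded len).

Lemma base_len_le x : base_len cw dw cy x <= P x.
Proof.
have b0 : 0 < base_len cw dw cy x by rewrite /base_len; lia.
by rewrite /row_len -{1}(expn1 (base_len _ _ _ x)) leq_pexp2l.
Qed.

Lemma row_len_large x : size (enc_word x) + W x < P x.
Proof.
apply: leq_trans (base_len_le x); rewrite size_enc_word /base_len; lia.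
Qed.

Lemma row_len_gt1 x : 1 < P x.
Proof. apply: leq_trans (base_len_le x); rewrite /base_len; lia. Qed.

Definition inst (x : seq bool) : instance := tab_instance Mv (P x) (W x) x.

Section Matrices.
Variables (em : class -> (offset -> bool) -> kind Mv -> seq bool) (G : nat).
Hypothesis emG : forall c f k, size (em c f k) <= G.

Definition read_em (r : seq symbol) (k : kind Mv) : seq bool :=
  em (reads_class r) (reads_near r) k.

Local Notation rl := [:: tP; 3; 4; 5; 6; 7; 8].
Local Notation dl := [:: 5; 6; 7; 8].

Lemma matrix_bits_prepared x s : prepared cw dw cy D x s ->
  matrix_bits_of read_em rl dl (N x) (kinds Mv) s = matrix_bits (P x) (W x) x em.
Proof.
move=> pr; congr flatten; apply: eq_map => l; congr flatten; apply: eq_map => k.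
congr flatten; apply: eq_map => j; rewrite /read_em.
have -> : [seq cell (shift_heads dl (- l%:Z)%R s i).1 ((shift_heads dl (- l%:Z)%R s i).2 + j%:Z)%R
   | i <- rl] = [:: cell (bits (nseq (P x) true)) j; cell (bits (class_word1 (W x) x)) j;
     cell (bits (class_word2 (W x) x)) j;
     cell (bits [:: true; false]) (0 - l%:Z + j%:Z)%R;
     cell (bits (mark (P x))) (1 - l%:Z + j%:Z)%R; cell (bits (mark (P x))) (0 - l%:Z + j%:Z)%R;
     cell (bits (mark (P x))) (-1 - l%:Z + j%:Z)%R].
  rewrite [map _ _]/= /shift_heads /=.
  rewrite (prep_P pr) (prep_1 pr) (prep_2 pr) (prep_d pr) (prep_dL pr) (prep_dP pr) (prep_dR pr).
  by rewrite /= ?add0r.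
have P0 : 0 < P x := ltnW (row_len_gt1 x).
rewrite reads_class_of ?row_len_large //.
set near := reads_near _; have -> // : near = fun o => j == l + dist (P x) o.
by apply/funext => o; rewrite /near (reads_near_dist P0 (row_len_large x)).
Qed.

Definition write_matrix : cmd machines :=
  matrix_prog machines read_em tN a0 9 rl dl (kinds Mv).

Lemma pdoes_matrix s (t : seq bool -> seq bool) :
  (forall x, prepared cw dw cy D x (s x)) ->
  (forall x, s x a0 = (bits (t x), Posz (size (t x)))) ->
  pdoes len write_matrix s
    (fun x => upd (s x) a0 (bits (t x ++ matrix_bits (P x) (W x) x em),
                            Posz (size (t x ++ matrix_bits (P x) (W x) x em)))).
Proof.
move=> pr sa; exists (fun x => matrix_cost G rl dl (N x) (kinds Mv)).
  have pN := pb_hist_len cw dw cy D.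
  apply: pb_mul (pb_add pN (pb_const _ _)) _; apply: pb_add (pb_const _ _).
  apply: pb_add (pb_const _ _); apply: pb_mul (pb_const _ _) _; apply: pb_add (pb_const _ _).
  exact: pb_mul (pb_add pN (pb_const _ _)) (pb_const _ _).
move=> x; have sa' : s x a0 = (bits (t x), Posz (size (bits (t x)))) by rewrite size_bits.
have H := @does_matrix machines _ read_em G (fun r k => emG _ _ _) tN a0 9 rl dl.
have u1 : uniq (tN :: rl) by rewrite /= !inE; lia.
have u2 : {subset dl <= rl} by move=> i; rewrite !inE => ->; rewrite !orbT.
have u3 : a0 \notin tN :: rl by rewrite !inE; lia.
have u4 : 9 \notin [:: a0, tN & rl] by rewrite !inE; lia.
apply: does_ext (H u1 isT u2 u3 u4 (N x) (kinds Mv) (s x) _ (prep_N (pr x)) (prep_cnt (pr x)) sa') _.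
move=> i; rewrite /upd; case: eqP => // _; rewrite matrix_bits_prepared //.
by rewrite /bits map_cat !size_cat !size_map.
Qed.

End Matrices.

Definition bits_bound : nat := m * (1 + size (enc_rat 0) + size (enc_rat 1)).

Lemma arc_bits_bound c f k : size (arc_bits (M := Mv) c f k) <= bits_bound.
Proof. by rewrite size_map /bits_bound leq_pmulr. Qed.

Lemma prob_bits_bound c f k : size (prob_bits (M := Mv) c f k) <= bits_bound.
Proof.
apply: size_flatten_le => k'; case: (_ && _).
  exact: leq_addl.
by rewrite -addnA; exact: (leq_trans (leq_addr _ _) (leq_addl _ _)).
Qed.

Lemma matrix_bits_size em x : (forall c f k, size (em c f k) <= bits_bound) ->
  size (matrix_bits (M := Mv) (P x) (W x) x em) <= N x * (m * (N x * bits_bound)).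
Proof.
move=> emB; rewrite -{1}(size_iota 0 (N x)); apply: size_flatten_le => l.
apply: size_flatten_le => k.
have H := @size_flatten_le _ _ (fun j => em (class_of (P x) (W x) x j) (fun o => j == l + dist (P x) o) k)
  bits_bound (iota 0 (P x * P x)) (fun=> emB _ _ _).
by rewrite size_iota in H.
Qed.

Lemma pb_inst : pb (fun x => size (enc_instance (inst x))).
Proof.
have pN := pb_hist_len cw dw cy D.
apply: (@pb_le _ _ _ (fun x => (N x * m + 1) + ((N x * m + 1) +
   (N x * (m * (N x * bits_bound)) + N x * (m * (N x * bits_bound)))))).
  have p1 : pb (fun x => N x * m + 1) by apply: pb_add (pb_mul pN (pb_const _ _)) (pb_const _ _).
  have p2 : pb (fun x => N x * (m * (N x * bits_bound))).
    exact: pb_mul pN (pb_mul (pb_const _ _) (pb_mul pN (pb_const _ _))).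
  exact: pb_add p1 (pb_add p1 (pb_add p2 p2)).
move=> x; rewrite enc_tab_instance size_cat size_enc_unary size_cat size_enc_unary size_cat !addn1.
have h1 := @matrix_bits_size _ x arc_bits_bound.
have h2 := @matrix_bits_size _ x prob_bits_bound.
by rewrite leq_add2l leq_add2l leq_add.
Qed.

(** The blocks at [a0], [e0] and [v0] belong to the approximation algorithm, the evaluator and the
    verifier. The instance is copied to [e0] before the first call destroys it; the zeros appended
    there encode the empty set, and the description produced by the algorithm completes the
    query. *)
Definition decider : cmd machines :=
  seqs [:: prepare machines cw dw cy D;
    append machines a0 [:: Map tN (fun=> nseq m true); Lit [:: false];
                           Map tN (fun=> nseq m true); Lit [:: false]];
    write_matrix (@arc_bits Mv);
    write_matrix (@prob_bits Mv);
    rewind machines a0 [:: a0];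
    append machines e0 [:: Map a0 (fun b => [:: b]); Map tN (fun=> nseq m false)];
    @Run machines 0 (tm_start Ma) a0;
    each machines a0 e0 (fun c => if c is Some b then bits [:: b] else [::]);
    rewind machines e0 [:: e0];
    @Run machines 1 (tm_start Me) e0;
    append machines v0 [:: Map 0 (fun b => [:: true; b]); Lit [:: false]];
    parse_prog machines e0 10 11 v0 tN 3 4 m;
    rewind machines v0 [:: v0];
    @Run machines 2 (tm_start Mv) v0;
    finish machines v0].

Variables (da : seq bool -> seq bool) (va : seq bool -> nat -> nat) (r : seq bool -> bool).
Variables (ta te tv : seq bool -> nat).
Hypotheses (pta : pb ta) (pte : pb te) (ptv : pb tv).

Definition query_string (x : seq bool) : seq bool :=
  enc_instance (inst x) ++ nseq (N x * m) false ++ da x.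

Definition found_word (x : seq bool) : seq bool :=
  wit_word (P x) (W x) x (@read_off Mv (va x)).

Hypothesis run_a : forall x, computes_within Ma (ta x) (enc_instance (inst x)) (da x).
Hypothesis run_e : forall x,
  computes_within Me (te x) (query_string x) (all_text m (va x) (N x)).
Hypothesis run_v : forall x,
  computes_within Mv (tv x) (enc_word x ++ found_word x) [:: r x].

Lemma pb_da : pb (fun x => size (da x)).
Proof.
apply: (@pb_le _ _ _ (fun x => size (enc_instance (inst x)) + 2 * ta x)).
  exact: pb_add pb_inst (pb_mul (pb_const _ _) pta).
by move=> x; exact: size_tm_output.
Qed.

Lemma pb_query : pb (fun x => size (query_string x)).
Proof.
apply: (@pb_le _ _ _ (fun x => size (enc_instance (inst x)) + (N x * m + size (da x)))).
  apply: pb_add pb_inst (pb_add _ pb_da).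
  exact: pb_mul (pb_hist_len cw dw cy D) (pb_const _ _).
by move=> x; rewrite /query_string size_cat size_cat size_nseq.
Qed.

Lemma pb_text : pb (fun x => size (all_text m (va x) (N x))).
Proof.
apply: (@pb_le _ _ _ (fun x => size (query_string x) + 2 * te x)).
  exact: pb_add pb_query (pb_mul (pb_const _ _) pte).
by move=> x; exact: size_tm_output.
Qed.

Lemma pb_enc_word : pb (fun x => size (enc_word x)).
Proof.
apply: (@pb_le _ _ _ (fun x => size x * 2 + 1)).
  by apply: pb_add (pb_mul (pb_len _) (pb_const _ _)) (pb_const _ _).
by move=> x; rewrite size_enc_word.
Qed.

Lemma pb_found : pb (fun x => size (enc_word x ++ found_word x)).
Proof.
apply: (@pb_le _ _ _ (fun x => size (enc_word x) + W x)).
  exact: pb_add pb_enc_word (pb_wit_bound cw dw).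
move=> x; rewrite size_cat leq_add2l.
exact: size_wit_word (row_len_gt1 x) (row_len_large x) _.
Qed.

Lemma all_wit_found x s : prepared cw dw cy D x s ->
  all_wit 3 4 m s (va x) (N x) = found_word x.
Proof.
move=> pr; congr flatten; apply: eq_map => l.
rewrite /loc_wit (prep_1 pr) (prep_2 pr) addn0 ![(_ + _)%R]/=.
by rewrite (wit_syms_class (ltnW (row_len_gt1 x)) (row_len_large x)).
Qed.

(** Each stage is a [pdoes] triple whose final store starts the next one. What has to be tracked is
    that each call finds its block clean and that the prepared tapes survive until the parsing. *)
Lemma decider_correct : poly_time id enc_bool r.
Proof.
have [s0 H0 prep0] := @prepare_does machines cw dw cy D.
have pr0 x : prepared cw dw cy D x (s0 x) by case: (prep0 x).
have bl0 x i : tN < i -> s0 x i = ([::], 0%R) by case: (prep0 x) => _; apply.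
pose hdr x := enc_unary (N x * m) ++ enc_unary (N x * m).
have pN := pb_hist_len cw dw cy D.
have pN1 : pb (fun x => size (nseq (N x) true)) by apply: pb_le pN _ => x; rewrite size_nseq.
pose st a (u : seq bool -> seq bool) (s : seq bool -> store) x :=
  upd (s x) a (bits (u x), Posz (size (u x))).
have H1 : pdoes len (append machines a0 [:: Map tN (fun=> nseq m true); Lit [:: false];
    Map tN (fun=> nseq m true); Lit [:: false]]) s0 (st a0 hdr s0).
  apply: (@pdoes_append machines _ len (fun _ x => nseq (N x) true) a0 _ s0 (fun=> [::]) hdr).
  - by move=> x; rewrite bl0 //; lia.
  - by case=> [|[|[|[|]]]] //= _; split=> //; try lia; move=> x; rewrite (prep_N (pr0 x)).
  - by move=> x; rewrite /written /= !flatten_map_nseq size_nseq /hdr /enc_unary -!catA.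
set s1 := st _ _ _ in H1.
have prf s u x : prepared cw dw cy D x (s x) -> prepared cw dw cy D x (st a0 u s x).
  by move=> h; apply: prepared_frame h _ => i iN; rewrite /st upd_ne //; lia.
have H2 := @pdoes_matrix _ _ arc_bits_bound s1 hdr (fun x => prf s0 _ _ (pr0 x)) (fun x => upd_eq _ _ _).
pose u2 x := hdr x ++ matrix_bits (P x) (W x) x (@arc_bits Mv).
have {}H2 : pdoes len (write_matrix (@arc_bits Mv)) s1 (st a0 u2 s0).
  by apply: pdoes_ext H2 _ => x i; rewrite /s1 /st /upd; case: eqP.
have H3 := @pdoes_matrix _ _ prob_bits_bound (st a0 u2 s0) u2
  (fun x => prf s0 _ _ (pr0 x)) (fun x => upd_eq _ _ _).
pose g x := enc_instance (inst x).
have gE x : u2 x ++ matrix_bits (P x) (W x) x (@prob_bits Mv) = g x.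
  by rewrite /g enc_tab_instance /u2 /hdr -!catA.
have {}H3 : pdoes len (write_matrix (@prob_bits Mv)) (st a0 u2 s0) (st a0 g s0).
  by apply: pdoes_ext H3 _ => x i; rewrite gE /st /upd; case: eqP.
have H4 := @pdoes_rewind machines _ len a0 (st a0 g s0) g (fun x => upd_eq _ _ _) pb_inst.
pose s4 x := upd (s0 x) a0 (word (g x)).
have {}H4 : pdoes len (rewind machines a0 [:: a0]) (st a0 g s0) s4.
  by apply: pdoes_ext H4 _ => x i; rewrite /st /s4 /upd; case: eqP.
pose us (a : nat) x := if a == a0 then g x else nseq (N x) true.
have us1 x : us a0 x = g x by rewrite /us eqxx.
have us2 x : us tN x = nseq (N x) true by rewrite /us ifF //; lia.
pose q0 x := g x ++ nseq (N x * m) false.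
have H5 : pdoes len (append machines e0 [:: Map a0 (fun b => [:: b]); Map tN (fun=> nseq m false)])
    s4 (st e0 q0 s4).
  apply: (@pdoes_append machines _ len us e0 _ s4 (fun=> [::]) q0).
  - by move=> x; rewrite /s4 upd_ne ?bl0 //; lia.
  - case=> [|[|]] //= _; split; try lia.
    + by move=> x; rewrite us1 /s4 upd_eq.
    + by apply: pb_le pb_inst _ => x; rewrite us1.
    + by move=> x; rewrite us2 /s4 upd_ne ?(prep_N (pr0 x)) //; lia.
    + by apply: pb_le pN _ => x; rewrite us2 size_nseq.
  - move=> x; rewrite /written /= us1 us2 flatten_map_nseq size_nseq cats0 flatten_map1.
    by rewrite map_id.
set s5 := st _ _ _ in H5.
have [|s6 [H6 o6 f6]] := @pdoes_run machines _ len 0 a0 s5 g da ta _ run_a pta.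
  move=> x; split; first by rewrite /s5 /st /s4 upd_ne ?upd_eq //; lia.
  by move=> j /= hj; rewrite /s5 /st /s4 !upd_ne ?bl0 //; lia.
have s6e x : s6 x e0 = (bits (q0 x), Posz (size (q0 x))).
  by rewrite f6 ?/s5 ?/st ?upd_eq //=; lia.
have a0e0 : a0 <> e0 by lia.
have H7 := @pdoes_each machines _ len a0 e0 (fun b => [:: b]) s6 da q0 a0e0 o6 s6e pb_da.
set s7 := fun x => upd _ _ _ in H7.
have s7e x : s7 x e0 = (bits (query_string x), Posz (size (query_string x))).
  by rewrite /s7 upd_eq flatten_map1 map_id -catA.
have H8 := @pdoes_rewind machines _ len e0 s7 query_string s7e pb_query.
set s8 := fun x => upd _ _ _ in H8.
have s8_hi x i : e0 < i -> s8 x i = ([::], 0%R).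
  by move=> hi; rewrite /s8 /s7 !upd_ne ?f6 /=; try lia; rewrite /s5 /st /s4 !upd_ne ?bl0 //; lia.
have s8_lo x i : i <= tN -> s8 x i = s0 x i.
  by move=> hi; rewrite /s8 /s7 !upd_ne ?f6 /=; try lia; rewrite /s5 /st /s4 !upd_ne //; lia.
have [|s9 [H9 o9 f9]] := @pdoes_run machines _ len 1 e0 s8 query_string _ te _ run_e pte.
  move=> x; split; first by rewrite /s8 upd_eq.
  by move=> j /= hj; rewrite s8_hi //; lia.
have s9_lo x i : i <= tN -> s9 x i = s0 x i.
  by move=> hi; rewrite f9 ?s8_lo //=; lia.
have s9_hi x i : v0 <= i -> s9 x i = ([::], 0%R).
  by move=> hi; rewrite f9 ?s8_hi //=; lia.
have pr9 x : prepared cw dw cy D x (s9 x).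
  by apply: prepared_frame (pr0 x) _; exact: s9_lo.
have H10 : pdoes len (append machines v0 [:: Map 0 (fun b => [:: true; b]); Lit [:: false]])
    s9 (st v0 enc_word s9).
  apply: (@pdoes_append machines _ len (fun _ x => x) v0 _ s9 (fun=> [::]) enc_word).
  - by move=> x; rewrite s9_hi.
  - case=> [|[|]] //= _; split; [lia| |exact: pb_len].
    by move=> x; rewrite (prep_x (pr9 x)).
  - by move=> x.
set s10 := st _ _ _ in H10.
have pr10 x : prepared cw dw cy D x (s10 x).
  by apply: prepared_frame (pr9 x) _ => i hi; rewrite /s10 /st upd_ne //; lia.
pose s11 x := shift_heads [:: tN; 3; 4] (N x)%:Z
  (upd (upd (s10 x) e0 ((s10 x e0).1, (s10 x e0).2 + (size (all_text m (va x) (N x)))%:Z)%R) v0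
    (bits (enc_word x ++ found_word x), Posz (size (enc_word x ++ found_word x)))).
have H11 : pdoes len (parse_prog machines e0 10 11 v0 tN 3 4 m) s10 s11.
  exists (fun x => N x * (5 * size (all_text m (va x) (N x)) + 51) + 1).
    apply: pb_add (pb_const _ _); apply: pb_mul pN _; apply: pb_add (pb_const _ _).
    exact: pb_mul (pb_const _ _) pb_text.
  move=> x; have un : uniq [:: e0; 10; 11; v0; tN; 3; 4] by rewrite /= !inE; lia.
  have so : s10 x v0 = (bits (enc_word x), Posz (size (bits (enc_word x)))).
    by rewrite /s10 /st upd_eq size_bits.
  have se : s10 x e0 = s9 x e0 by rewrite /s10 /st upd_ne //; lia.
  have rd : reads_at (s10 x e0).1 (s10 x e0).2 (all_text m (va x) (N x)).
    by rewrite se; case: (o9 x).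
  have H := does_parse machines un (nkinds_ge4 Mv) (prep_N (pr10 x)) (surjective_pairing _) rd
    (prep_re (pr10 x)) (prep_rb (pr10 x)) so.
  have bc : bits (enc_word x) ++ bits (found_word x) = bits (enc_word x ++ found_word x).
    by rewrite /bits map_cat.
  by rewrite addn1; apply: does_ext H _ => i; rewrite /s11 all_wit_found // bc size_bits.
have s11v x : s11 x v0 = (bits (enc_word x ++ found_word x), Posz (size (enc_word x ++ found_word x))).
  by rewrite /s11 /shift_heads ifF ?upd_eq // !inE; lia.
have H12 := @pdoes_rewind machines _ len v0 s11 (fun x => enc_word x ++ found_word x) s11v pb_found.
set s12 := fun x => upd _ _ _ in H12.
have [|s13 [H13 o13 f13]] := @pdoes_run machines _ len 2 v0 s12
    (fun x => enc_word x ++ found_word x) (fun x => [:: r x]) tv _ run_v ptv.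
  move=> x; split; first by rewrite /s12 upd_eq.
  move=> j /= hj; rewrite /s12 upd_ne; last by lia.
  rewrite /s11 /shift_heads ifF; last by rewrite !inE; lia.
  by rewrite !upd_ne ?/s10 ?/st ?upd_ne ?s9_hi //; lia.
have s13_0 x : s13 x 0 = (bits x, Posz 0).
  rewrite f13 /=; last by lia.
  have -> : s12 x 0 = s11 x 0 by rewrite /s12 upd_ne //; lia.
  rewrite /s11; have -> u d : shift_heads [:: tN; 3; 4] d u 0 = u 0 by [].
  by rewrite !upd_ne ?(prep_x (pr10 x)) //; lia.
have v00 : v0 <> 0 by lia.
have [s14 H14 o14] := @pdoes_finish machines _ len v0 s13 (fun x => x) (fun=> 0) r v00 s13_0
  (fun=> leq0n _) o13 (pb_len _).
apply: (@poly_time_prog _ id machines decider s14 _ enc_bool r _ o14).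
apply: (pdoes_seq H0).
apply: (pdoes_seq H1).
apply: (pdoes_seq H2).
apply: (pdoes_seq H3).
apply: (pdoes_seq H4).
apply: (pdoes_seq H5).
apply: (pdoes_seq H6).
apply: (pdoes_seq H7).
apply: (pdoes_seq H8).
apply: (pdoes_seq H9).
apply: (pdoes_seq H10).
apply: (pdoes_seq H11).
apply: (pdoes_seq H12).
apply: (pdoes_seq H13).
apply: (pdoes_seq H14).
exact: pdoes_nop.
Qed.

End Decider.

(** * From an approximation algorithm to P = NP *)

Lemma row_len_time cw dw cV dV x n :
  n <= size (enc_word x) + wit_bound cw dw x ->
  (cV * n ^ dV + cV).+1 < row_len cw dw (2 * cV + 3) dV.+1 x.
Proof.
rewrite size_enc_word /row_len /base_len; set y := _ + _ + (_ + 3) => ny.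
have {ny} [ny yc] : n <= y /\ 2 * cV + 3 <= y by rewrite /y; lia.
have y0 : 0 < y ^ dV by rewrite expn_gt0; lia.
have : n ^ dV <= y ^ dV by case: (dV) => [|e]; rewrite ?expn0 ?leq_exp2r.
rewrite expnS; move: (n ^ dV) (y ^ dV) y0 => a b b0 ab.
apply: leq_trans (leq_mul yc (leqnn b)); nia.
Qed.

Lemma min_expected_time_ge0 (R : realType) (I : instance) :
  (forall (i : workers I) j, prob i j = 0%R \/ prob i j = 1%R) ->
  (0 <= min_expected_time R I)%E.
Proof.
move=> p01; apply: le_ereal_inf_tmp => _ [s rs <-].
have [ex|nex] := pselect (exists k, finished (det_run s k)).
  have [k fk] := ex; have [K _ [fK aK]] := first_finish fk.
  by rewrite (expected_time_finish p01 R fK aK) lee_fin.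
by rewrite (expected_time_never p01) ?leey // => k; apply/negP => fk; apply: nex; exists k.
Qed.

Lemma enc_set0 (I : instance) : enc_set (finset.set0 : {set tasks I}) = nseq (ntasks I) false.
Proof.
rewrite /enc_set (eq_map (finset.in_set0 (T := tasks I))) -(size_enum_ord (ntasks I)).
by elim: (enum _) => //= _ l ->.
Qed.

Section Reduction.
Local Open Scope ring_scope.

Lemma approx_lt4 (R : realType) (rho : R) (e m : \bar R) : rho < 5%:R / 4%:R ->
  (0 <= m)%E -> (m <= 3%:R%:E)%E -> (e <= rho%:E * m)%E -> (e < 4%:R%:E)%E.
Proof.
move=> hr m0 m3 em; apply: le_lt_trans em _.
move: m0 m3; case: m => [m| |]; rewrite ?leye_eq ?leeNy_eq // !lee_fin => m0 m3.
rewrite -EFinM lte_fin.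
(* For a nonpositive ratio the product is at most 0; otherwise it is at most [3 * rho], which is
   below 15/4. *)
have [r0|r0] := leP rho 0.
  by apply: (@le_lt_trans _ _ 0); [exact: mulr_le0_ge0|rewrite ltr0n].
apply: (@le_lt_trans _ _ (rho * 3%:R)); first by rewrite ler_pM2l.
apply: (@lt_trans _ _ (5%:R / 4%:R * 3%:R)); first by rewrite ltr_pM2r ?ltr0n.
by rewrite mulrAC ltr_pdivrMr ?ltr0n // -!natrM ltr_nat.
Qed.

End Reduction.

(** The decider never measures a regimen: it tests the witness found by the verifier, so only inputs
    in L require the guarantee on the approximation. *)
Lemma classNP_sub_classP (R : realType) (rho : R) : (rho < 5%:R / 4%:R)%R ->
  poly_time_approximable rho -> forall L, classNP L -> classP L.
Proof.
move=> hr [ev [alg [[Me [ce [de he]]] [Ma [ca [da ha]]] apx]]] L [V [cw [dw [[Mv [cV [dV hV]]] hL]]]].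
pose cy := 2 * cV + 3; pose D := dV.+1.
have cy1 : 1 < cy by rewrite /cy; lia.
pose I x := inst Mv cw dw cy D x.
have Pgt1 x : 1 < row_len cw dw cy D x by apply: row_len_gt1.
have Plarge x : size (enc_word x) + wit_bound cw dw x < row_len cw dw cy D x by apply: row_len_large.
(* The regimen is chosen classically from the guarantee. Its first round is nevertheless computable,
   being the value of [ev] on the output of [alg]. *)
pose s x := projT1 (cid (apx (I x))); have hs x := projT2 (cid (apx (I x))).
pose va x := assigned (s x).
pose fw x := found_word Mv cw dw cy D va x.
pose r x := V (x, fw x).
have fwW x : size (fw x) <= wit_bound cw dw x by exact: size_wit_word.
have timeP x w : size w <= wit_bound cw dw x ->
    (cV * size (enc_word x ++ w) ^ dV + cV).+1 < row_len cw dw cy D x.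
  by move=> wW; apply: row_len_time; rewrite size_cat leq_add2l.
exists r; split; last first.
  move=> x; rewrite hL; split=> [[w [wW Vw]]|Vr]; last by exists (fw x).
  have [rs _ ap] := hs x.
  have m3 : (min_expected_time R (I x) <= 3%:R%:E)%E.
    apply: (min_time_tab (Pgt1 x) (Plarge x) R wW _ (timeP x w wW)).
    by have := hV (x, w); rewrite Vw.
  have lt4 : (expected_time (s x) R < 4%:R%:E)%E.
    apply: approx_lt4 hr _ m3 ap.
    by apply: min_expected_time_ge0; exact: gadget_prob01.
  exact: (extract_tab (Pgt1 x) (Plarge x) rs lt4 (hV (x, fw x)) (timeP x _ (fwW x))).
pose ta x := ca * size (enc_instance (I x)) ^ da + ca.
pose dx x := alg (I x).
pose te x := ce * size (query_string Mv cw dw cy D dx x) ^ de + ce.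
pose tv x := cV * size (enc_word x ++ fw x) ^ dV + cV.
have pa : poly_bounded (fun x : seq bool => size x) ta by apply: pb_poly; exact: pb_inst.
have qE x : enc_query (@Query (I x) finset.set0 (alg (I x))) = query_string Mv cw dw cy D dx x.
  change (enc_instance (I x) ++ enc_set (finset.set0 : {set tasks (I x)}) ++ dx x =
    query_string Mv cw dw cy D dx x).
  by rewrite enc_set0.
have ra x : computes_within Ma (ta x) (enc_instance (I x)) (dx x) by exact: ha.
apply: (@decider_correct Ma Me Mv cw dw cy D isT cy1 dx va r ta te tv pa _ _ ra _ _).
- by apply: pb_poly; apply: pb_query pa ra.
- by apply: pb_poly; apply: pb_found.
- move=> x; rewrite /te -qE.
  have [_ ds _] := hs x.
  (* The empty set satisfies the precedence constraints, so the description determines the regimen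
     there. *)
  have <- : ev (@Query (I x) finset.set0 (alg (I x))) = all_text (nkinds Mv) (va x) (hist_len cw dw cy D x).
    rewrite ds; first exact: enc_assignment_tab.
    by apply/forall_inP => v; rewrite finset.in_set0.
  exact: he.
- by move=> x; exact: (hV (x, fw x)).
Qed.

Local Open Scope ring_scope.

Theorem theorem4p7 (R : realType) (hPNP : classP <> classNP) (rho : R)
  (hrho : rho < 5%:R / 4%:R) : ~ poly_time_approximable rho.
Proof.
move=> apx; apply: hPNP; apply/seteqP; split=> L; first exact: classP_sub_classNP.
exact: classNP_sub_classP hrho apx L.
Qed.
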